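(* Let $\mathcal{M}^{eq}$ be $MS$-measurable and $\omega$-categorical with $\mathrm{acl}^{eq}(\emptyset)=\mathrm{dcl}^{eq}(\emptyset)$, with dimension-measure $h=(\mathrm{d},\mu)$. Suppose that $a_1,a_2,a_3$ are tuples from $\mathcal{M}^{eq}$ which are pairwise non-forking independent over $\emptyset$, i.e. $a_i$ is independent from $a_j$ over $\emptyset$ for $1\leq i<j\leq 3$. Then $$\mathrm{d}(\mathrm{tp}(a_3/a_1)\cup\mathrm{tp}(a_3/a_2))=\mathrm{d}(a_3)$$ and $$\mu(\mathrm{tp}(a_3/a_1)\cup\mathrm{tp}(a_3/a_2))=\frac{\mu(a_3/a_1)\,\mu(a_3/a_2)}{\mu(a_3)}.$$
   Context: For a structure $\mathcal{M}$, $\mathrm{Def}(M)$ is the set of non-empty subsets of the powers $M^n$ ($n\ge 1$) definable with parameters. $\mathcal{M}$ is $MS$-measurable with dimension-measure $h:\mathrm{Def}(M)\to\mathbb{N}\times\mathbb{R}^{>0}$, $h(X)=(\mathrm{d}(X),\mu(X))$, if: (1) for each formula $\phi(\overline{x},\overline{y})$, $h(\phi(M^{|\overline{x}|},\overline{a}))$ takes finitely many values as $\overline{a}$ varies, and for each value $v$ the set of $\overline{a}$ with $h(\phi(M^{|\overline{x}|},\overline{a}))=v$ is $\emptyset$-definable; (2) $h(\{\overline{a}\})=(0,1)$ for every $\overline{a}\in M^n$; (3) for disjoint definable $X,Y\subseteq M^n$, $\mu(X\cup Y)=\mu(X)+\mu(Y)$ if $\mathrm{d}(X)=\mathrm{d}(Y)$,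 and $\mu(X\cup Y)=\mu(Y)$ if $\mathrm{d}(X)<\mathrm{d}(Y)$ [$\mathrm{d}$ being a dimension, $\mathrm{d}(X\cup Y)=\max\{\mathrm{d}(X),\mathrm{d}(Y)\}$]; (4) (Fubini) if $X\subseteq M^n$ is definable, $\pi:M^n\to M^m$ ($1\le m<n$) is a projection to $m$ coordinates, and $h(\pi^{-1}(\overline{a})\cap X)=(k,\nu)$ for all $\overline{a}\in\pi(X)$, then $\mathrm{d}(X)=\mathrm{d}(\pi(X))+k$ and $\mu(X)=\mu(\pi(X))\nu$. A many-sorted structure such as $\mathcal{M}^{eq}$ is $MS$-measurable if each restriction to finitely many sorts is; if $\mathcal{M}$ is $MS$-measurable, then so is $\mathcal{M}^{eq}$, and $h$ on $\mathcal{M}$ induces a single well-defined $h$ on all definable sets of $\mathcal{M}^{eq}$ satisfying these conditions on every finite set of sorts. $MS$-measurable structures are supersimple. For a partial type $\pi$ over a finite set in an $\omega$-categorical structure, the set of its realisations is definable, and $\mathrm{d}(\pi),\mu(\pi)$ denote the dimension and measure of this set. Also $\mathrm{d}(a/b),\mu(a/b)$ denote $\mathrm{d}(\mathrm{tp}(a/b)),\mu(\mathrm{tp}(a/b))$, and $\mathrm{d}(a),\mu(a)$ denote $\mathrm{d}(\mathrm{tp}(a/\emptyset)),\mu(\mathrm{tp}(a/\emptyset))$. *)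

(* Defs.v *)
From Stdlib Require List.
From HB Require Import structures.
From mathcomp Require Import all_boot all_order all_algebra.
From mathcomp Require Import boolp classical_sets functions cardinality reals.
Set Implicit Arguments. Unset Strict Implicit. Unset Printing Implicit Defensive.
Import Order.TTheory GRing.Theory Num.Theory.
Local Open Scope classical_set_scope.

(** * Many-sorted first-order logic, with well-sorted de Bruijn syntax.
    A list of sorts [c] serves both as the context of the free variables of a
    formula and as the name of the product of sorts [tup N c]. *)

Fixpoint htup (S : Type) (T : S -> Type) (c : seq S) : Type :=
  if c is s :: c' then (T s * htup T c')%type else unit.

Fixpoint hcat (S : Type) (T : S -> Type) (c d : seq S) :
    htup T c -> htup T d -> htup T (c ++ d) :=
  match c with
  | [::] => fun _ y => y
  | s :: c' => fun x y => (x.1, hcat x.2 y)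
  end.

Fixpoint hmap (S : Type) (T U : S -> Type) (f : forall s, T s -> U s)
    (c : seq S) : htup T c -> htup U c :=
  match c with
  | [::] => fun _ => tt
  | s :: c' => fun x => (f s x.1, hmap f x.2)
  end.

(* Projection to the coordinates selected by the bit mask [b]. *)
Fixpoint hproj (S : Type) (T : S -> Type) (b : bitseq) (c : seq S) :
    htup T c -> htup T (mask b c) :=
  match b, c with
  | true :: b', s :: c' => fun x => (x.1, @hproj S T b' c' x.2)
  | false :: b', s :: c' => fun x => @hproj S T b' c' x.2
  | [::], _ => fun _ => tt
  | _ :: _, [::] => fun _ => tt
  end.

Record lang := Lang {
  Sort : Type;
  Fun : Type;
  fn_dom : Fun -> seq Sort;
  fn_cod : Fun -> Sort;
  Rel : Type;
  rel_ar : Rel -> seq Sort }.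

Inductive var (S : Type) : seq S -> S -> Type :=
| vz s c : var (s :: c) s
| vs s s' c : var c s -> var (s' :: c) s.

Inductive term (L : lang) (c : seq (Sort L)) : Sort L -> Type :=
| tvar s : var c s -> term c s
| tapp f : terms c (fn_dom f) -> term c (fn_cod f)
with terms (L : lang) (c : seq (Sort L)) : seq (Sort L) -> Type :=
| tnil : terms c [::]
| tcons s d : term c s -> terms c d -> terms c (s :: d).

Inductive form (L : lang) (c : seq (Sort L)) : Type :=
| fbot
| feq s of term c s & term c s
| frel r of terms c (rel_ar r)
| fimp of form c & form c
| fall s of form (s :: c).

Record structure (L : lang) := Structure {
  car :> Sort L -> Type;
  car_inh : forall s, inhabited (car s);
  fn_int : forall f : Fun L, htup car (fn_dom f) -> car (fn_cod f);
  rel_int : forall r : Rel L, htup car (rel_ar r) -> Prop }.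

Definition tup (L : lang) (N : structure L) (c : seq (Sort L)) : Type :=
  htup (car N) c.

Fixpoint lookup (S : Type) (T : S -> Type) (c : seq S) (s : S) (v : var c s) :
    htup T c -> T s :=
  match v in var c s return htup T c -> T s with
  | vz _ _ => fun x => x.1
  | vs _ _ _ v' => fun x => lookup v' x.2
  end.

Fixpoint eval (L : lang) (N : structure L) (c : seq (Sort L)) (x : tup N c)
    (s : Sort L) (t : term c s) : N s :=
  match t with
  | tvar _ v => lookup v x
  | tapp f ts => fn_int (evals x ts)
  end
with evals (L : lang) (N : structure L) (c : seq (Sort L)) (x : tup N c)
    (d : seq (Sort L)) (ts : terms c d) : tup N d :=
  match ts with
  | tnil => tt
  | tcons _ _ t ts' => (eval x t, evals x ts')
  end.

Fixpoint sat (L : lang) (N : structure L) (c : seq (Sort L)) (phi : form c) :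
    tup N c -> Prop :=
  match phi with
  | fbot => fun _ => False
  | feq _ t u => fun x => eval x t = eval x u
  | frel r ts => fun x => rel_int (evals x ts)
  | fimp p q => fun x => sat p x -> sat q x
  | fall s p => fun x => forall a : N s, sat p ((a, x) : tup N (s :: c))
  end.
Arguments sat {L} N {c} phi _.

(** * Formulas with parameters, definable sets, types *)

Definition elt (L : lang) (N : structure L) : Type := {s : Sort L & N s}.

Fixpoint elts (L : lang) (N : structure L) (c : seq (Sort L)) :
    tup N c -> set (elt N) :=
  match c with
  | [::] => fun _ => set0
  | s :: c' => fun x => [set existT (car N) s x.1] `|` @elts L N c' x.2
  end.

(* The formula [pfm](x, [ppar]) in the free variables [x]. *)
Record pform (L : lang) (N : structure L) (x : seq (Sort L)) := PForm {
  pctx : seq (Sort L);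
  pfm : form (x ++ pctx);
  ppar : tup N pctx }.

Definition psat (L : lang) (N : structure L) x (phi : pform N x) :
    set (tup N x) :=
  [set a | sat N (pfm phi) (hcat a (ppar phi))].

Definition over (L : lang) (N : structure L) (A : set (elt N)) x
    (phi : pform N x) : Prop :=
  elts (ppar phi) `<=` A.

Definition definable_over (L : lang) (N : structure L) (A : set (elt N)) x
    (X : set (tup N x)) : Prop :=
  exists2 phi : pform N x, over A phi & X = psat phi.

Definition tp (L : lang) (N : structure L) x (a : tup N x) (A : set (elt N)) :
    set (pform N x) :=
  [set phi | over A phi /\ psat phi a].

Definition realisations (L : lang) (N : structure L) x
    (p : set (pform N x)) : set (tup N x) :=
  [set a | forall phi, p phi -> psat phi a].

Definition acl (L : lang) (N : structure L) (A : set (elt N)) : set (elt N) :=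
  [set e | exists phi : pform N [:: projT1 e],
     [/\ over A phi, psat phi (projT2 e, tt) & finite_set (psat phi)]].

Definition dcl (L : lang) (N : structure L) (A : set (elt N)) : set (elt N) :=
  [set e | exists2 phi : pform N [:: projT1 e],
     over A phi & psat phi = [set (projT2 e, tt)]].

(** * Elementary embeddings, omega-categoricity *)

Definition elementary (L : lang) (N N' : structure L)
    (f : forall s, N s -> N' s) : Prop :=
  forall c (phi : form c) (a : tup N c), sat N phi a <-> sat N' phi (hmap f a).

Definition isomorphic (L : lang) (N N' : structure L) : Prop :=
  exists f : forall s, N s -> N' s,
    [/\ forall s, bijective (f s),
        forall g (x : tup N (fn_dom g)),
          f _ (fn_int x) = fn_int (hmap f x : tup N' (fn_dom g))
      & forall r (x : tup N (rel_ar r)),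
          rel_int x <-> rel_int (hmap f x : tup N' (rel_ar r))].

Definition elem_equiv (L : lang) (N N' : structure L) : Prop :=
  forall phi : form [::], sat N phi tt <-> sat N' phi tt.

Definition countable_lang (L : lang) : Prop :=
  [/\ countable [set: Sort L], countable [set: Fun L] & countable [set: Rel L]].

Definition countably_infinite (L : lang) (N : structure L) : Prop :=
  exists f : elt N -> nat, bijective f.

(* Th(N) has exactly one countably infinite model up to isomorphism. *)
Definition omega_categorical (L : lang) (N : structure L) : Prop :=
  countable_lang L /\
  exists N0 : structure L,
    [/\ elem_equiv N N0, countably_infinite N0
      & forall N1 : structure L, elem_equiv N N1 -> countably_infinite N1 ->
          isomorphic N0 N1].

(** * Dividing, forking, independence.
    Instead of a monster model, the witnesses are taken in arbitrary
    elementary extensions. *)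

Definition elt_map (L : lang) (N N' : structure L) (f : forall s, N s -> N' s)
    (e : elt N) : elt N' :=
  existT (car N') (projT1 e) (f _ (projT2 e)).

Definition pform_map (L : lang) (N N' : structure L)
    (f : forall s, N s -> N' s) x (phi : pform N x) : pform N' x :=
  PForm (pfm phi) (hmap f (ppar phi) : tup N' (pctx phi)).

(* phi(x, b) divides over A: for some k there is a sequence (b_i) of
   realisations of tp(b/A) such that {phi(x, b_i)} is k-inconsistent. *)
Definition divides (L : lang) (N : structure L) (A : set (elt N)) x
    (phi : pform N x) : Prop :=
  exists (N' : structure L) (f : forall s, N s -> N' s)
         (b_ : nat -> tup N' (pctx phi)) (k : nat),
    [/\ elementary f,
        forall i, tp (b_ i) (elt_map f @` A) =
                  tp (hmap f (ppar phi) : tup N' (pctx phi)) (elt_map f @` A)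
      & forall j : 'I_k -> nat, injective j ->
          ~ exists a : tup N' x,
              forall i, psat (PForm (pfm phi) (b_ (j i))) a].

(* p forks over A: p implies a finite disjunction of formulas psi_j, with
   parameters in some elementary extension, each of which divides over A. *)
Definition forks (L : lang) (N : structure L) (A : set (elt N)) x
    (p : set (pform N x)) : Prop :=
  exists (N' : structure L) (f : forall s, N s -> N' s) (m n : nat)
         (phi_ : 'I_m -> pform N x) (psi_ : 'I_n -> pform N' x),
    [/\ elementary f,
        forall i, p (phi_ i),
        forall j, divides (elt_map f @` A) (psi_ j)
      & forall a : tup N' x, (forall i, psat (pform_map f (phi_ i)) a) ->
          exists j, psat (psi_ j) a].

Definition indep (L : lang) (N : structure L) (A : set (elt N)) x y
    (a : tup N x) (b : tup N y) : Prop :=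
  ~ forks A (tp a (A `|` elts b)).

(** * The structure M^eq *)

(* One sort for each 0-definable equivalence relation on a product of sorts of
   M, in addition to the sorts of M themselves. *)
Record eqsort (L : lang) (M : structure L) := EqSort {
  es_ctx : seq (Sort L);
  es_rel : form (es_ctx ++ es_ctx);
  es_pos : (0 < size es_ctx)%N;
  es_refl : forall a : tup M es_ctx, sat M es_rel (hcat a a);
  es_sym : forall a b : tup M es_ctx,
    sat M es_rel (hcat a b) -> sat M es_rel (hcat b a);
  es_trans : forall a b c : tup M es_ctx,
    sat M es_rel (hcat a b) -> sat M es_rel (hcat b c) ->
    sat M es_rel (hcat a c) }.

Definition eqclass (L : lang) (M : structure L) (E : eqsort M)
    (a : tup M (es_ctx E)) : set (tup M (es_ctx E)) :=
  [set b | sat M (es_rel E) (hcat a b)].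

Definition eqcar (L : lang) (M : structure L) (s : Sort L + eqsort M) : Type :=
  match s with
  | inl s => M s
  | inr E => {C : set (tup M (es_ctx E)) | exists a, C = eqclass a}
  end.

(* The function symbols added to L are the quotient maps. *)
Definition Leq (L : lang) (M : structure L) : lang := {|
  Sort := Sort L + eqsort M;
  Fun := Fun L + eqsort M;
  fn_dom f := match f with
              | inl g => map inl (fn_dom g)
              | inr E => map inl (es_ctx E)
              end;
  fn_cod f := match f with inl g => inl (fn_cod g) | inr E => inr E end;
  Rel := Rel L;
  rel_ar r := map inl (rel_ar r) |}.

Fixpoint hreal (L : lang) (M : structure L) (c : seq (Sort L)) :
    htup (@eqcar L M) (map inl c) -> tup M c :=
  match c with
  | [::] => fun _ => tt
  | s :: c' => fun x => (x.1, @hreal L M c' x.2)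
  end.

Lemma htup_inh (S : Type) (T : S -> Type) (c : seq S) :
  (forall s, inhabited (T s)) -> inhabited (htup T c).
Proof.
by move=> h; elim: c => [|s c [y]]; [exists | have [x] := h s; exists].
Qed.

Lemma eqcar_inh (L : lang) (M : structure L) (s : Sort (Leq M)) :
  inhabited (eqcar s).
Proof.
case: s => [s|E]; first exact: car_inh.
have [a] := htup_inh (es_ctx E) (@car_inh _ M).
by exists; exists (eqclass a); exists a.
Qed.

Definition Meq (L : lang) (M : structure L) : structure (Leq M) :=
  @Structure (Leq M) (@eqcar L M) (@eqcar_inh L M)
    (fun f => match f return
         htup (@eqcar L M) (@fn_dom (Leq M) f) -> eqcar (@fn_cod (Leq M) f)
       with
       | inl g => fun x => fn_int (hreal x)
       | inr E => fun x => exist _ (eqclass (hreal x)) (ex_intro _ _ erefl)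
       end)
    (fun r x => rel_int (hreal x : tup M (@rel_ar L r))).

Definition onesorted (F P : Type) (arF : F -> nat) (arP : P -> nat) : lang := {|
  Sort := unit;
  Fun := F;
  fn_dom f := nseq (arF f) tt;
  fn_cod _ := tt;
  Rel := P;
  rel_ar r := nseq (arP r) tt |}.

(** * MS-measurability *)

(* Only the values of [h] on non-empty definable sets in non-empty contexts
   are meaningful; dimension first, measure second. *)
Definition dim_meas (R : realType) (L : lang) (N : structure L) : Type :=
  forall c : seq (Sort L), set (tup N c) -> nat * R.

Section MS.
Variables (R : realType) (L : lang) (N : structure L) (h : dim_meas R N).
Local Open Scope ring_scope.

Definition dm (c : seq (Sort L)) (X : set (tup N c)) : nat := (h X).1.
Definition ms (c : seq (Sort L)) (X : set (tup N c)) : R := (h X).2.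

Definition in_sorts (S : set (Sort L)) (c : seq (Sort L)) : Prop :=
  List.Forall S c.

(* Def of the restriction of N to the sorts in S. *)
Definition Def (S : set (Sort L)) (c : seq (Sort L)) (X : set (tup N c)) : Prop :=
  [/\ (0 < size c)%N, in_sorts S c,
      definable_over [set e : elt N | S (projT1 e)] X & X !=set0].

Definition fibre (x y : seq (Sort L)) (phi : form (x ++ y)) (a : tup N y) :
    set (tup N x) :=
  [set b | sat N phi (hcat b a)].

(* The restriction of N to the sorts in S, with all the 0-definable structure
   induced by N, satisfies the axioms. *)
Record MS_measurable_on (S : set (Sort L)) : Prop := {
  MS_pos : forall c (X : set (tup N c)), Def S X -> 0 < ms X;
  MS_finite : forall x y (phi : form (x ++ y)),
    (0 < size x)%N -> in_sorts S x -> in_sorts S y ->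
    finite_set [set v : nat * R |
      exists a : tup N y, fibre phi a !=set0 /\ h (fibre phi a) = v];
  MS_definable : forall x y (phi : form (x ++ y)) (v : nat * R),
    (0 < size x)%N -> in_sorts S x -> in_sorts S y ->
    definable_over set0
      [set a : tup N y | fibre phi a !=set0 /\ h (fibre phi a) = v];
  MS_point : forall c (a : tup N c), (0 < size c)%N -> in_sorts S c ->
    h [set a] = (0%N, 1);
  MS_dimU : forall c (X Y : set (tup N c)), Def S X -> Def S Y ->
    X `&` Y = set0 -> dm (X `|` Y) = maxn (dm X) (dm Y);
  MS_measU_eq : forall c (X Y : set (tup N c)), Def S X -> Def S Y ->
    X `&` Y = set0 -> dm X = dm Y -> ms (X `|` Y) = ms X + ms Y;
  MS_measU_lt : forall c (X Y : set (tup N c)), Def S X -> Def S Y ->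
    X `&` Y = set0 -> (dm X < dm Y)%N -> ms (X `|` Y) = ms Y;
  MS_fubini : forall c (X : set (tup N c)) (b : bitseq) (k : nat) (nu : R),
    Def S X -> size b = size c -> (0 < count id b < size c)%N ->
    (forall a : tup N (mask b c),
       (@hproj _ (car N) b c @` X) a ->
       h ((@hproj _ (car N) b c @^-1` [set a] `&` X) : set (tup N c)) = (k, nu)) ->
    let piX : set (tup N (mask b c)) := @hproj _ (car N) b c @` X in
    dm X = (dm piX + k)%N /\ ms X = ms piX * nu }.

Definition MS_measurable : Prop :=
  forall S : set (Sort L), finite_set S -> MS_measurable_on S.

End MS.

(* Main.v *)
From Pilot Require Import Defs.
From mathcomp Require Import all_boot all_order all_algebra.
From mathcomp Require Import boolp classical_sets functions cardinality reals.
From mathcomp Require Import ring lra zify.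
Import Pilot.Defs.
Set Implicit Arguments. Unset Strict Implicit. Unset Printing Implicit Defensive.
Import Order.TTheory GRing.Theory Num.Theory.
Local Open Scope classical_set_scope.

(** Normalise the measure on X = tp(a3) and put
    f(b,c) = m(tp(a3/a1)_b /\ tp(a3/a2)_c), the inner product in L^2(X) of the
    indicators of the two conjugate sets, for b in Z = tp(a1), c in Y = tp(a2).
    By Fubini the mean of f over either variable is
    ll' = m(tp(a3/a1)) m(tp(a3/a2)).

    Let delta(c,c') be the squared L^2(Z)-distance of f(.,c) and f(.,c').  Were
    there infinitely many c_i in Y with pairwise nonzero delta, Ramsey would
    make m(tp(a3/a2)_{c_i} /\ tp(a3/a2)_{c_j}) and delta(c_i,c_j) independent
    of i <> j; the differences of consecutive indicators would then be
    orthogonal, and Bessel's inequality would bound their number.  So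
    delta = 0 is a 0-definable equivalence relation with finitely many classes
    on a complete type, and acl(0) = dcl(0) leaves only one class.  Hence
    int_b f(b,c) f(b,c') does not depend on c'; averaging over c' shows that it
    equals (ll')^2, so f(.,c) has variance 0 and f(b,c) = ll' for every b with
    d(b/c) = d(b).

    Non-forking gives these equalities of dimensions: if d(a/b) < d(a), then
    along a sequence of generic conjugates b_i each new instance of tp(a/b)
    lowers the dimension, so the instances are (d(a)+1)-inconsistent.

    Omega-categoricity enters through Ryll-Nardzewski: there are finitely many
    types in each context, so that definability amounts to invariance under
    equality of types. *)

(** * Changes of variables and 0-definable sets *)

(** After Ryll-Nardzewski everything happens in [Meq M] itself. Instead of saturation two
    consequences of having finitely many types are used: equal types extend ([eqv_extend]), and an
    integral depends only on the type of its parameters ([integ_eqv]). So overlaps and delta take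
    finitely many values, which is the finite colouring Ramsey needs, and delta = 0 is an invariant
    relation.

    Bessel's bound is pointwise in b; integrated over b it reads n delta <= 2 for every n. The
    differences use disjoint pairs of indices, so that the four terms of each inner product cancel.

    An obstacle in applying acl(0) = dcl(0) is that the equivalence relation lives on tuples of
    M^eq, while a sort of M^eq is a quotient of a product of sorts of M. The relation is therefore
    pulled back to representatives, which requires translating formulas between M and M^eq.

    The equality of dimensions comes with that of measures: ll' is positive, so the intersection can
    be neither empty nor of smaller dimension. As h means nothing on empty sets or empty contexts,
    these cases are split off throughout. *)

Section Tuples.
Variable S : Type.
Implicit Types c d : seq S.

Lemma hmap_hmap (T U V : S -> Type) (f : forall s, T s -> U s)
    (g : forall s, U s -> V s) c (x : htup T c) :
  hmap g (hmap f x) = hmap (fun s a => g s (f s a)) x.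
Proof. by elim: c x => //= s c IH x; rewrite IH. Qed.

Lemma eq_hmap (T U : S -> Type) (f g : forall s, T s -> U s) c (x : htup T c) :
  (forall s a, f s a = g s a) -> hmap f x = hmap g x.
Proof. by move=> fg; elim: c x => //= s c IH x; rewrite IH fg. Qed.

Lemma hmap_id (T : S -> Type) c (x : htup T c) : hmap (fun s a => a) x = x.
Proof. by elim: c x => [[]|s c IH [a x]] //=; rewrite IH. Qed.

Lemma hmap_hcat (T U : S -> Type) (f : forall s, T s -> U s) c d
    (x : htup T c) (y : htup T d) :
  hmap f (hcat x y) = hcat (hmap f x) (hmap f y).
Proof. by elim: c x => //= s c IH x; rewrite IH. Qed.

Lemma lookup_hmap (T U : S -> Type) (f : forall s, T s -> U s) c s
    (v : var c s) (x : htup T c) : lookup v (hmap f x) = f s (lookup v x).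
Proof. by elim: v x => //= s1 s2 c1 v1 IH x; exact: IH. Qed.

Fixpoint hfst (T : S -> Type) c d : htup T (c ++ d) -> htup T c :=
  match c with
  | [::] => fun _ => tt
  | s :: c' => fun x => (x.1, @hfst T c' d x.2)
  end.

Fixpoint hsnd (T : S -> Type) c d : htup T (c ++ d) -> htup T d :=
  match c with
  | [::] => fun x => x
  | s :: c' => fun x => @hsnd T c' d x.2
  end.

Lemma hfst_hcat (T : S -> Type) c d (x : htup T c) (y : htup T d) :
  hfst (hcat x y) = x.
Proof. by elim: c x => [[]|s c IH [a x]] //=; rewrite IH. Qed.

Lemma hsnd_hcat (T : S -> Type) c d (x : htup T c) (y : htup T d) :
  hsnd (hcat x y) = y.
Proof. by elim: c x => [[]|s c IH [a x]] //=; rewrite IH. Qed.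

Lemma hcat_hfst_hsnd (T : S -> Type) c d (x : htup T (c ++ d)) :
  hcat (hfst x) (hsnd x) = x.
Proof. by elim: c x => [x|s c IH [a x]] //=; rewrite IH. Qed.

Fixpoint vid c : htup (var c) c :=
  match c with
  | [::] => tt
  | s :: c' => (vz s c', hmap (fun s' v => vs s v) (vid c'))
  end.

Fixpoint vfst c d : htup (var (c ++ d)) c :=
  match c with
  | [::] => tt
  | s :: c' => (vz s (c' ++ d), hmap (fun s' v => vs s v) (vfst c' d))
  end.

Fixpoint vsnd c d : htup (var (c ++ d)) d :=
  match c with
  | [::] => vid d
  | s :: c' => hmap (fun s' v => vs s v) (vsnd c' d)
  end.

Definition vlift s c d (w : htup (var d) c) : htup (var (s :: d)) (s :: c) :=
  (vz s d, hmap (fun s' v => vs s v) w).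

Definition pull (T : S -> Type) c d (w : htup (var d) c) (x : htup T d) :
    htup T c := hmap (fun s v => lookup v x) w.

Lemma pull_vid (T : S -> Type) c (x : htup T c) : pull (vid c) x = x.
Proof.
elim: c x => [[]|s c IH [a x]] //=.
by rewrite /pull /= hmap_hmap /= -[in RHS](IH x).
Qed.

Lemma pull_vfst (T : S -> Type) c d (x : htup T (c ++ d)) :
  pull (vfst c d) x = hfst x.
Proof.
elim: c x => //= s c IH [a x].
by rewrite /pull /= hmap_hmap /= -[in RHS](IH x).
Qed.

Lemma pull_vsnd (T : S -> Type) c d (x : htup T (c ++ d)) :
  pull (vsnd c d) x = hsnd x.
Proof.
elim: c x => [x|s c IH [a x]] /=; first exact: pull_vid.
by rewrite /pull /= hmap_hmap /= -[in RHS](IH x).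
Qed.

(** Maps that only select, repeat and reorder coordinates. The witness is a tuple of variables, so
    pulling a formula back along such a map is a renaming ([sat_ren]). *)
Definition coord (T : S -> Type) c d (f : htup T c -> htup T d) : Prop :=
  exists w : htup (var c) d, forall x, f x = pull w x.

Lemma coord_id (T : S -> Type) c : coord (fun x : htup T c => x).
Proof. by exists (vid c) => x; rewrite pull_vid. Qed.

Lemma coord_nil (T : S -> Type) c : coord (d := [::]) (fun _ : htup T c => tt).
Proof. by exists tt. Qed.

Lemma coord_comp (T : S -> Type) c d e (f : htup T c -> htup T d)
    (g : htup T d -> htup T e) :
  coord f -> coord g -> coord (fun x => g (f x)).
Proof.
move=> [w hw] [v hv]; exists (pull v w) => x.
by rewrite hv hw /pull hmap_hmap; apply: eq_hmap => s a; rewrite lookup_hmap.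
Qed.

Lemma coord_hfst (T : S -> Type) c d e (f : htup T e -> htup T (c ++ d)) :
  coord f -> coord (fun x => hfst (f x)).
Proof.
move=> hf; apply: (coord_comp hf); exists (vfst c d) => x.
by rewrite pull_vfst.
Qed.

Lemma coord_hsnd (T : S -> Type) c d e (f : htup T e -> htup T (c ++ d)) :
  coord f -> coord (fun x => hsnd (f x)).
Proof.
move=> hf; apply: (coord_comp hf); exists (vsnd c d) => x.
by rewrite pull_vsnd.
Qed.

Lemma coord_hcat (T : S -> Type) c d e (f : htup T e -> htup T c)
    (g : htup T e -> htup T d) :
  coord f -> coord g -> coord (fun x => hcat (f x) (g x)).
Proof.
move=> [w hw] [v hv]; exists (hcat w v) => x.
by rewrite hw hv /pull hmap_hcat.
Qed.

End Tuples.

Ltac coords := repeat first [exact: coord_id | exact: coord_nil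
  | apply: coord_hcat | apply: coord_hfst | apply: coord_hsnd].

(** * Renaming of variables, 0-definable sets and equality of types *)

Section Renaming.
Variable L : lang.
Implicit Types c d : seq (Sort L).

Fixpoint rent c d (w : htup (var d) c) s (t : term c s) : term d s :=
  match t with
  | tvar _ v => tvar (lookup v w)
  | tapp f ts => tapp (rents w ts)
  end
with rents c d (w : htup (var d) c) e (ts : terms c e) : terms d e :=
  match ts with
  | tnil => tnil d
  | tcons _ _ t ts' => tcons (rent w t) (rents w ts')
  end.

Fixpoint renf c d (w : htup (var d) c) (phi : form c) : form d :=
  match phi with
  | fbot => fbot d
  | feq _ t u => feq (rent w t) (rent w u)
  | frel r ts => frel (rents w ts)
  | fimp p q => fimp (renf w p) (renf w q)
  | fall s p => fall (renf (vlift s w) p)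
  end.

Scheme term_mut := Induction for term Sort Prop
  with terms_mut := Induction for terms Sort Prop.
Combined Scheme term_terms_ind from term_mut, terms_mut.

Variable N : structure L.

Lemma eval_ren c d (w : htup (var d) c) (x : tup N d) :
  (forall s (t : term c s), eval x (rent w t) = eval (pull w x : tup N c) t) /\
  (forall e (ts : terms c e),
     evals x (rents w ts) = evals (pull w x : tup N c) ts).
Proof.
apply: term_terms_ind => //=.
- by move=> s v; rewrite /pull lookup_hmap.
- by move=> f ts ->.
- by move=> s e t -> ts ->.
Qed.

Lemma sat_ren c (phi : form c) d (w : htup (var d) c) (x : tup N d) :
  sat N (renf w phi) x <-> sat N phi (pull w x).
Proof.
elim: phi d w x => {c} //=.
- by move=> c s t u d w x; rewrite !(proj1 (eval_ren _ _)).
- by move=> c r ts d w x; rewrite !(proj2 (eval_ren _ _)).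
- by move=> c p IHp q IHq d w x; split=> h /IHp /h /IHq.
- move=> c s p IH d w x.
  have E (a : N s) : pull (vlift s w) ((a, x) : tup N (s :: d)) = (a, pull w x).
    by rewrite /pull /= hmap_hmap.
  by split=> h a; move: (h a); rewrite IH E.
Qed.

Definition def0 c (X : set (tup N c)) : Prop :=
  exists phi : form c, forall x, X x <-> sat N phi x.

Lemma def0_sat c (phi : form c) : def0 [set x | sat N phi x].
Proof. by exists phi. Qed.

Lemma def0_ext c (X Y : set (tup N c)) :
  (forall x, X x <-> Y x) -> def0 X -> def0 Y.
Proof. by move=> h [phi hp]; exists phi => x; rewrite -h. Qed.

Lemma def0_imp c (X Y : set (tup N c)) :
  def0 X -> def0 Y -> def0 [set x | X x -> Y x].
Proof.
move=> [p hp] [q hq]; exists (fimp p q) => x /=.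
by split=> h /hp /h /hq.
Qed.

Lemma def0_false c : def0 [set x : tup N c | False].
Proof. by exists (fbot c). Qed.

Lemma def0C c (X : set (tup N c)) : def0 X -> def0 (~` X).
Proof. by move=> hX; apply: (def0_imp hX (@def0_false _)). Qed.

Lemma def0T c : def0 (setT : set (tup N c)).
Proof. by apply: def0_ext (def0C (@def0_false c)) => x; split=> // _ []. Qed.

Lemma def0I c (X Y : set (tup N c)) : def0 X -> def0 Y -> def0 (X `&` Y).
Proof.
move=> hX hY; apply: def0_ext (def0C (def0_imp hX (def0C hY))) => x; split.
  by move=> /not_implyP [hx /contrapT].
by move=> [a b] /(_ a).
Qed.

Lemma def0U c (X Y : set (tup N c)) : def0 X -> def0 Y -> def0 (X `|` Y).
Proof.
move=> hX hY; apply: def0_ext (def0_imp (def0C hX) hY) => x; split=> /=.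
  by move=> h; have [?|/h ?] := pselect (X x); [left|right].
by case.
Qed.

Lemma def0_pre c d (f : tup N c -> tup N d) (X : set (tup N d)) :
  coord f -> def0 X -> def0 (f @^-1` X).
Proof.
move=> [w hw] [phi hp]; exists (renf w phi) => x.
by rewrite sat_ren -hw -hp.
Qed.

Lemma def0_preE c d (f : tup N c -> tup N d) (X : set (tup N d))
    (Y : set (tup N c)) :
  coord f -> def0 X -> (forall x, X (f x) <-> Y x) -> def0 Y.
Proof. by move=> cf hX h; apply: def0_ext h (def0_pre cf hX). Qed.

Lemma def0_hfst c d (X : set (tup N c)) :
  def0 X -> def0 [set z : tup N (c ++ d) | X (hfst z)].
Proof.
exact: (@def0_pre _ _ (fun z => hfst z) X (coord_hfst (@coord_id _ _ _))).
Qed.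

Lemma def0_hsnd c d (X : set (tup N d)) :
  def0 X -> def0 [set z : tup N (c ++ d) | X (hsnd z)].
Proof.
exact: (@def0_pre _ _ (fun z => hsnd z) X (coord_hsnd (@coord_id _ _ _))).
Qed.

Lemma def0_ex1 c s (X : set (tup N (s :: c))) :
  def0 X -> def0 [set x : tup N c | exists a, X (a, x)].
Proof.
move=> /def0C [phi hp].
suff h : def0 [set x : tup N c | forall a, (~` X) (a, x)].
  apply: def0_ext (def0C h) => x; split.
    by move=> /= /existsNP [a /contrapT]; exists a.
  by move=> /= [a hX] /(_ a).
by exists (fall phi) => x; split=> h a; apply/hp.
Qed.

Lemma def0_ex c d (X : set (tup N (d ++ c))) :
  def0 X -> def0 [set x : tup N c | exists y : tup N d, X (hcat y x)].
Proof.
elim: d X => [|s d IH] X hX.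
  by apply: def0_ext hX => x; split=> [?|[] //]; exists tt.
apply: def0_ext (IH _ (def0_ex1 hX)) => x; split.
  by move=> [y [a ?]]; exists ((a, y) : tup N (s :: d)).
by move=> [[a y] ?]; exists y, a.
Qed.

Lemma def0_eq c d (f g : tup N c -> tup N d) :
  coord f -> coord g -> def0 [set x | f x = g x].
Proof.
move=> [w hw] [v hv].
suff h : def0 [set x : tup N c | pull w x = pull v x :> tup N d].
  by apply: def0_ext h => x /=; rewrite hw hv.
elim: d w v {f g hw hv} => [|s d IH] w v.
  by apply: def0_ext (@def0T c) => x.
apply: def0_ext (def0I _ (IH w.2 v.2)) => [x|]; last first.
  by exists (feq (tvar w.1) (tvar v.1)) => x; split=> h; exact: h.
rewrite /pull /=; split=> [[h1 h2]|[h1 h2]]; first by rewrite /= h1 h2.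
by split.
Qed.

(** Types over a tuple [e] are handled by the same relation, with [e] appended to both arguments;
    this avoids formulas with parameters. *)
Definition eqv c (a b : tup N c) : Prop :=
  forall phi : form c, sat N phi a <-> sat N phi b.

Lemma eqv_refl c (a : tup N c) : eqv a a.
Proof. by []. Qed.

Lemma eqv_sym c (a b : tup N c) : eqv a b -> eqv b a.
Proof. by move=> h phi; split=> /h. Qed.

Lemma eqv_trans c (a b d : tup N c) : eqv a b -> eqv b d -> eqv a d.
Proof. by move=> h k phi; rewrite h. Qed.

Lemma eqv_coord c d (f : tup N c -> tup N d) (a b : tup N c) :
  coord f -> eqv a b -> eqv (f a) (f b).
Proof.
by move=> [w hw] h phi; rewrite !hw -!sat_ren.
Qed.

Lemma eqv_def0 c (X : set (tup N c)) (a b : tup N c) :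
  def0 X -> eqv a b -> X a -> X b.
Proof. by move=> [phi hp] h /hp /h /hp. Qed.

Lemma def0_eqv c (X : set (tup N c)) (t : tup N c) :
  def0 X -> X !=set0 -> (forall x, X x -> eqv t x) -> def0 [set x | eqv t x].
Proof.
move=> hX [y Xy] h; apply: (def0_ext _ (hX)) => x; split=> [/h//|tx].
by apply: (eqv_def0 hX _ Xy); apply: eqv_trans tx; apply: eqv_sym; apply: h.
Qed.

End Renaming.

(** * Ryll-Nardzewski *)

Lemma existT_inj2 (A : Type) (P : A -> Type) (x : A) (a b : P x) :
  existT P x a = existT P x b -> a = b.
Proof.
move=> h; have := projT2_eq h.
by rewrite (Prop_irrelevance (projT1_eq h) erefl).
Qed.

(** * Coding of formulas by natural numbers *)

Section Countability.
Variable L : lang.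
Implicit Types c d : seq (Sort L).

(** Dependent elimination of a variable whose context is a cons: the return type is computed from
    the context, which keeps the indices general. *)
Definition var_case s0 c0 (Q : forall s : Sort L, var (s0 :: c0) s -> Prop)
    (hz : Q s0 (vz s0 c0)) (hs : forall s w, Q s (vs s0 w)) s
    (v : var (s0 :: c0) s) : Q s v :=
  match v in var c1 s1
    return (match c1 return var c1 s1 -> Prop with
            | [::] => fun _ => True
            | s2 :: c2 => fun v1 =>
                forall Q : forall s, var (s2 :: c2) s -> Prop,
                  Q s2 (vz s2 c2) -> (forall s w, Q s (vs s2 w)) -> Q s1 v1
            end) v
  with
  | vz _ _ => fun Q a b => a
  | vs _ _ _ w => fun Q a b => b _ w
  end Q hz hs.

Fixpoint var_code c s (v : var c s) : nat :=
  if v is vs _ _ _ w then (var_code w).+1 else 0.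

Lemma var_code_inj c s (v : var c s) s' (v' : var c s') :
  var_code v = var_code v' -> existT (var c) s v = existT (var c) s' v'.
Proof.
elim: v s' v' => [s0 c0|s0 s1 c0 v IH] s' v'; elim/var_case: v' => //= s2 w.
by move=> [/IH] /(congr1 (fun z => existT _ _ (vs s1 (projT2 z)))).
Qed.

Variables (cs : Sort L -> nat) (cf : Fun L -> nat) (cr : Rel L -> nat).
Hypotheses (cs_inj : injective cs) (cf_inj : injective cf)
  (cr_inj : injective cr).

Local Notation tree := (GenTree.tree nat).

Fixpoint term_code c s (t : term c s) : tree :=
  match t with
  | tvar _ v => GenTree.Leaf (var_code v)
  | tapp f ts => GenTree.Node (cf f) (terms_code ts)
  end
with terms_code c d (ts : terms c d) : seq tree :=
  match ts with
  | tnil => [::]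
  | tcons _ _ t ts' => term_code t :: terms_code ts'
  end.

(** The sorts belong to the conclusion because, during the induction, two terms with equal codes are
    not yet known to have the same sort. *)
Lemma term_code_inj c :
  (forall s (t : term c s) s' (t' : term c s'), term_code t = term_code t' ->
     existT (term c) s t = existT (term c) s' t') /\
  (forall d (ts : terms c d) d' (ts' : terms c d'),
     terms_code ts = terms_code ts' ->
     existT (terms c) d ts = existT (terms c) d' ts').
Proof.
apply: term_terms_ind => /=.
- move=> s v s' [s1 v'|//] /= [/var_code_inj].
  by move=> /(congr1 (fun z => existT _ _ (tvar (projT2 z)))).
- move=> f ts IH s' [//|f' ts'] /= [/cf_inj e]; subst f'.
  by move=> h; rewrite (existT_inj2 (IH _ _ h)).
- by move=> d' [].
- move=> s d t IHt ts IHts d' [//|s' d1 t' ts'] /= [/IHt e1 /IHts e2].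
  have := congr1 (fun z => existT _ _ (tcons (projT2 z) ts)) e1 => /= ->.
  by have := congr1 (fun z => existT _ _ (tcons t' (projT2 z))) e2.
Qed.

Fixpoint form_code c (phi : form c) : tree :=
  match phi with
  | fbot => GenTree.Node 0 [::]
  | feq _ t u => GenTree.Node 1 [:: term_code t; term_code u]
  | frel r ts => GenTree.Node 2 (GenTree.Leaf (cr r) :: terms_code ts)
  | fimp p q => GenTree.Node 3 [:: form_code p; form_code q]
  | fall s p => GenTree.Node 4 [:: GenTree.Leaf (cs s); form_code p]
  end.

(** The code of [fall] records the quantified sort, so that the two bodies share their context
    again. *)
Lemma form_code_inj c : injective (@form_code c).
Proof.
move=> phi; elim: phi => {c}.
- by move=> c [].
- move=> c s t u [|s' t' u'|//|//|//] //= [/(proj1 (term_code_inj _)) e1].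
  move=> /(proj1 (term_code_inj _)) e2.
  move: (congr1 (@projT1 _ _) e1) => /= e; subst s'.
  by rewrite (existT_inj2 e1) (existT_inj2 e2).
- move=> c r ts [|//|r' ts'|//|//] //= [/cr_inj e]; subst r'.
  by move=> h; rewrite (existT_inj2 (proj2 (term_code_inj _) _ _ _ _ h)).
- by move=> c p IHp q IHq [|//|//|p' q'|//] //= [/IHp -> /IHq ->].
- by move=> c s p IHp [|//|//|//|s' p'] //= [/cs_inj e]; subst s' => /IHp ->.
Qed.

Fixpoint htup_code (I : Sort L -> Type) (ci : forall s, I s -> nat) c :
    htup I c -> seq nat :=
  match c with
  | [::] => fun _ => [::]
  | s :: c' => fun x => ci s x.1 :: htup_code ci x.2
  end.

Lemma htup_code_inj (I : Sort L -> Type) (ci : forall s, I s -> nat) c :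
  (forall s, injective (ci s)) -> injective (@htup_code I ci c).
Proof.
move=> ci_inj; elim: c => [[] []//|s c IH [i x] [j y]] /=.
by move=> [/ci_inj -> /IH ->].
Qed.

(** Numbers the tasks of the generic construction: a formula together with the variables substituted
    into it. *)
Definition req_code (I : Sort L -> Type) (ci : forall s, I s -> nat)
    (q : {c : seq (Sort L) & (form c * htup I c)%type}) : nat :=
  pickle (map cs (projT1 q), form_code (projT2 q).1,
          htup_code ci (projT2 q).2).

Lemma req_code_inj (I : Sort L -> Type) (ci : forall s, I s -> nat) :
  (forall s, injective (ci s)) -> injective (@req_code I ci).
Proof.
move=> ci_inj [c [p x]] [c' [p' x']] /(pcan_inj pickleK) /= [].
move=> /(inj_map cs_inj) e; subst c'.
by move=> /form_code_inj -> /(htup_code_inj ci_inj) ->.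
Qed.

End Countability.

(** Serves as truth in the limit of a sequence of assignments. *)
Definition eventually (Q : nat -> Prop) : Prop := exists n, forall m, (n <= m)%N -> Q m.

Lemma eventually_all (Q : nat -> Prop) : (forall m, Q m) -> eventually Q.
Proof. by exists 0%N. Qed.

Lemma eventually_imp (Q Q' : nat -> Prop) :
  eventually (fun m => Q m -> Q' m) -> eventually Q -> eventually Q'.
Proof.
move=> [n h] [n' h']; exists (maxn n n') => m.
by rewrite geq_max => /andP[/h k /h' /k].
Qed.

Lemma eventually_and (Q Q' : nat -> Prop) :
  eventually Q -> eventually Q' -> eventually (fun m => Q m /\ Q' m).
Proof. by move=> h h'; apply: eventually_imp h'; apply: eventually_imp h; apply: eventually_all. Qed.

Lemma eventually_ex (Q : nat -> Prop) : eventually Q -> exists m, Q m.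
Proof. by move=> [n h]; exists n; apply: h. Qed.

(** * Generic sequences of assignments *)

Section Henkin.
Variables (L : lang) (N : structure L).
Implicit Types c d : seq (Sort L).
Variable srt : nat -> Sort L.
Hypothesis srt_inf : forall s n, exists2 i, (n <= i)%N & srt i = s.

(* A generic model is built from variables indexed by nat, the i-th one of sort
   [srt i], and assignments of all of them in [N].  Forcing conditions are the
   finitely supported definable sets of assignments that belong to [big]; the
   choice of [big] decides which type a fixed tuple of variables may realise. *)
Definition idx (s : Sort L) : Type := {i : nat | srt i = s}.
Definition asgn : Type := forall i : nat, N (srt i).
Definition val1 (b : asgn) s (i : idx s) : N s :=
  eq_rect (srt (sval i)) (car N) (b (sval i)) s (proj2_sig i).
Definition valt (b : asgn) c (w : htup idx c) : tup N c := hmap (val1 b) w.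

Definition agree (n : nat) (b b' : asgn) : Prop :=
  forall i, (i < n)%N -> b i = b' i.

Lemma val1_eq (b b' : asgn) s (i : idx s) :
  b (sval i) = b' (sval i) -> val1 b i = val1 b' i.
Proof. by rewrite /val1 => ->. Qed.

Lemma valt_bound c (w : htup idx c) :
  exists n, forall m b b', (n <= m)%N -> agree m b b' -> valt b w = valt b' w.
Proof.
elim: c w => [|s c IH] w; first by exists 0%N.
have [n hn] := IH w.2; exists (maxn (sval w.1).+1 n) => m b b'.
rewrite geq_max => /andP[h1 h2] hb.
rewrite /valt /= (@val1_eq b b') ?hb //.
by move: (hn m b b' h2 hb); rewrite /valt => ->.
Qed.

Definition upd (b : asgn) s (i : idx s) (a : N s) : asgn := fun j =>
  match pselect (sval i = j) with
  | left e => eq_rect (sval i) (fun k => N (srt k))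
                (eq_rect s (car N) a (srt (sval i)) (esym (proj2_sig i))) j e
  | right _ => b j
  end.

Lemma upd_same (b : asgn) s (i : idx s) (a : N s) : val1 (upd b i a) i = a.
Proof.
rewrite /val1 /upd; case: pselect => // e.
rewrite (Prop_irrelevance e erefl) /=.
by move: a; case: i {e} => i e /= a; subst s; rewrite /=.
Qed.

Lemma upd_other (b : asgn) s (i : idx s) (a : N s) j :
  sval i <> j -> upd b i a j = b j.
Proof. by rewrite /upd; case: pselect. Qed.

Lemma asgn_inh : inhabited asgn.
Proof.
have h i : exists _ : N (srt i), True by have [x] := car_inh N (srt i); exists x.
by exists => i; case: (cid (h i)).
Qed.

(** Indices with the same underlying number have the same sort, so [i] is either literally an entry
    of [w] or can be reassigned freely. *)
Lemma idx_var s c (i : idx s) (w : htup idx c) :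
  (exists v : var c s, lookup v w = i) \/
  (forall (b : asgn) a, valt (upd b i a) w = valt b w).
Proof.
elim: c w => [|s' c IH] w; first by right.
have [[v hv]|h] := IH w.2; first by left; exists (vs s' v).
have [e|ne] := pselect (sval i = sval w.1); last first.
  right=> b a; rewrite /valt /= -/(valt _ _) h; congr (_, _).
  by apply: val1_eq; apply: upd_other.
left; case: w e {h IH} => [[j ej] w] /= e.
case: i e => i ei /= e; subst j; subst s s'.
by exists (vz _ _) => /=; congr exist; apply: Prop_irrelevance.
Qed.

(** The entries of [w] may repeat; the range consists of the tuples that agree at repeated entries,
    which equations express. *)
Lemma def0_range_valt c (w : htup idx c) : def0 (range (fun b => valt b w)).
Proof.
have [b0] := asgn_inh.
elim: c w => [|s c IH] w.
  apply: def0_ext (@def0T _ N _) => -[]; split=> // _; by exists b0.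
have hsub : def0 [set x : tup N (s :: c) |
    range (fun b => valt b w.2) x.2].
  apply: (@def0_pre _ _ _ _ (fun x : tup N (s :: c) => x.2)) (IH w.2).
  exact: (@coord_hsnd _ _ [:: s] c _ _ (@coord_id _ _ _)).
have [[v hv]|h] := idx_var w.1 w.2; last first.
  apply: def0_ext hsub => -[a x]; split=> /=.
    move=> [b _ <-]; exists (upd b w.1 a) => //.
    by rewrite /valt /= -/(valt _ _) h upd_same.
  by move=> [b _ [_ <-]]; exists b.
have heq : def0 [set x : tup N (s :: c) | x.1 = lookup v x.2].
  exists (feq (tvar (vz s c)) (tvar (vs s v))) => x /=; by split.
apply: def0_ext (def0I hsub heq) => -[a x]; split=> /=.
  move=> [[b _ <-] ->]; exists b => //.
  by rewrite /valt /= -hv lookup_hmap.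
move=> [b _ [<- <-]]; split; first by exists b.
by rewrite /valt lookup_hmap hv.
Qed.

Definition finsupp (K : set asgn) : Prop :=
  exists c (phi : form c) (w : htup idx c), forall b, K b <-> sat N phi (valt b w).

Lemma finsupp_sat c (phi : form c) (w : htup idx c) :
  finsupp [set b | sat N phi (valt b w)].
Proof. by exists c, phi, w. Qed.

Lemma finsuppC K : finsupp K -> finsupp (~` K).
Proof.
move=> [c [phi [w h]]]; exists c, (fimp phi (fbot c)), w => b.
by split=> [k /h//|k /h/k].
Qed.

Lemma finsuppI K K' : finsupp K -> finsupp K' -> finsupp (K `&` K').
Proof.
move=> [c [phi [w h]]] [c' [phi' [w' h']]].
have [psi hpsi] : def0 ([set z : tup N (c ++ c') | sat N phi (hfst z)] `&`
    [set z | sat N phi' (hsnd z)]).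
  apply (def0I (def0_hfst c' (def0_sat N phi)) (def0_hsnd c (def0_sat N phi'))).
exists (c ++ c'), psi, (hcat w w') => b; rewrite -hpsi /= /valt hmap_hcat.
by rewrite hfst_hcat hsnd_hcat; split=> -[/h ? /h' ?].
Qed.

Lemma finsuppT : finsupp setT.
Proof. by exists [::], (fimp (fbot [::]) (fbot [::])), tt => b; split=> // _ []. Qed.

(** Evaluating jointly at the support of [K] and at [v] gives a definable set, from which the
    support is quantified away. *)
Lemma def0_image_valt K c (v : htup idx c) :
  finsupp K -> def0 ((fun b => valt b v) @` K).
Proof.
move=> [d [phi [w h]]].
have h1 : def0 (range (fun b => valt b (hcat w v)) `&`
    [set z : tup N (d ++ c) | sat N phi (hfst z)]).
  apply (def0I (def0_range_valt _) (def0_hfst c (def0_sat N phi))).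
apply: def0_ext (def0_ex h1) => x; split.
  move=> [y [[b _]]] /=; rewrite hfst_hcat /valt hmap_hcat => e.
  have <- : valt b w = y by rewrite -[RHS](hfst_hcat y x) -e hfst_hcat.
  have <- : valt b v = x by rewrite -[RHS](hsnd_hcat y x) -e hsnd_hcat.
  by move=> /h Kb; exists b.
move=> [b Kb <-]; exists (valt b w); split; last by rewrite /= hfst_hcat; apply/h.
by exists b => //; rewrite /valt hmap_hcat.
Qed.

Variable big : set (set asgn).
Variable n0 : nat.
Hypothesis bigT : big setT.
Hypothesis big0 : ~ big set0.
Hypothesis bigU : forall K K', big (K `|` K') -> big K \/ big K'.
(* Beyond [n0], conditions may be prolonged freely: this leaves room for
   Henkin witnesses without affecting the variables that [big] looks at. *)
Hypothesis big_agree : forall n K K', (n0 <= n)%N ->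
  (forall b, K b -> exists2 b', K' b' & agree n b b') -> big K -> big K'.

(** Every tuple of the model will satisfy a member of [Theta]. Formulas false of a tuple serve to
    omit its type; isolating formulas make the model atomic. *)
Variable Theta : forall c, set (form c).
Hypothesis Theta_dense : forall K c (v : htup idx c), finsupp K -> big K ->
  exists2 th, Theta th & big (K `&` [set b | sat N th (valt b v)]).

Lemma big_sub K K' : K `<=` K' -> big K -> big K'.
Proof.
by move=> h; apply: (big_agree (leqnn n0)) => b Kb; exists b; first apply: h.
Qed.

Lemma big_nonempty K : big K -> K !=set0.
Proof. by move=> bK; apply/set0P/eqP => e; apply: big0; rewrite -e. Qed.

Definition decided (K X : set asgn) : Prop := K `<=` X \/ K `<=` ~` X.

(** The Henkin property: a universal formula that fails must fail at a named variable. *)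
Definition witnessed (K : set asgn) c (phi : form c) (v : htup idx c) : Prop :=
  match phi with
  | fall s p =>
      K `<=` [set b | forall a : N s, sat N p ((a, valt b v) : tup N (s :: c))]
      \/ exists i : idx s, K `<=`
        [set b | ~ sat N p ((val1 b i, valt b v) : tup N (s :: c))]
  | _ => True
  end.

Definition req (K : set asgn) c (phi : form c) (v : htup idx c) : Prop :=
  [/\ decided K [set b | sat N phi (valt b v)], witnessed K phi v
    & exists2 th, Theta th & K `<=` [set b | sat N th (valt b v)]].

Lemma decided_dense K X : finsupp K -> big K -> finsupp X ->
  exists K', [/\ finsupp K', big K', K' `<=` K & decided K' X].
Proof.
move=> fK bK fX; have : big ((K `&` X) `|` (K `&` ~` X)).
  by apply: big_sub bK => b Kb; have [?|?] := pselect (X b); [left|right].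
move=> /bigU [b|b].
  exists (K `&` X); split=> //.
  - exact: finsuppI.
  - by left=> ? [].
exists (K `&` ~` X); split=> //.
- by apply: finsuppI => //; apply: finsuppC.
- by right=> ? [].
Qed.

Lemma finsupp_bound K : finsupp K ->
  exists n, forall m b b', (n <= m)%N -> agree m b b' -> K b -> K b'.
Proof.
move=> [c [phi [w h]]]; have [n hn] := valt_bound w.
by exists n => m b b' le_nm ag /h; rewrite (hn m b b' le_nm ag) => /h.
Qed.

Lemma witnessed_dense K c (phi : form c) (v : htup idx c) :
  finsupp K -> big K ->
  exists K', [/\ finsupp K', big K', K' `<=` K & witnessed K' phi v].
Proof.
case: phi v => [|s t u|r ts|p q|s p] v fK bK; try by exists K; split=> //; exact: I.
have [K1 [fK1 bK1 sK1 [d|d]]] :=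
    decided_dense fK bK (finsupp_sat (fall p) v).
  by exists K1; split=> //; left.
have [n hn] := finsupp_bound fK1; have [m hm] := valt_bound v.
(* An index past [n0] and past the supports of [K1] and [v]: storing the counterexample there
   disturbs neither, and [big_agree] keeps the condition big. *)
have [i0 hi e0] := srt_inf s (maxn n0 (maxn n m)).
pose i : idx s := exist _ i0 e0.
exists (K1 `&` [set b | ~ sat N p ((val1 b i, valt b v) : tup N (s :: c))]).
split.
- apply: finsuppI => //.
  exact: (finsuppC (@finsupp_sat (s :: c) p (i, v))).
- apply: (@big_agree (maxn n0 (maxn n m)) K1) => //; first exact: leq_maxl.
  move=> b K1b; have /= /existsNP [a ha] := d b K1b.
  have ag : agree (maxn n0 (maxn n m)) b (upd b i a).
    move=> j hj; rewrite upd_other //= => e; move: hj; rewrite -e.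
    by rewrite ltnNge hi.
  exists (upd b i a) => //; split.
    by apply: (hn (maxn n0 (maxn n m)) b) => //; rewrite leq_max leq_maxl orbT.
  rewrite /= upd_same -(hm (maxn n0 (maxn n m)) b) //.
  by rewrite leq_max leq_maxr orbT.
- by move=> b [] /sK1.
- by right; exists i => b [].
Qed.

Lemma req_dense K c (phi : form c) (v : htup idx c) : finsupp K -> big K ->
  exists K', [/\ finsupp K', big K', K' `<=` K & req K' phi v].
Proof.
move=> fK bK.
have [K1 [f1 b1 s1 d1]] := decided_dense fK bK (finsupp_sat phi v).
have [K2 [f2 b2 s2 w2]] := witnessed_dense phi v f1 b1.
have [th t1 t2] := Theta_dense v f2 b2.
exists (K2 `&` [set b | sat N th (valt b v)]); split=> //.
- by apply: finsuppI => //; apply: finsupp_sat.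
- by move=> b [] /s2 /s1.
split.
- by case: d1 => d; [left|right] => b [] /s2 /d.
- case: phi w2 {d1} => //= s p [w|[i w]].
    by left=> b [] /w.
  by right; exists i => b [] /w.
- by exists th => // b [].
Qed.

Variable code : {c : seq (Sort L) & (form c * htup idx c)%type} -> nat.
Hypothesis code_inj : injective code.

(** A decreasing chain of big conditions meets the task numbered [j] at step [j]. The chain need not
    have a common assignment, so one assignment is chosen from each condition. *)
Lemma generic_sequence : exists b : nat -> asgn,
  [/\ forall c (phi : form c) (v : htup idx c),
        eventually (fun m => sat N phi (valt (b m) v)) \/
        eventually (fun m => ~ sat N phi (valt (b m) v)),
      forall s c (p : form (s :: c)) (v : htup idx c),
        eventually (fun m => forall a : N s,
              sat N p ((a, valt (b m) v) : tup N (s :: c))) \/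
        exists i : idx s, eventually (fun m =>
              ~ sat N p ((val1 (b m) i, valt (b m) v) : tup N (s :: c))),
      forall c (v : htup idx c), exists2 th, Theta th &
        eventually (fun m => sat N th (valt (b m) v))
    & forall c (phi : form c) (v : htup idx c),
        eventually (fun m => sat N phi (valt (b m) v)) ->
        big [set b | sat N phi (valt b v)]].
Proof.
pose T := {K : set asgn | finsupp K /\ big K}.
have step (j : nat) (K : T) : exists K' : T, sval K' `<=` sval K /\
    forall q, code q = j -> req (sval K') (projT2 q).1 (projT2 q).2.
  have [[q hq]|nq] := pselect (exists q, code q = j); last first.
    by exists K; split=> // q hq; case: nq; exists q.
  have [K' [f' b' s' r']] :=
    req_dense (projT2 q).1 (projT2 q).2 (proj1 (svalP K)) (proj2 (svalP K)).
  exists (exist _ K' (conj f' b')); split=> // q' hq'.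
  by have -> : q' = q by apply: code_inj; rewrite hq hq'.
pose K0 : T := exist _ setT (conj finsuppT bigT).
pose Ks := fix Ks (n : nat) : T :=
  if n is j.+1 then sval (cid (step j (Ks j))) else K0.
have Ksub n m : (n <= m)%N -> sval (Ks m) `<=` sval (Ks n).
  elim: m => [|m IH]; first by rewrite leqn0 => /eqP ->.
  rewrite leq_eqVlt => /orP[/eqP -> //|]; rewrite ltnS => /IH h.
  apply: subset_trans h; rewrite /=; case: cid => K' [] //.
have Kreq c (phi : form c) v : exists n, req (sval (Ks n)) phi v.
  pose q : {c : seq (Sort L) & (form c * htup idx c)%type} :=
    existT _ c (phi, v).
  exists (code q).+1; rewrite /=.
  exact: (proj2 (svalP (cid (step (code q) (Ks (code q))))) q erefl).
have Kne n : exists b, sval (Ks n) b.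
  exact: (big_nonempty (proj2 (svalP (Ks n)))).
pose b n := sval (cid (Kne n)).
have bK n m : (n <= m)%N -> sval (Ks n) (b m).
  by move=> /Ksub; apply; rewrite /b; case: cid.
have evK n (X : set asgn) : sval (Ks n) `<=` X -> eventually (fun m => X (b m)).
  by move=> h; exists n => m /bK /h.
exists b; split.
- move=> c phi v; have [n [[d|d] _ _]] := Kreq c phi v; [left|right].
    exact: evK d.
  exact: (evK n (~` [set b | sat N phi (valt b v)])).
- move=> s c p v; have [n [_ [w|[i w]] _]] := Kreq c (fall p) v.
    by left; apply: evK w.
  by right; exists i; apply: evK w.
- move=> c v; have [n [_ _ [th t1 t2]]] := Kreq c (fbot c) v.
  by exists th => //; apply: evK t2.
(* The condition deciding [phi] cannot refute it, since [phi] holds eventually; being big, it makes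
   the larger set big. *)
- move=> c phi v e; have [n [[d|d] _ _]] := Kreq c phi v.
    exact: big_sub d (proj2 (svalP (Ks n))).
  have /eventually_ex [m []] := eventually_and e
    (evK n (~` [set b | sat N phi (valt b v)]) d).
  by [].
Qed.

End Henkin.

Lemma sval_inj (A : Type) (P : A -> Prop) : injective (@proj1_sig A P).
Proof. by move=> [x p] [y q] /= e; apply: eq_exist. Qed.

(** * The countable model defined by a generic sequence *)

Section TermModel.
Variables (L : lang) (N : structure L).
Implicit Types c d : seq (Sort L).
Variable srt : nat -> Sort L.
Hypothesis srt_inf : forall s n, exists2 i, (n <= i)%N & srt i = s.
Local Notation idx := (idx srt).
Local Notation asgn := (asgn N srt).
Variable b : nat -> asgn.
Hypothesis b_dec : forall c (phi : form c) (v : htup idx c),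
  eventually (fun m => sat N phi (valt (b m) v)) \/
  eventually (fun m => ~ sat N phi (valt (b m) v)).
Hypothesis b_wit : forall s c (p : form (s :: c)) (v : htup idx c),
  eventually (fun m => forall a : N s, sat N p ((a, valt (b m) v) : tup N (s :: c))) \/
  exists i : idx s, eventually (fun m =>
    ~ sat N p ((val1 (b m) i, valt (b m) v) : tup N (s :: c))).

Definition lim_eq s (i j : idx s) : Prop :=
  eventually (fun m => val1 (b m) i = val1 (b m) j).

Definition lim_class s (i : idx s) : set (idx s) := [set j | lim_eq i j].

Lemma lim_eq_sym s (i j : idx s) : lim_eq i j -> lim_eq j i.
Proof. by apply: eventually_imp; apply: eventually_all => m ->. Qed.

Lemma lim_eq_trans s (i j k : idx s) : lim_eq i j -> lim_eq j k -> lim_eq i k.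
Proof.
move=> h h'; have := eventually_and h h'; apply: eventually_imp.
by apply: eventually_all => m [-> ->].
Qed.

Definition tm_car (s : Sort L) : Type :=
  {C : set (idx s) | exists i, C = lim_class i}.

Definition cls s (i : idx s) : tm_car s :=
  exist _ (lim_class i) (ex_intro _ i erefl).

Definition rep s (x : tm_car s) : idx s := sval (cid (svalP x)).

Lemma cls_rep s (x : tm_car s) : cls (rep x) = x.
Proof. by apply: sval_inj; rewrite /rep /=; case: cid. Qed.

Lemma cls_eq s (i j : idx s) : cls i = cls j <-> lim_eq i j.
Proof.
split=> [/(congr1 sval) /= e|h].
  suff : lim_class i j by [].
  by rewrite e; apply: eventually_all.
apply: eq_exist; apply/seteqP; split=> k hk.
  exact: lim_eq_trans (lim_eq_sym h) hk.
exact: lim_eq_trans h hk.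
Qed.

Lemma rep_cls s (i : idx s) : lim_eq i (rep (cls i)).
Proof. by apply/cls_eq; rewrite cls_rep. Qed.

Lemma idx_inh s : exists _ : idx s, True.
Proof. by have [i _ h] := srt_inf s 0; exists (exist _ i h). Qed.

Lemma tm_inh s : inhabited (tm_car s).
Proof. by have [i _] := idx_inh s; exists; apply: cls i. Qed.

Definition tm_val (m : nat) c (x : htup tm_car c) : tup N c :=
  hmap (fun s e => val1 (b m) (rep e)) x.

Definition reps c (x : htup tm_car c) : htup idx c := hmap rep x.

Lemma tm_valE m c (x : htup tm_car c) : tm_val m x = valt (b m) (reps x).
Proof. by rewrite /tm_val /valt /reps hmap_hmap. Qed.

(** [b_wit] is applied to the complement of [X]: its universal alternative contradicts totality, the
    other one names a value. Function symbols are interpreted in this way. *)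
Lemma eventually_def0_choice s c (X : set (tup N (s :: c))) (v : htup idx c) :
  def0 X -> (forall y, exists a, X (a, y)) ->
  exists i : idx s, eventually (fun m => X (val1 (b m) i, valt (b m) v)).
Proof.
move=> /def0C [phi hp] tot; have [h|[i h]] := b_wit phi v.
  have [m hm] := eventually_ex h; have [a ha] := tot (valt (b m) v).
  by have /hp := hm a.
exists i; apply: eventually_imp h; apply: eventually_all => m h; apply: contrapT => nX.
by apply: h; apply/hp.
Qed.

Fixpoint var_terms c d : htup (var d) c -> terms d c :=
  match c with
  | [::] => fun _ => tnil d
  | s :: c' => fun w => tcons (tvar w.1) (@var_terms c' d w.2)
  end.

Lemma evals_var_terms (N' : structure L) c d (w : htup (var d) c)
    (x : tup N' d) : evals x (var_terms w) = pull w x.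
Proof. by elim: c w => //= s c IH w; rewrite IH. Qed.

Lemma def0_fn (N' : structure L) (f : Fun L) :
  def0 [set z : tup N' (fn_cod f :: fn_dom f) | z.1 = fn_int z.2].
Proof.
pose c := fn_cod f :: fn_dom f.
exists (feq (tvar (vz _ _))
  (tapp (var_terms (vsnd [:: fn_cod f] (fn_dom f))))) => x /=.
by rewrite evals_var_terms (@pull_vsnd _ _ [:: fn_cod f]).
Qed.

Definition tm_fn (f : Fun L) (x : htup tm_car (fn_dom f)) : tm_car (fn_cod f) :=
  cls (sval (cid (eventually_def0_choice (reps x) (@def0_fn N f)
    (fun y => ex_intro _ (fn_int y) erefl)))).

Lemma tm_fnP (f : Fun L) (x : htup tm_car (fn_dom f)) :
  eventually (fun m => val1 (b m) (rep (tm_fn x)) = fn_int (tm_val m x)).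
Proof.
rewrite /tm_fn; case: cid => i /= hi.
have := eventually_and hi (rep_cls i); apply: eventually_imp; apply: eventually_all => m [h <-].
by rewrite tm_valE.
Qed.

Definition term_model : structure L :=
  @Structure L tm_car tm_inh tm_fn
    (fun r x => eventually (fun m => rel_int (tm_val m x))).

Lemma eval_tm c (x : tup term_model c) :
  (forall s (t : term c s),
     eventually (fun m => val1 (b m) (rep (eval x t : tm_car s)) =
                  eval (tm_val m x) t)) /\
  (forall d (ts : terms c d),
     eventually (fun m => tm_val m (evals x ts : htup tm_car d) =
                  evals (tm_val m x) ts)).
Proof.
apply: term_terms_ind => /=.
- by move=> s v; apply: eventually_all => m; rewrite /tm_val lookup_hmap.
- move=> f ts IH; have := eventually_and IH (tm_fnP (evals x ts)).
  by apply: eventually_imp; apply: eventually_all => m [-> ->].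
- exact: eventually_all.
- move=> s d t IHt ts IHts; have := eventually_and IHt IHts.
  apply: eventually_imp; apply: eventually_all => m [h1 h2].
  by rewrite /tm_val /= -/(tm_val _ _) h1 h2.
Qed.

(** Analogue of the theorem on truth in ultraproducts: [b_dec] plays the part of maximality of the
    ultrafilter in the case of implication, [b_wit] that of the choice of witnesses in the case of a
    quantifier. *)
Lemma sat_tm c (phi : form c) (x : tup term_model c) :
  sat term_model phi x <-> eventually (fun m => sat N phi (tm_val m x)).
Proof.
elim: phi x => {c} /=.
- by move=> c x; split=> // /eventually_ex [].
- move=> c s t u x; have e := eventually_and (proj1 (eval_tm x) s t)
    (proj1 (eval_tm x) s u); split=> [h|h].
    by apply: eventually_imp e; apply: eventually_all => m [<- <-]; rewrite h.
  rewrite -[LHS]cls_rep -[RHS]cls_rep; apply/cls_eq.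
  by have := eventually_and e h; apply: eventually_imp; apply: eventually_all => m [[-> ->]].
- move=> c r ts x; split; apply: eventually_imp;
    apply: eventually_imp (proj2 (eval_tm x) _ ts); apply: eventually_all => m -> //.
- move=> c p IHp q IHq x; rewrite IHp IHq; split=> [h|h k]; last first.
    by have := eventually_and h k; apply: eventually_imp; apply: eventually_all => m [h1 /h1].
  have [k|k] := b_dec p (reps x).
    have : eventually (fun m => sat N q (tm_val m x)).
      by apply: h; apply: eventually_imp k; apply: eventually_all => m; rewrite tm_valE.
    by apply: eventually_imp; apply: eventually_all.
  by apply: eventually_imp k; apply: eventually_all => m; rewrite -tm_valE.
- move=> c s p IH x; split=> [h|h a]; last first.
    by apply/IH; apply: eventually_imp h; apply: eventually_all => m k; apply: k.
  have [k|[i k]] := b_wit p (reps x).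
    by apply: eventually_imp k; apply: eventually_all => m; rewrite -tm_valE.
  have /IH h1 := h (cls i).
  have [m [[h2 h3] h4]] := eventually_ex (eventually_and (eventually_and h1 k) (rep_cls i)).
  by case: h3; rewrite -tm_valE h4.
Qed.

Definition clst c (v : htup idx c) : tup term_model c := hmap cls v.

Lemma sat_clst c (phi : form c) (v : htup idx c) :
  sat term_model phi (clst v) <-> eventually (fun m => sat N phi (valt (b m) v)).
Proof.
have e : eventually (fun m => tm_val m (clst v) = valt (b m) v).
  elim: c v {phi} => [|s c IH] v; first by exists 0%N.
  have := eventually_and (rep_cls v.1) (IH v.2); apply: eventually_imp; apply: eventually_all => m.
  by move=> [e1 e2]; congr pair; [exact: esym|exact: e2].
by rewrite sat_tm; split; apply: eventually_imp; apply: eventually_imp e; apply: eventually_all => m ->.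
Qed.

Lemma clst_reps c (x : tup term_model c) : clst (reps x) = x.
Proof.
rewrite /clst /reps hmap_hmap -[RHS]hmap_id; apply: eq_hmap => s a.
exact: cls_rep.
Qed.

Lemma tm_elem_equiv : elem_equiv N term_model.
Proof.
move=> phi; rewrite (sat_clst phi (tt : htup idx [::])); split.
  by move=> h; apply: eventually_all.
by move=> /eventually_ex [].
Qed.

(** Infinity comes from the sorts alone, each being non-empty; countability comes from choosing a
    variable index in each class. *)
Lemma tm_countably_infinite :
  infinite_set [set: Sort L] -> countably_infinite term_model.
Proof.
move=> infS.
have inf : infinite_set [set: elt term_model].
  move=> /(finite_image (@projT1 _ _)); suff -> : (@projT1 _ _) @` [set: elt term_model] = [set: Sort L] by [].
  apply/seteqP; split=> // s _; have [i _] := idx_inh s.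
  by exists (existT (car term_model) s (cls i)).
pose f (e : elt term_model) : nat := sval (rep (projT2 e : tm_car _)).
have f_inj : injective f.
  move=> [s x] [s' x']; rewrite /f /= => e.
  have e' : existT idx s (rep (x : tm_car s)) = existT idx s' (rep (x' : tm_car s')).
    move: e; case: (rep _) => i ei; case: (rep _) => j ej /= eij; subst j.
    by subst s s'.
  have := congr1 (fun z => existT tm_car (projT1 z) (cls (projT2 z))) e'.
  by rewrite /= !cls_rep.
have /pcard_eqP/unsquash g : ([set: elt term_model] #= [set: nat])%card.
  rewrite card_eq_le; apply/andP; split; last exact/infiniteP.
  by apply/pcard_injP; exists f => x y _ _; apply: f_inj.
by exists g; apply: bijTT.
Qed.

End TermModel.

(** * Countable models controlled by a notion of largeness *)

Section Henkin.
Variables (L : lang) (N : structure L).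
Hypothesis (cL : countable_lang L) (infS : infinite_set [set: Sort L]).

Lemma sort_enumeration :
  exists srt : nat -> Sort L, forall s n, exists2 i, (n <= i)%N & srt i = s.
Proof.
have [/pcard_injP [f f_inj] _ _] := cL.
have [s0 _] := infinite_setN0 infS.
pose g (k : nat) : Sort L :=
  if pselect (exists s, f s = k) is left h then sval (cid h) else s0.
have gf s : g (f s) = s.
  rewrite /g; case: pselect => [h|[]]; last by exists s.
  by case: cid => s' /= e; apply: f_inj; rewrite ?inE.
exists (fun i => g (oapp fst 0%N (@unpickle (nat * nat)%type i))) => s n.
apply: contrapT => h.
(* If [s] had no index from [n] on, the codes of all pairs [(f s, m)] would be distinct numbers
   below [n]. *)
have sm m : (@pickle (nat * nat)%type (f s, m) < n)%N.
  rewrite ltnNge; apply/negP => le; apply: h.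
  by exists (@pickle (nat * nat)%type (f s, m)) => //; rewrite /= pickleK /= gf.
pose k (i : 'I_n.+1) : 'I_n := Ordinal (sm i).
have k_inj : injective k.
  by move=> i j /(congr1 val) /= /(pcan_inj pickleK) [] /val_inj.
by have := leq_card k k_inj; rewrite !card_ord ltnn.
Qed.

(** The map [r] sends variables to the elements they name. Formulas true of these define big sets,
    which is how [big] controls the type of a chosen tuple. *)
Lemma henkin (srt : nat -> Sort L)
    (srt_inf : forall s n, exists2 i, (n <= i)%N & srt i = s)
    (big : set (set (asgn N srt))) (n0 : nat)
    (Theta : forall c, set (form c)) :
  big setT -> ~ big set0 ->
  (forall K K', big (K `|` K') -> big K \/ big K') ->
  (forall n K K', (n0 <= n)%N ->
    (forall b, K b -> exists2 b', K' b' & agree n b b') -> big K -> big K') ->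
  (forall K c (v : htup (idx srt) c), finsupp K -> big K ->
    exists2 th, Theta c th & big (K `&` [set b | sat N th (valt b v)])) ->
  exists N1 : structure L,
    [/\ elem_equiv N N1, countably_infinite N1,
        forall c (x : tup N1 c), exists2 th, Theta c th & sat N1 th x
      & exists r : forall c, htup (idx srt) c -> tup N1 c,
        forall c (phi : form c) v, sat N1 phi (r c v) ->
          big [set b | sat N phi (valt b v)]].
Proof.
move=> bT b0 bU bA Td.
have [/pcard_injP [cs hs] /pcard_injP [cf hf] /pcard_injP [cr hr]] := cL.
have cs_inj : injective cs by move=> x y; apply: hs; rewrite inE.
have cf_inj : injective cf by move=> x y; apply: hf; rewrite inE.
have cr_inj : injective cr by move=> x y; apply: hr; rewrite inE.
have ci_inj s : injective (fun i : idx srt s => sval i).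
  exact: sval_inj.
have [b [dec wit th bg]] := generic_sequence srt_inf bT b0 bU bA Td
  (req_code_inj cs_inj cf_inj cr_inj ci_inj).
exists (term_model srt_inf wit); split.
- exact: tm_elem_equiv.
- exact: tm_countably_infinite.
- move=> c x; have [t tT te] := th c (reps x); exists t => //.
  by rewrite -(clst_reps x); apply/(sat_clst srt_inf dec wit).
- exists (fun c v => clst srt_inf wit v) => c phi v.
  by move=> /(sat_clst srt_inf dec wit) /bg.
Qed.

End Henkin.

Section Isomorphism.
Variables (L : lang) (N N' : structure L) (f : forall s, N s -> N' s).
Hypothesis f_bij : forall s, bijective (@f s).
Hypothesis f_fn : forall g (x : tup N (fn_dom g)),
  f (fn_int x) = fn_int (hmap (@f) x : tup N' (fn_dom g)).
Hypothesis f_rel : forall r (x : tup N (rel_ar r)),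
  rel_int x <-> rel_int (hmap (@f) x : tup N' (rel_ar r)).

Lemma eval_iso c (x : tup N c) :
  (forall s (t : term c s), f (eval x t) = eval (hmap (@f) x : tup N' c) t) /\
  (forall d (ts : terms c d),
     hmap (@f) (evals x ts) = evals (hmap (@f) x : tup N' c) ts).
Proof.
apply: term_terms_ind => //=.
- by move=> s v; rewrite lookup_hmap.
- by move=> g ts <-; rewrite f_fn.
- by move=> s d t -> ts ->.
Qed.

Lemma sat_iso c (phi : form c) (x : tup N c) :
  sat N phi x <-> sat N' phi (hmap (@f) x).
Proof.
elim: phi x => {c} //=.
- move=> c s t u x; rewrite -!(proj1 (eval_iso _)); split=> [->//|].
  exact: bij_inj.
- by move=> c r ts x; rewrite f_rel (proj2 (eval_iso _)).
- by move=> c p IHp q IHq x; rewrite IHp IHq.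
- move=> c s p IH x; split=> h a; last by apply/IH; apply: h.
  by have [g fK gK] := f_bij s; rewrite -(gK a); apply/(IH (g a, x)).
Qed.

End Isomorphism.

(** * Isolation and finiteness of types *)

Section RyllNardzewski.
Variables (L : lang) (N : structure L).
Hypothesis (infS : infinite_set [set: Sort L]) (ocat : omega_categorical N).
Implicit Types c d : seq (Sort L).

Lemma countable_models_same_types (N1 N2 : structure L) c (x : tup N1 c) :
  elem_equiv N N1 -> countably_infinite N1 ->
  elem_equiv N N2 -> countably_infinite N2 ->
  exists y : tup N2 c, forall phi : form c, sat N1 phi x <-> sat N2 phi y.
Proof.
case: ocat => _ [N0 [_ _ uniq]] e1 i1 e2 i2.
have [f [f_bij f_fn f_rel]] := uniq N1 e1 i1.
have [g [g_bij g_fn g_rel]] := uniq N2 e2 i2.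
have surj : exists z : tup N0 c, hmap f z = x.
  elim: c x => [|s c IH] x; first by exists tt; case: x.
  have [z hz] := IH x.2; have [h _ hK] := f_bij s.
  by exists (h x.1, z); rewrite /= hK hz; case: x {hz}.
have [z hz] := surj; exists (hmap g z) => phi; rewrite -hz.
by rewrite -(sat_iso f_bij f_fn f_rel) (sat_iso g_bij g_fn g_rel).
Qed.

(** Here [big] is a notion of largeness for sets of tuples of [N]; it is carried to sets of
    assignments through a tuple [w] of distinct variables. *)
Lemma henkin_over c (big : set (set (tup N c))) (Theta : forall c, set (form c)) :
  big setT -> ~ big set0 ->
  (forall X Y, X `<=` Y -> big X -> big Y) ->
  (forall X Y, big (X `|` Y) -> big X \/ big Y) ->
  (forall srt (w : htup (idx srt) c) K d (v : htup (idx srt) d), finsupp K ->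
    big ((fun b : asgn N srt => valt b w) @` K) -> exists2 th, Theta d th
    & big ((fun b : asgn N srt => valt b w) @` (K `&` [set b | sat N th (valt b v)]))) ->
  exists N1 : structure L, [/\ elem_equiv N N1, countably_infinite N1,
    forall d (x : tup N1 d), exists2 th, Theta d th & sat N1 th x
    & exists x : tup N1 c, forall phi : form c, sat N1 phi x ->
        big [set t | sat N phi t]].
Proof.
move=> bT b0 bS bU Td.
case: (ocat) => cL _; have [srt srt_inf] := sort_enumeration cL infS.
have [w w_inj] : exists w : htup (idx srt) c,
    forall x : tup N c, exists b : asgn N srt, valt b w = x.
  (* The bound on the indices already chosen keeps the next variable fresh, so that all values can
     be prescribed independently. *)
  suff [w [_ hw]] : exists w : htup (idx srt) c, (exists n, forall s (v : var c s),
      (sval (lookup v w) < n)%N) /\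
      forall x : tup N c, exists b : asgn N srt, valt b w = x by exists w.
  have [b0'] := asgn_inh N srt.
  elim: (c) => [|s d [w [[n hn] hw]]].
    exists tt; split; last by case; exists b0'.
    exists 0%N => s v; exfalso; move: v.
    have h (e : seq (Sort L)) s' (v : var e s') : e <> [::] by case: v.
    by move=> v; case: (h _ _ v).
  have [i0 hi e0] := srt_inf s n; pose i : idx srt s := exist _ i0 e0.
  exists (i, w); split.
    exists i0.+1 => s'; elim/var_case => [//|s1 v] /=.
    by apply: leq_trans (hn _ v) _; apply: leqW.
  move=> [a x]; have [b hb] := hw x; exists (upd b i a).
  rewrite /valt /= -/(valt _ _) upd_same.
  have [[v hv]|h] := idx_var N i w; last by rewrite h hb.
  by have := hn _ v; rewrite hv ltnNge hi.
pose Big (K : set (asgn N srt)) := big ((fun b => valt b w) @` K).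
have [n0 hn0] := valt_bound N w.
have [||||//|N1 [e1 i1 t1 [r hr]]] :=
    @henkin _ N cL infS srt srt_inf Big n0 Theta.
- apply: bS bT => x _; have [b <-] := w_inj x; by exists b.
- by rewrite /Big image_set0.
- by move=> K K'; rewrite /Big image_setU => /bU.
- move=> n K K' hn h; apply: bS => _ [b Kb <-]; have [b' K'b' ag] := h b Kb.
  by exists b' => //; rewrite (hn0 n b b').
- by move=> K d v; apply: Td.
exists N1; split=> //; exists (r c w) => phi /hr.
by apply: bS => _ [b hb <-].
Qed.

(* A type realised by [t] that is not isolated would be realised in one
   countable model and omitted in another. *)
Lemma class_def0 c (t : tup N c) : def0 [set x | eqv t x].
Proof.
apply: contrapT => nd.
have [||||//|N1 [e1 i1 _ [x hx]]] := @henkin_over c [set X | X t]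
    (fun d => [set fimp (fbot d) (fbot d)]).
- by [].
- by [].
- by move=> X Y h /h.
- by move=> X Y.
- move=> srt w K d v _ [b Kb hb]; exists (fimp (fbot d) (fbot d)) => //.
  by exists b => //; split=> // -[].
have tx phi : sat N phi t <-> sat N1 phi x.
  split=> [h|/hx //]; apply: contrapT => nh.
  by have := hx (fimp phi (fbot c)) nh; apply.
have [||||//|N2 [e2 i2 om _]] := @henkin_over [::] [set X | X !=set0]
    (fun d => [set th | forall t' : tup N d,
       existT _ d t' = existT _ c t -> ~ sat N th t']).
- by exists tt.
- by case=> [? []].
- by move=> X Y h [z Xz]; exists z; apply: h.
- by move=> X Y [z [?|?]]; [left|right]; exists z.
- move=> srt w K d v fK [_ [b Kb _]]; apply: contrapT => h.
  have h' th : (forall t' : tup N d,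
      existT (tup N) d t' = existT _ c t -> ~ sat N th t') ->
      forall b', K b' -> ~ sat N th (valt b' v).
    move=> k b' Kb' hb'; apply: h; exists th => //.
    by exists (valt b' w); exists b'.
  have [e|ne] := pselect (d = c); last first.
    apply: (h' (fimp (fbot d) (fbot d)) _ b Kb); last by [].
    by move=> t' /(congr1 (@projT1 _ _)) /ne.
  (* Every formula false of [t] fails throughout [K], so the definable image of [K] lies inside the
     type of [t] and isolates it. *)
  subst d; apply: nd; apply: def0_eqv (def0_image_valt v fK) _ _.
    by exists (valt b v); exists b.
  move=> _ [b' Kb' <-] phi; split=> hp; apply: contrapT => nhp.
    apply: (h' (fimp phi (fbot c)) _ b' Kb') nhp => t' e.
    by rewrite (existT_inj2 e) => /(_ hp).
  by apply: (h' phi _ b' Kb') hp => t' e; rewrite (existT_inj2 e).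
have [y hy] := countable_models_same_types x e1 i1 e2 i2.
have [th h1 h2] := om c y.
by apply: (h1 t erefl); apply/tx/hy.
Qed.

(* If there were infinitely many types, all isolated by [class_def0], then one
   countable model would be atomic and another would realise a type that
   contains no isolating formula. *)
Lemma finitely_many_classes c :
  finite_set [set C | exists t : tup N c, C = [set x | eqv t x]].
Proof.
apply: contrapT => inf.
pose cl (X : set (tup N c)) := (fun t => [set x | eqv t x]) @` X.
(* Sets meeting infinitely many types are large: when one is split in two, a part is still large. *)
have [||||//|N1 [e1 i1 _ [x hx]]] := @henkin_over c
    [set X | infinite_set (cl X)] (fun d => [set fimp (fbot d) (fbot d)]).
- apply: sub_infinite_set inf => _ [t ->]; by exists t.
- by move=> h; apply: h; rewrite /cl image_set0.
- move=> X Y h; apply: sub_infinite_set; exact: image_subset.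
- move=> X Y; rewrite /= /cl image_setU finite_setU => h.
  by apply: contrapT => /not_orP [/contrapT ? /contrapT ?]; apply: h.
- move=> srt w K d v _ h; exists (fimp (fbot d) (fbot d)) => //.
  apply: sub_infinite_set h; apply: image_subset; apply: image_subset.
  by move=> b Kb; split.
have [||||//|N2 [e2 i2 at_ _]] := @henkin_over [::] [set X | X !=set0]
    (fun d => [set th | exists t : tup N d, forall z, eqv t z <-> sat N th z]).
- by exists tt.
- by case=> [? []].
- by move=> X Y h [z Xz]; exists z; apply: h.
- by move=> X Y [z [?|?]]; [left|right]; exists z.
- move=> srt w K d v fK [_ [b Kb _]]; have [th hth] := class_def0 (valt b v).
  exists th; first by exists (valt b v).
  by exists (valt b w); exists b => //; split=> //; apply/hth.
have [y hy] := countable_models_same_types x e1 i1 e2 i2.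
have [th [t ht] h2] := at_ c y.
(* Being true of [x], [th] should meet infinitely many types, yet it isolates a single one. *)
have /hx := (proj2 (hy th) h2); apply.
apply: (@sub_finite_set _ _ [set [set x | eqv t x]]) => //.
move=> _ [z /ht tz <-] /=; apply/seteqP; split=> u /=.
  exact: eqv_trans.
by apply: eqv_trans; apply: eqv_sym.
Qed.

End RyllNardzewski.

(** * Structures with finitely many types *)

Section FinTypes.
Variables (L : lang) (N : structure L).
Implicit Types c d e : seq (Sort L).

Definition fin_types : Prop := forall c,
  exists l : seq (tup N c), forall x, exists2 t, List.In t l & eqv t x.

Hypothesis ft : fin_types.

Definition inv_over e (a : tup N e) c (X : set (tup N c)) : Prop :=
  forall x x', eqv (hcat x a) (hcat x' a) -> X x -> X x'.

Definition type_over e (a : tup N e) c (t : tup N c) : set (tup N c) :=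
  [set x | eqv (hcat t a) (hcat x a)].

(** The isolating formula is the conjunction, over the finitely many representatives, of formulas
    separating [t] from those of another type. *)
Lemma fin_types_class_def0 c (t : tup N c) : def0 [set x | eqv t x].
Proof.
have [l hl] := ft c.
have sep u : exists2 phi : form c, sat N phi t & eqv t u \/ ~ sat N phi u.
  have [tu|ntu] := pselect (eqv t u).
    by exists (fimp (fbot c) (fbot c)) => //=; left.
  have [phi h] := (existsNP _).2 ntu.
  have [ht|ht] := pselect (sat N phi t).
    by exists phi => //; right=> hu; apply: h.
  exists (fimp phi (fbot c)) => //; right=> hu; apply: h; split=> //.
  by move=> /hu.
have [psi ht hpsi] : exists2 psi : form c, sat N psi t &
    forall u, List.In u l -> sat N psi u -> eqv t u.
  elim: l {hl} => [|u l [psi ht hpsi]].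
    by exists (fimp (fbot c) (fbot c)).
  have [phi hp hu] := sep u.
  have [chi hchi] := def0I (def0_sat N phi) (def0_sat N psi).
  exists chi; first exact/hchi.
  move=> v [<-|vl] /hchi [h1 h2]; last exact: hpsi.
  by case: hu.
exists psi => x; split=> [/(_ psi) h|hx]; first exact/h.
have [u ul ux] := hl x.
by apply: (eqv_trans (hpsi u ul _) ux); apply/ux.
Qed.

Lemma inv_def0 c (X : set (tup N c)) :
  (forall x x', eqv x x' -> X x -> X x') -> def0 X.
Proof.
move=> hX; have [l hl] := ft c.
suff : def0 [set x | exists t, [/\ List.In t l, X t & eqv t x]].
  apply: def0_ext => x; split=> [[t [_ Xt /hX]]|Xx]; first exact.
  have [t tl tx] := hl x; exists t; split=> //.
  by apply: (hX x) => //; apply: eqv_sym.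
elim: l {hl} => [|u l IH].
  by apply: def0_ext (@def0_false _ N c) => x; split=> // -[t [[]]].
have [Xu|nXu] := pselect (X u).
  apply: def0_ext (def0U (fin_types_class_def0 u) IH) => x; split.
    move=> [ux|[t [h1 h2 h3]]]; first by exists u; split=> //; left.
    by exists t; split=> //; right.
  move=> [t [[<-|h1] h2 h3]]; first by left.
  by right; exists t.
apply: def0_ext IH => x; split=> [[t [h1 h2 h3]]|[t [[e|h1] h2 h3]]].
- by exists t; split=> //; right.
- by case: nXu; rewrite e.
- by exists t.
Qed.

(** As the type of [hcat b a] is isolated, the existence of such a [b] is expressed by a formula
    about [a] alone. *)
Lemma eqv_extend c d (a a' : tup N c) (b : tup N d) : eqv a a' ->
  exists b', eqv (hcat b a) (hcat b' a').
Proof.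
move=> aa'; have h := def0_ex (fin_types_class_def0 (hcat b a)).
have [|b' hb'] := eqv_def0 h aa'; first by exists b.
by exists b'.
Qed.

(** An invariant set is a finite disjoint union of types over [a], because [hcat x a] realises only
    finitely many types. Most arguments on measures below reduce in this way to a single type. *)
Lemma inv_over_ind e (a : tup N e) c (Q : set (tup N c) -> Prop) :
  Q set0 ->
  (forall D t, inv_over a D -> ~ D t -> Q D -> Q (D `|` type_over a t)) ->
  forall D, inv_over a D -> Q D.
Proof.
move=> Q0 QS D hD; have [l hl] := ft (c ++ e).
pose cov (l : seq (tup N (c ++ e))) : set (tup N c) :=
  [set x | exists2 u, List.In u l & eqv u (hcat x a)].
have -> : D = D `&` cov l.
  by apply/seteqP; split=> [x Dx|x []//]; split=> //; have [u ? ?] := hl (hcat x a); exists u.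
elim: l {hl} => [|u l IH].
  suff -> : D `&` cov [::] = set0 by [].
  by rewrite -subset0 => x [_ []].
have inv_cov : inv_over a (D `&` cov l).
  move=> x x' xx' [Dx [v vl vx]]; split; first exact: hD Dx.
  by exists v => //; apply: eqv_trans xx'.
have [[x [Dx ux nx]]|h] :=
    pselect (exists x, [/\ D x, eqv u (hcat x a) & ~ cov l x]).
  suff -> : D `&` cov (u :: l) = (D `&` cov l) `|` type_over a x.
    by apply: QS => // -[].
  apply/seteqP; split=> y.
    move=> [Dy [v [<-|vl] vy]]; last by left; split=> //; exists v.
    by right; apply: eqv_trans vy; apply: eqv_sym.
  move=> [[Dy [v vl vy]]|xy]; first by split=> //; exists v => //; right.
  split; first exact: hD Dx.
  by exists u; [left|apply: eqv_trans xy].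
suff -> : D `&` cov (u :: l) = D `&` cov l by [].
apply/seteqP; split=> y [Dy [v vl vy]]; split=> //; last by exists v => //; right.
case: vl vy => [<-|vl] vy; last by exists v.
by apply: contrapT => ny; apply: h; exists y.
Qed.

End FinTypes.

Lemma ryll_nardzewski (L : lang) (N : structure L) :
  infinite_set [set: Sort L] -> omega_categorical N -> fin_types N.
Proof.
move=> infS ocat c; have fin := @finitely_many_classes _ _ infS ocat c.
have /finite_seqP [s hs] :
  @finite_set {classic set (tup N c)}
    [set C | exists t : tup N c, C = [set x | eqv t x]] := fin.
have [l hl] : exists l : seq (tup N c), forall C : {classic set (tup N c)}, C \in s ->
    exists2 t, List.In t l & C = [set x | eqv t x].
  have : forall C : {classic set (tup N c)}, C \in s ->
      exists t : tup N c, C = [set x | eqv t x].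
    by move=> C Cs; have : [set` s] C by []; rewrite -hs.
  elim: s {hs} => [|C s IH] h; first by exists [::].
  have [|l hl] := IH; first by move=> C' h'; apply: h; rewrite inE h' orbT.
  have [t ht] := h C (mem_head _ _).
  exists (t :: l) => C'; rewrite inE => /orP[/eqP ->|/hl [t' h1 h2]].
    by exists t => //; left.
  by exists t' => //; right.
exists l => x; have : [set` s] [set y | eqv x y] by rewrite -hs; exists x.
move=> /hl [t tl e]; exists t => //.
by have /(congr1 (@^~ x)) : [set y | eqv x y] = [set y | eqv t y] := e;
   rewrite /= => <-.
Qed.

(** * Definability in M and in Meq *)

Section Meq.
Variables (L : lang) (M : structure L).
Local Notation inls := (map (@inl (Sort L) (eqsort M))).

Fixpoint var_inl (c : seq (Sort L)) s (v : var c s) : var (inls c) (inl s) :=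
  match v with
  | vz s c => vz (inl s) (inls c)
  | vs s s' c v' => vs (inl s') (var_inl v')
  end.

Fixpoint term_inl (c : seq (Sort L)) s (t : term c s) :
    @term (Leq M) (inls c) (inl s) :=
  match t with
  | tvar _ v => @tvar (Leq M) _ _ (var_inl v)
  | tapp f ts => @tapp (Leq M) (inls c) (inl f) (terms_inl ts)
  end
with terms_inl (c : seq (Sort L)) d (ts : terms c d) :
    @terms (Leq M) (inls c) (inls d) :=
  match ts with
  | tnil => @tnil (Leq M) _
  | tcons _ _ t ts' => @tcons (Leq M) _ _ _ (term_inl t) (terms_inl ts')
  end.

Fixpoint form_inl (c : seq (Sort L)) (phi : form c) : @form (Leq M) (inls c) :=
  match phi with
  | fbot => @fbot (Leq M) _
  | feq _ t u => @feq (Leq M) _ _ (term_inl t) (term_inl u)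
  | frel r ts => @frel (Leq M) _ r (terms_inl ts)
  | fimp p q => fimp (form_inl p) (form_inl q)
  | fall s p => @fall (Leq M) _ (inl s) (form_inl p)
  end.

Lemma lookup_inl (c : seq (Sort L)) s (v : var c s) (x : tup (Meq M) (inls c)) :
  lookup (var_inl v) x = lookup v (hreal x).
Proof. by elim: v x => //= s0 s1 c0 v IH x; rewrite IH. Qed.

Lemma eval_inl (c : seq (Sort L)) (x : tup (Meq M) (inls c)) :
  (forall s (t : term c s),
     eval x (term_inl t) = eval (hreal x : tup M c) t) /\
  (forall d (ts : terms c d),
     hreal (evals x (terms_inl ts)) = evals (hreal x : tup M c) ts).
Proof.
apply: term_terms_ind => //=.
- by move=> s v; rewrite lookup_inl.
- by move=> f ts ->.
- by move=> s d t -> ts ->.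
Qed.

Lemma sat_inl (c : seq (Sort L)) (phi : form c) (x : tup (Meq M) (inls c)) :
  sat (Meq M) (form_inl phi) x <-> sat M phi (hreal x).
Proof.
elim: phi x => {c} //=.
- by move=> c s t u x; rewrite !(proj1 (eval_inl _)).
- by move=> c r ts x; rewrite (proj2 (eval_inl _)).
- by move=> c p IHp q IHq x; rewrite IHp IHq.
- by move=> c s p IH x; split=> h a; apply/(IH (a, x))/h.
Qed.

(* Elements of Meq are represented by real tuples: [quots] maps a tuple of
   representatives in the context [rctxs c] onto the tuple of Meq it names. *)
Definition rctx (s : Sort (Leq M)) : seq (Sort L) :=
  match s with inl s => [:: s] | inr E => es_ctx E end.

Fixpoint rctxs (c : seq (Sort (Leq M))) : seq (Sort L) :=
  if c is s :: c' then rctx s ++ rctxs c' else [::].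

Definition quot (s : Sort (Leq M)) : tup M (rctx s) -> Meq M s :=
  match s return tup M (rctx s) -> Meq M s with
  | inl s => fun x => x.1
  | inr E => fun x => exist _ (eqclass x) (ex_intro _ _ erefl)
  end.

Fixpoint quots (c : seq (Sort (Leq M))) : tup M (rctxs c) -> tup (Meq M) c :=
  match c return tup M (rctxs c) -> tup (Meq M) c with
  | [::] => fun _ => tt
  | s :: c' => fun x => (quot (hfst x), @quots c' (hsnd x))
  end.

Lemma quot_surj s (y : Meq M s) : exists x, @quot s x = y.
Proof.
case: s y => [s|E] y; first by exists (y, tt).
by case: y => C [a ea]; exists a; apply: sval_inj.
Qed.

Lemma quots_surj c (y : tup (Meq M) c) : exists x, @quots c x = y.
Proof.
elim: c y => [|s c IH] [] //; first by exists tt.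
move=> a y; have [x1 h1] := quot_surj a; have [x2 h2] := IH y.
by exists (hcat x1 x2); rewrite /= hfst_hcat hsnd_hcat h1 h2.
Qed.

Lemma eqclass_eq (E : eqsort M) (a b : tup M (es_ctx E)) :
  eqclass a = eqclass b <-> sat M (es_rel E) (hcat a b).
Proof.
split=> [e|h]; first by have : eqclass a b by rewrite e; exact: es_refl.
apply/seteqP; split=> z hz; last exact: es_trans hz.
by apply: es_trans hz; apply: es_sym.
Qed.

Lemma def0_quot_eq s :
  def0 [set z : tup M (rctx s ++ rctx s) | quot (hfst z) = quot (hsnd z)].
Proof.
case: s => [s|E].
  exists (feq (tvar (vz _ _)) (tvar (vs _ (vz _ _)))) => x /=; by [].
exists (es_rel E) => z /=; rewrite -[X in sat _ _ X]hcat_hfst_hsnd -eqclass_eq.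
by split=> [/(congr1 sval)|h]; last exact: sval_inj.
Qed.

Lemma coord_real (d : seq (Sort L)) :
  coord (fun r : tup M (rctxs (inls d)) => hreal (quots r : tup (Meq M) (inls d))).
Proof.
elim: d => [|s d [w hw]]; first by exists tt.
exists (vz _ _, hmap (fun s' v => vs s v) w) => x /=.
by rewrite hw /pull /= hmap_hmap.
Qed.

Lemma real_surj (d : seq (Sort L)) (y : tup M d) :
  exists r, hreal (quots r : tup (Meq M) (inls d)) = y.
Proof.
elim: d y => [|s d IH] [] //; first by exists tt.
by move=> a y; have [r hr] := IH y; exists (a, r); rewrite /= hr.
Qed.

Lemma def0_rel (r : Rel L) : def0 [set z : tup M (rel_ar r) | rel_int z].
Proof.
exists (frel (var_terms (vid (rel_ar r)))) => x /=.
by rewrite evals_var_terms pull_vid.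
Qed.

(** Terms of [Leq M] may take imaginary values, for which [L] has no terms; their graphs can still
    be expressed on representatives, since equality of two classes is the formula [es_rel]. *)
Lemma def0_term_graph c :
  (forall s (t : term c s), def0 [set z : tup M (rctx s ++ rctxs c) |
     quot (hfst z) = eval (quots (hsnd z)) t]) /\
  (forall d (ts : terms c d), def0 [set z : tup M (rctxs d ++ rctxs c) |
     quots (hfst z) = evals (quots (hsnd z)) ts]).
Proof.
apply: term_terms_ind.
- move=> s v; elim: v => {c s} [s c|s s' c v IH].
    apply: (@def0_preE _ _ (rctx s ++ rctx s ++ rctxs c) _
      (fun z => hcat (hfst z) (hfst (hsnd z))) _ _ _ (def0_quot_eq s)).
      by coords.
    by move=> z; rewrite /= hfst_hcat hsnd_hcat.
  apply: (@def0_preE _ _ (rctx s ++ rctx s' ++ rctxs c) _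
    (fun z => hcat (hfst z) (hsnd (hsnd z))) _ _ _ IH).
    by coords.
  by move=> z; rewrite /= hfst_hcat hsnd_hcat.
- move=> f ts IH; pose d := rctxs (@fn_dom (Leq M) f).
  pose e := rctx (@fn_cod (Leq M) f) ++ rctxs c.
  have h1 : def0 [set z : tup M (d ++ e) |
      quots (hfst z) = evals (quots (hsnd (hsnd z))) ts].
    apply: (@def0_preE _ _ (d ++ e) _ (fun z => hcat (hfst z) (hsnd (hsnd z)))
      _ _ _ IH); first by coords.
    by move=> z; rewrite /= hfst_hcat hsnd_hcat.
  suff h2 : def0 [set z : tup M (d ++ e) |
      quot (hfst (hsnd z)) = @fn_int _ (Meq M) f (quots (hfst z))].
    apply: def0_ext (def0_ex (def0I h1 h2)) => z; split => /=.
      by move=> [y []]; rewrite /= !hfst_hcat !hsnd_hcat => -> ->.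
    move=> h; have [y hy] := quots_surj (evals (quots (hsnd z)) ts).
    by exists y; rewrite /= !hfst_hcat !hsnd_hcat hy h.
  case: f @d @e {ts IH h1} => [g|E] d e.
    apply: (@def0_preE _ _ (d ++ e) _
      (fun z => hcat (hfst (hsnd z)) (hreal (quots (hfst z)))) _ _ _
      (@def0_fn L M g)).
      apply: coord_hcat; first by coords.
      by apply: (coord_comp _ (coord_real _)); coords.
    by move=> z.
  apply: (@def0_preE _ _ (d ++ e) _
    (fun z => hcat (hfst (hsnd z)) (hreal (quots (hfst z)))) _ _ _
    (def0_quot_eq (inr E))).
    apply: coord_hcat; first by coords.
    by apply: (coord_comp _ (coord_real _)); coords.
  by move=> z; rewrite /= hfst_hcat hsnd_hcat.
- by apply: def0_ext (@def0T _ M _) => z; split=> // _; case: (quots _).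
- move=> s d t IHt ts IHts; pose e := (rctx s ++ rctxs d) ++ rctxs c.
  have h1 : def0 [set z : tup M e |
      quot (hfst (hfst z)) = eval (quots (hsnd z)) t].
    apply: (@def0_preE _ _ e _ (fun z => hcat (hfst (hfst z)) (hsnd z))
      _ _ _ IHt); first by coords.
    by move=> z; rewrite /= hfst_hcat hsnd_hcat.
  have h2 : def0 [set z : tup M e |
      quots (hsnd (hfst z)) = evals (quots (hsnd z)) ts].
    apply: (@def0_preE _ _ e _ (fun z => hcat (hsnd (hfst z)) (hsnd z))
      _ _ _ IHts); first by coords.
    by move=> z; rewrite /= hfst_hcat hsnd_hcat.
  apply: def0_ext (def0I h1 h2) => z; split => /= [[/= -> ->] //|[h3 h4]].
  by split.
Qed.

(** Since every element is named by a real tuple, a quantifier over a sort of [Meq M] becomes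
    quantifiers over representatives. *)
Lemma def0_quots c (phi : @form (Leq M) c) :
  def0 [set r : tup M (rctxs c) | sat (Meq M) phi (quots r)].
Proof.
elim: phi => {c}.
- by move=> c; exact: def0_false.
- move=> c s t u.
  have h := def0_ex (def0I (proj1 (def0_term_graph c) s t)
    (proj1 (def0_term_graph c) s u)).
  apply: def0_ext h => r; split=> /= [[y []] /=|e].
    by rewrite hfst_hcat hsnd_hcat => <- <-.
  have [y hy] := quot_surj (eval (quots r) t).
  by exists y; split; rewrite /= hfst_hcat hsnd_hcat hy.
- move=> c r ts; pose d := rctxs (@rel_ar (Leq M) r).
  have h1 : def0 [set z : tup M (d ++ rctxs c) |
      rel_int (hreal (quots (hfst z) : tup (Meq M) (@rel_ar (Leq M) r)) :
        tup M (@rel_ar L r))].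
    apply: (@def0_preE _ _ (d ++ rctxs c) _
      (fun z => hreal (quots (hfst z))) _ _ _ (@def0_rel r)) => //.
    by apply: (coord_comp _ (coord_real _)); coords.
  apply: def0_ext (def0_ex (def0I (proj2 (def0_term_graph c) _ ts) h1)) => x.
  split=> /= [[y []] /=|h]; first by rewrite hfst_hcat hsnd_hcat => <-.
  have [y hy] := quots_surj (evals (quots x) ts).
  by exists y; split; rewrite /= hfst_hcat ?hsnd_hcat hy.
- by move=> c p IHp q IHq; exact: def0_imp IHp IHq.
- move=> c s p IH.
  apply: def0_ext (def0C (def0_ex (def0C IH))) => r; split=> /=.
    move=> h a; have [y hy] := quot_surj a; apply: contrapT => np.
    by apply: h; exists y; rewrite /= hfst_hcat hsnd_hcat hy.
  by move=> h [y]; apply; rewrite /= hfst_hcat hsnd_hcat; apply: h.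
Qed.

(** Counterpart of [vfst] for a mapped context: [inls (c ++ d)] and [inls c ++ inls d] are not
    convertible. *)
Fixpoint mfst (c d : seq (Sort L)) : htup (var (inls (c ++ d))) (inls c) :=
  match c with
  | [::] => tt
  | s :: c' =>
      (vz (inl s) (inls (c' ++ d)), hmap (fun s' v => vs (inl s) v) (mfst c' d))
  end.

Fixpoint msnd (c d : seq (Sort L)) : htup (var (inls (c ++ d))) (inls d) :=
  match c with
  | [::] => vid (inls d)
  | s :: c' => hmap (fun s' v => vs (inl s) v) (msnd c' d)
  end.

Lemma hreal_mfst (c d : seq (Sort L)) (x : tup (Meq M) (inls (c ++ d))) :
  hreal (pull (mfst c d) x : tup (Meq M) (inls c)) = hfst (hreal x).
Proof.
elim: c x => //= s c IH [a x] /=.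
by rewrite /pull /= hmap_hmap /= -IH.
Qed.

Lemma hreal_msnd (c d : seq (Sort L)) (x : tup (Meq M) (inls (c ++ d))) :
  hreal (pull (msnd c d) x : tup (Meq M) (inls d)) = hsnd (hreal x).
Proof.
elim: c x => [x|s c IH [a x]] /=; first by rewrite pull_vid.
by rewrite /pull /= hmap_hmap /= -IH.
Qed.

Definition quot_term (s : Sort (Leq M)) (d : seq (Sort L)) :
    @term (Leq M) (inls (rctx s ++ d)) s :=
  match s return @term (Leq M) (inls (rctx s ++ d)) s with
  | inl s => @tvar (Leq M) _ _ (vz (inl s) (inls d))
  | inr E => @tapp (Leq M) _ (inr E)
      (@var_terms (Leq M) (inls (es_ctx E)) _ (mfst (es_ctx E) d))
  end.

Fixpoint quots_terms (c : seq (Sort (Leq M))) :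
    @terms (Leq M) (inls (rctxs c)) c :=
  match c return @terms (Leq M) (inls (rctxs c)) c with
  | [::] => @tnil (Leq M) _
  | s :: c' => @tcons (Leq M) _ _ _ (quot_term s (rctxs c'))
      (@rents (Leq M) _ _ (msnd (rctx s) (rctxs c')) _ (quots_terms c'))
  end.

Lemma eval_quot_term s d (x : tup (Meq M) (inls (rctx s ++ d))) :
  eval x (quot_term s d) = quot (hfst (hreal x)).
Proof.
case: s x => [s|E] x //=; apply: sval_inj => /=.
by rewrite evals_var_terms hreal_mfst.
Qed.

Lemma evals_quots_terms c (x : tup (Meq M) (inls (rctxs c))) :
  evals x (quots_terms c) = quots (hreal x).
Proof.
elim: c x => [|s c IH] x //=; rewrite eval_quot_term.
by rewrite (proj2 (eval_ren _ _)) IH hreal_msnd.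
Qed.

Lemma def0_evals (L' : lang) (N : structure L') d c (ts : terms d c) :
  def0 [set z : tup N (d ++ c) | evals (hfst z) ts = hsnd z].
Proof.
elim: ts => [|s e t ts IH].
  apply: def0_ext (@def0T _ N _) => z; split=> // _ /=.
  by move: (hsnd z) => [].
have h1 : def0 [set z : tup N (d ++ s :: e) | evals (hfst z) ts = (hsnd z).2].
  apply: (@def0_preE _ _ (d ++ s :: e) _
    (fun z => hcat (hfst z) (@hsnd _ _ [:: s] e (hsnd z))) _ _ _ IH).
    by coords.
  by move=> z; rewrite /= hfst_hcat hsnd_hcat.
have h2 : def0 [set z : tup N (s :: d) | eval z.2 t = z.1].
  exists (feq (rent (vsnd [:: s] d) t) (tvar (vz s d))) => z /=.
  by rewrite (proj1 (eval_ren _ _)) (@pull_vsnd _ _ [:: s]).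
have h3 : def0 [set z : tup N (d ++ s :: e) | eval (hfst z) t = (hsnd z).1].
  apply: (@def0_preE _ _ (d ++ s :: e) _
    (fun z => hcat (@hfst _ _ [:: s] e (hsnd z)) (hfst z)) _ _ _ h2) => //.
  by coords.
apply: def0_ext (def0I h3 h1) => z; split=> /=.
  by move=> [/= -> ->]; case: (hsnd z).
by move=> e1; split; rewrite /= -e1.
Qed.

(** The quotient maps are terms of [Leq M], so that being named by some real tuple satisfying a
    formula of [L] is definable in [Meq M]. *)
Lemma def0_quots_inv c (X : set (tup (Meq M) c)) :
  def0 [set r : tup M (rctxs c) | X (quots r)] -> def0 X.
Proof.
move=> [phi hp].
have [chi hchi] := def0I (def0_evals (Meq M) (quots_terms c))
  (def0_hfst c (def0_sat (Meq M) (form_inl phi))).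
have h : def0 [set z | sat (Meq M) chi z] by exact: def0_sat.
apply: def0_ext (def0_ex h) => u; split.
  move=> [y /hchi [/=]]; rewrite hfst_hcat hsnd_hcat => <- /sat_inl /hp /=.
  by rewrite evals_quots_terms.
have [r <-] := quots_surj u => Xr.
have [y hy] : exists y : tup (Meq M) (inls (rctxs c)), hreal y = r.
  have [r' <-] := real_surj r; by exists (quots r').
exists y; apply/hchi; split; rewrite /= hfst_hcat ?hsnd_hcat.
  by rewrite evals_quots_terms hy.
by apply/sat_inl; rewrite hy; apply/hp.
Qed.

(** [rctxs] commutes with concatenation only up to reassociation, which is a change of
    coordinates. *)
Lemma coord_quots_cat c d :
  exists2 f : tup M (rctxs c ++ rctxs d) -> tup M (rctxs (c ++ d)), coord f
    & forall x, quots (f x) = hcat (quots (hfst x)) (quots (hsnd x)).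
Proof.
elim: c => [|s c [f cf hf]].
  by exists (fun x => x); [coords|].
exists (fun x : tup M ((rctx s ++ rctxs c) ++ rctxs d) =>
  hcat (hfst (hfst x)) (f (hcat (hsnd (hfst x)) (hsnd x)))).
  apply: coord_hcat; first by coords.
  by apply: (coord_comp _ cf); coords.
by move=> x; rewrite /= hfst_hcat hsnd_hcat hf hfst_hcat hsnd_hcat.
Qed.

Lemma over_set0_def0 (L' : lang) (N : structure L') c (phi : pform N c) :
  over set0 phi -> def0 (psat phi).
Proof.
case: phi => -[|s e] phi p; rewrite /over /psat /=; last first.
  by move=> /(_ _ (or_introl erefl)).
move=> _; have [w hw] : coord (fun x : tup N c => hcat x (tt : tup N [::])).
  by coords.
case: p; exists (renf w phi) => x.
by rewrite sat_ren -hw.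
Qed.

End Meq.

(** * Finite invariant equivalence relations when acl(0) = dcl(0) *)

Section FiniteEquivalence.
Variables (L : lang) (M : structure L).
Hypothesis ft : fin_types (Meq M).
Hypothesis acl_dcl : @acl _ (Meq M) set0 = dcl set0.
Variables (c : seq (Sort (Leq M))) (c_gt0 : (0 < size c)%N).
Variable R : tup (Meq M) c -> tup (Meq M) c -> Prop.
Hypothesis Rrefl : forall x, R x x.
Hypothesis Rsym : forall x y, R x y -> R y x.
Hypothesis Rtrans : forall x y z, R x y -> R y z -> R x z.
Hypothesis Rinv : forall x y x' y',
  eqv (hcat x y) (hcat x' y') -> R x y -> R x' y'.
Hypothesis Rfin :
  ~ exists s : nat -> tup (Meq M) c, forall i j, i <> j -> ~ R (s i) (s j).

Lemma def0_pull_R : def0 [set z : tup M (rctxs c ++ rctxs c) |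
  R (quots (hfst z)) (quots (hsnd z))].
Proof.
have h : def0 [set z : tup (Meq M) (c ++ c) | R (hfst z) (hsnd z)].
  apply: (inv_def0 ft) => z z' zz'; apply: Rinv.
  by rewrite !hcat_hfst_hsnd.
have [phi hp] := h; have [f cf hf] := coord_quots_cat c c.
apply: def0_preE cf (def0_quots phi) _ => z.
by rewrite /= -hp /= hf hfst_hcat hsnd_hcat.
Qed.

(** The class of [u] is an element of a finite sort, hence algebraic over the empty set and by
    hypothesis definable over it. Lying in this class is then a property of the type of [u]. *)
Lemma finite_equivalence_trivial u u' : eqv u u' -> R u u'.
Proof.
have [phi hp] := def0_pull_R.
have hp' (a b : tup M (rctxs c)) : R (quots a) (quots b) <-> sat M phi (hcat a b).
  by rewrite -hp /= hfst_hcat hsnd_hcat.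
have pos : (0 < size (rctxs c))%N.
  case: (c) c_gt0 => // s d _; rewrite /= size_cat.
  case: s => // E /=; apply: leq_trans (es_pos E) _; exact: leq_addr.
have er (a : tup M (rctxs c)) : sat M phi (hcat a a) by apply/hp'.
have es (a b : tup M (rctxs c)) : sat M phi (hcat a b) -> sat M phi (hcat b a).
  by move=> /hp' /Rsym /hp'.
have et (a b d : tup M (rctxs c)) : sat M phi (hcat a b) ->
    sat M phi (hcat b d) -> sat M phi (hcat a d).
  by move=> /hp' h1 /hp' h2; apply/hp'; apply: Rtrans h1 h2.
(* Sorts exist only for relations on real tuples, hence the pull-back of [R] along [quots]. *)
pose E := EqSort pos er es et.
pose cl (a : tup M (rctxs c)) : Meq M (inr E) := @quot L M (inr E) a.
have hcl a b : R (quots a) (quots b) <-> cl a = cl b.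
  rewrite hp'; rewrite -(@eqclass_eq _ _ E).
  by split=> [h|/(congr1 sval) //]; exact: sval_inj.
have cl_surj (y : Meq M (inr E)) : exists a, cl a = y.
  exact: (@quot_surj L M (inr E) y).
have finE : finite_set [set: Meq M (inr E)].
  apply: contrapT => /infiniteP/card_leP/unsquash g; apply: Rfin.
  pose k (i : nat) := projT1 (cid (cl_surj (val (g (to_setT i))))).
  have hk i : cl (k i) = val (g (to_setT i)) by rewrite /k; case: cid.
  exists (fun i => quots (k i)) => i j ij /hcl; rewrite !hk => /val_inj.
  by move=> /(inj (in_setT _) (in_setT _)) /(congr1 val) /=.
have [r <-] := quots_surj u => rr'.
have : @acl _ (Meq M) set0 (existT (car (Meq M)) (inr E) (cl r)).
  exists (@PForm _ (Meq M) [:: inr E] [::]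
    (fimp (@fbot (Leq M) _) (@fbot (Leq M) _)) tt); split=> //.
  apply: sub_finite_set (finite_image (fun y => (y, tt)) finE).
  by move=> [y []] _; exists y.
rewrite acl_dcl => -[psi /over_set0_def0 h1 /= e1].
move: h1; rewrite e1 => h1.
(* The graph relating a class to the tuples that its members name. Fixing the class, now a
   0-definable point, gives a 0-definable set containing [quots r]. *)
have h2 : def0 [set z : tup (Meq M) (inr E :: c) |
    exists2 a, cl a = z.1 & quots a = z.2].
  apply: def0_quots_inv.
  apply: def0_ext def0_pull_R => z; split=> /=.
    by move=> h; exists (hsnd z) => //; apply/hcl; apply: Rsym.
  by move=> [a h <-]; apply: Rsym; apply/hcl.
have h4 : def0 [set v : tup (Meq M) c | exists2 a, cl a = cl r & quots a = v].
  have h3 := @def0_ex _ (Meq M) c [:: inr E] _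
    (def0I (@def0_hfst _ (Meq M) [:: inr E] c _ h1) h2).
  apply: def0_ext h3 => v.
  split=> /= [[[y []] [/= [<-] [a h4 h5]]]|[a h4 h5]]; first by exists a.
  by exists (cl r, tt); split=> //; exists a.
have [|a ha hq] := eqv_def0 h4 rr'; first by exists r.
by rewrite -hq; apply/hcl.
Qed.

End FiniteEquivalence.

Local Open Scope ring_scope.

(** * Measures of definable sets and Fubini *)

Section InvOver.
Variables (L : lang) (N : structure L).
Hypothesis ft : fin_types N.
Implicit Types c d e : seq (Sort L).

Lemma inv_overP e (a : tup N e) c (X : set (tup N c)) :
  inv_over a X <-> exists2 X0 : set (tup N (c ++ e)), def0 X0 &
    forall x, X x <-> X0 (hcat x a).
Proof.
split=> [hX|[X0 d0 h] x x' xx' /h Xx]; last exact/h/(eqv_def0 d0 xx').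
exists [set z | exists2 x, X x & eqv (hcat x a) z].
  apply: (inv_def0 ft) => z z' zz' [x Xx xz]; exists x => //.
  exact: eqv_trans zz'.
by move=> x; split=> [Xx|[x' Xx' h]]; [exists x|apply: hX Xx'].
Qed.

Lemma inv_over_catl e (a : tup N e) d (b : tup N d) c (X : set (tup N c)) :
  inv_over a X -> inv_over (hcat a b) X.
Proof.
move=> h x x' xx'; apply: h.
have cf : coord (fun z : tup N (c ++ e ++ d) => hcat (hfst z) (hfst (hsnd z))).
  by coords.
by have := eqv_coord cf xx'; rewrite !hfst_hcat !hsnd_hcat !hfst_hcat.
Qed.

Lemma inv_over_catr e (a : tup N e) d (b : tup N d) c (X : set (tup N c)) :
  inv_over b X -> inv_over (hcat a b) X.
Proof.
move=> h x x' xx'; apply: h.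
have cf : coord (fun z : tup N (c ++ e ++ d) => hcat (hfst z) (hsnd (hsnd z))).
  by coords.
by have := eqv_coord cf xx'; rewrite !hfst_hcat !hsnd_hcat.
Qed.

Lemma inv_over_tt c (X : set (tup N c)) : def0 X -> inv_over (tt : tup N [::]) X.
Proof.
move=> dX x x' xx'; apply: (eqv_def0 dX).
have cf : coord (fun z : tup N (c ++ [::]) => hfst z) by coords.
by have := eqv_coord cf xx'; rewrite !hfst_hcat.
Qed.

End InvOver.

Section Casts.
Variables (S : Type) (T : S -> Type).

(** [mask b c] is equal to the selected context only propositionally, so mask projections are
    compared with [hfst] and [hsnd] through a cast. *)
Definition htup_cast c c' (e : c = c') (x : htup T c) : htup T c' :=
  eq_rect c (htup T) x c' e.

Lemma htup_cast_cons s c c' (e : s :: c = s :: c') (e' : c = c') (x : htup T (s :: c)) :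
  htup_cast e x = (x.1, htup_cast e' x.2).
Proof.
by case: _ / e' e => e; rewrite (Prop_irrelevance e erefl); case: x.
Qed.

Lemma hproj_fst c d (w : htup T (c ++ d))
    (e : mask (nseq (size c) true ++ nseq (size d) false) (c ++ d) = c) :
  htup_cast e (hproj (nseq (size c) true ++ nseq (size d) false) w) = hfst w.
Proof.
elim: c w e => [|s c IH] w e; first by case: (htup_cast _ _).
have e' : mask (nseq (size c) true ++ nseq (size d) false) (c ++ d) = c.
  by case: e.
by rewrite (htup_cast_cons e e') /= IH.
Qed.

Lemma hproj_true c (w : htup T c) (e : mask (nseq (size c) true) c = c) :
  htup_cast e (hproj (nseq (size c) true) w) = w.
Proof.
elim: c w e => [|s c IH] w e; first by case: (htup_cast _ _); case: w.
have e' : mask (nseq (size c) true) c = c by case: e.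
by rewrite (htup_cast_cons e e') /= IH; case: w.
Qed.

Lemma htup_cast_inj c c' (e : c = c') : injective (htup_cast e).
Proof. by case: _ / e. Qed.

Lemma hproj_snd c d (w : htup T (c ++ d))
    (e : mask (nseq (size c) false ++ nseq (size d) true) (c ++ d) = d) :
  htup_cast e (hproj (nseq (size c) false ++ nseq (size d) true) w) = hsnd w.
Proof.
elim: c w e => [|s c IH] w e; last exact: IH.
exact: hproj_true.
Qed.

End Casts.

(** * Definable sets and their dimension and measure on fixed sorts *)

Section Measure.
Variables (R : realType) (L : lang) (N : structure L) (h : dim_meas R N).
Variable S : set (Sort L).
Hypothesis ft : fin_types N.
Hypothesis hS : MS_measurable_on h S.
Implicit Types c d e : seq (Sort L).
Local Notation dm := (dm h).
Local Notation ms := (ms h).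

Definition sorts_in c : Prop := in_sorts S c /\ (0 < size c)%N.

Definition definable c (X : set (tup N c)) : Prop :=
  exists e (a : tup N e), in_sorts S e /\ inv_over a X.

Lemma in_sorts_cat c d : in_sorts S c -> in_sorts S d -> in_sorts S (c ++ d).
Proof. by move=> hc hd; apply/List.Forall_app. Qed.

Lemma sorts_in_cat c d : sorts_in c -> sorts_in d -> sorts_in (c ++ d).
Proof.
move=> [h1 h2] [h3 h4]; split; first exact: in_sorts_cat.
by rewrite size_cat addn_gt0 h2.
Qed.

Lemma elts_sorts c (a : tup N c) : in_sorts S c ->
  elts a `<=` [set e : elt N | S (projT1 e)].
Proof.
elim: c a => [|s c IH] a hc //=.
have h1 := List.Forall_inv hc; have h2 := List.Forall_inv_tail hc.
by move=> x [->|/(IH _ h2)].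
Qed.

Lemma definable_Def c (X : set (tup N c)) : sorts_in c -> definable X -> X !=set0 -> Def S X.
Proof.
move=> [h1 h2] [e [a [he /(inv_overP ft) [X0 [phi hp] hX]]]] ne; split=> //.
exists (PForm phi a); first exact: elts_sorts.
by apply/seteqP; split=> x; rewrite /psat /= hX hp.
Qed.

Lemma def0_dfn c (X : set (tup N c)) : def0 X -> definable X.
Proof.
move=> hX; exists [::], tt; split; first exact: List.Forall_nil.
exact: inv_over_tt.
Qed.

Lemma definable2 c d (X : set (tup N c)) (Y : set (tup N d)) : definable X -> definable Y ->
  exists e (a : tup N e), [/\ in_sorts S e, inv_over a X & inv_over a Y].
Proof.
move=> [e [a [he ha]]] [e' [a' [he' ha']]].
exists (e ++ e'), (hcat a a'); split; first exact: in_sorts_cat.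
  exact: inv_over_catl.
exact: inv_over_catr.
Qed.

Lemma definableC c (X : set (tup N c)) : definable X -> definable (~` X).
Proof.
move=> [e [a [he ha]]]; exists e, a; split=> // x x' xx' nX Xx'; apply: nX.
by apply: ha Xx'; apply: eqv_sym.
Qed.

Lemma definableI c (X Y : set (tup N c)) : definable X -> definable Y -> definable (X `&` Y).
Proof.
move=> dX dY; have [e [a [he h1 h2]]] := definable2 dX dY; exists e, a.
by split=> // x x' xx' [/(h1 _ _ xx') ? /(h2 _ _ xx') ?].
Qed.

Lemma definable_type_over e (a : tup N e) c (t : tup N c) : in_sorts S e ->
  definable (type_over a t).
Proof.
move=> he; exists e, a; split=> // x x' xx' tx; exact: eqv_trans xx'.
Qed.

Lemma definable_pre c d (f : tup N c -> tup N d) (X : set (tup N d)) :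
  coord f -> definable X -> definable (f @^-1` X).
Proof.
move=> cf [e [a [he ha]]]; exists e, a; split=> // x x' xx'; apply: ha.
have cg : coord (fun z : tup N (c ++ e) => hcat (f (hfst z)) (hsnd z)).
  by apply: coord_hcat; [apply: coord_comp cf|]; coords.
by have := eqv_coord cg xx'; rewrite !hfst_hcat !hsnd_hcat.
Qed.

Lemma definable_secr c d (W : set (tup N (c ++ d))) (b : tup N c) : in_sorts S c ->
  definable W -> definable [set y | W (hcat b y)].
Proof.
move=> hc [e [a [he ha]]]; exists (c ++ e), (hcat b a).
split; first exact: in_sorts_cat.
move=> y y' yy' /=; apply: ha.
have cf : coord (fun z : tup N (d ++ c ++ e) =>
    hcat (hcat (hfst (hsnd z)) (hfst z)) (hsnd (hsnd z))) by coords.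
by have := eqv_coord cf yy'; rewrite !(hfst_hcat, hsnd_hcat).
Qed.

Lemma definable_secl c d (W : set (tup N (c ++ d))) (b : tup N d) : in_sorts S d ->
  definable W -> definable [set y | W (hcat y b)].
Proof.
move=> hc [e [a [he ha]]]; exists (d ++ e), (hcat b a).
split; first exact: in_sorts_cat.
move=> y y' yy' /=; apply: ha.
have cf : coord (fun z : tup N (c ++ d ++ e) =>
    hcat (hcat (hfst z) (hfst (hsnd z))) (hsnd (hsnd z))) by coords.
by have := eqv_coord cf yy'; rewrite !(hfst_hcat, hsnd_hcat).
Qed.

Lemma definable_proj_l c d (W : set (tup N (c ++ d))) :
  definable W -> definable [set x | exists y, W (hcat x y)].
Proof.
move=> [e [a [he ha]]]; exists e, a; split=> // x x' xx' [y Wy].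
have [y' hy'] := eqv_extend ft y xx'; exists y'; apply: ha Wy.
have cf : coord (fun z : tup N (d ++ c ++ e) =>
    hcat (hcat (hfst (hsnd z)) (hfst z)) (hsnd (hsnd z))) by coords.
by have := eqv_coord cf hy'; rewrite !(hfst_hcat, hsnd_hcat).
Qed.

Lemma ms_gt0 c (X : set (tup N c)) : sorts_in c -> definable X -> X !=set0 -> 0 < ms X.
Proof. by move=> oc dX nX; apply: (MS_pos hS); apply: definable_Def. Qed.

(** The parameters giving a prescribed value of [h] form a 0-definable set, which is closed under
    equality of types. *)
Lemma h_eqv c e (D : set (tup N (c ++ e))) (a a' : tup N e) :
  sorts_in c -> in_sorts S e -> def0 D -> eqv a a' ->
  [set x | D (hcat x a)] !=set0 ->
  [set x | D (hcat x a')] !=set0 /\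
  h [set x | D (hcat x a')] = h [set x | D (hcat x a)].
Proof.
move=> [oc c0] oe [phi hp] aa' ne.
have E b : [set x | D (hcat x b)] = fibre phi b.
  by apply/seteqP; split=> x /hp.
rewrite !E in ne *.
have [chi ov hchi] := MS_definable hS phi (h (fibre phi a)) c0 oc oe.
have d0 : def0 [set b : tup N e | fibre phi b !=set0 /\
    h (fibre phi b) = h (fibre phi a)].
  by rewrite hchi; apply: over_set0_def0.
exact: (eqv_def0 d0 aa' (conj ne erefl)).
Qed.

Lemma dm_sub c (X Y : set (tup N c)) : sorts_in c -> definable X -> definable Y ->
  X !=set0 -> X `<=` Y -> (dm X <= dm Y)%N.
Proof.
move=> oc dX dY nX XY.
have [e|/set0P ne] := eqVneq (Y `&` ~` X) set0.
  suff -> : X = Y by [].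
  apply/seteqP; split=> // y Yy; apply: contrapT => nXy.
  by have : (Y `&` ~` X) y by []; rewrite e.
have -> : Y = X `|` (Y `&` ~` X).
  apply/seteqP; split=> y; last by move=> [/XY|[]].
  by have [?|?] := pselect (X y); [left|right].
rewrite (MS_dimU hS); first exact: leq_maxl.
- exact: definable_Def.
- by apply: definable_Def => //; apply: definableI => //; apply: definableC.
- by apply/seteqP; split=> // y [? []].
Qed.

Lemma h_cast c c' (e : c = c') (X : set (tup N c')) :
  h [set x : tup N c | X (htup_cast e x)] = h X.
Proof. by case: _ / e X. Qed.

Definition mask_l c d : bitseq := nseq (size c) true ++ nseq (size d) false.
Definition mask_r c d : bitseq := nseq (size c) false ++ nseq (size d) true.

Lemma mask_lE c d : mask (mask_l c d) (c ++ d) = c.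
Proof.
by rewrite mask_cat ?size_nseq // mask_true // mask_false cats0.
Qed.

Lemma mask_rE c d : mask (mask_r c d) (c ++ d) = d.
Proof. by rewrite mask_cat ?size_nseq // mask_false mask_true. Qed.

Lemma size_mask_l c d : size (mask_l c d) = size (c ++ d).
Proof. by rewrite /mask_l !size_cat !size_nseq. Qed.

Lemma size_mask_r c d : size (mask_r c d) = size (c ++ d).
Proof. by rewrite /mask_r !size_cat !size_nseq. Qed.

Lemma hproj_mask (b : bitseq) c c' (e : mask b c = c') (p : tup N c -> tup N c') :
  (forall w, htup_cast e (hproj b w) = p w) ->
  forall (X : set (tup N c)) (k : nat) (nu : R), sorts_in c -> definable X -> X !=set0 ->
  size b = size c -> (0 < count id b < size c)%N ->
  (forall y, (p @` X) y -> h (p @^-1` [set y] `&` X) = (k, nu)) ->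
  dm X = (dm (p @` X) + k)%N /\ ms X = ms (p @` X) * nu.
Proof.
move=> hp X k nu oc dX nX sb cb hy.
have hE : h (p @` X) = h (@hproj _ (car N) b c @` X : set (tup N _)).
  rewrite -(h_cast e); congr (h _); apply/seteqP; split=> y.
    by move=> [x Xx]; rewrite -hp => /htup_cast_inj <-; exists x.
  by move=> [x Xx <-]; exists x; rewrite ?hp.
have [y hy'|h1 h2] := MS_fubini hS (definable_Def oc dX nX) sb cb (k := k) (nu := nu).
  rewrite -(hy (htup_cast e y)); last first.
    by case: hy' => x Xx <-; exists x; rewrite ?hp.
  congr (h _); apply/seteqP; split=> x [] /= hx Xx; split=> //=.
    by rewrite -hp hx.
  by move: hx; rewrite -hp => /htup_cast_inj.
by rewrite /dm /ms hE.
Qed.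

(** Fubini with one-point fibres, whose value is (0, 1). *)
Lemma h_proj_inj (b : bitseq) c c' (e : mask b c = c') (p : tup N c -> tup N c') :
  (forall w, htup_cast e (hproj b w) = p w) ->
  forall X : set (tup N c), sorts_in c -> definable X -> X !=set0 ->
  size b = size c -> (0 < count id b < size c)%N ->
  (forall x x', X x -> X x' -> p x = p x' -> x = x') ->
  h (p @` X) = h X.
Proof.
move=> hp X oc dX nX sb cb inj.
have [y [x Xx xy]|h1 h2] := hproj_mask hp (k := 0%N) (nu := 1) oc dX nX sb cb.
  have -> : p @^-1` [set y] `&` X = [set x].
    apply/seteqP; split=> z /=; last by move=> ->.
    by move=> [zy Xz]; apply: inj => //; rewrite xy zy.
  by apply: (MS_point hS); have [] := oc.
move: h1 h2; rewrite addn0 mulr1 /Defs.dm /Defs.ms.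
by case: (h X) (h (p @` X)) => [? ?] [? ?] /= -> ->.
Qed.

Lemma count_mask_l c d : sorts_in c -> sorts_in d ->
  (0 < count id (mask_l c d) < size (c ++ d))%N.
Proof.
move=> oc od; rewrite /mask_l count_cat !count_nseq /= mul0n mul1n addn0.
by rewrite size_cat (proj2 oc) -[X in (X < _)%N]addn0 ltn_add2l (proj2 od).
Qed.

Lemma count_mask_r c d : sorts_in c -> sorts_in d ->
  (0 < count id (mask_r c d) < size (c ++ d))%N.
Proof.
move=> oc od; rewrite /mask_r count_cat !count_nseq /= mul0n mul1n add0n.
by rewrite size_cat (proj2 od) -[X in (X < _)%N]add0n ltn_add2r (proj2 oc).
Qed.

Lemma h_fst_inj c d (X : set (tup N (c ++ d))) :
  sorts_in c -> sorts_in d -> definable X -> X !=set0 ->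
  (forall x x', X x -> X x' -> hfst x = hfst x' -> x = x') ->
  h ((fun w => hfst w) @` X) = h X.
Proof.
move=> oc od dX nX; apply: (h_proj_inj (@hproj_fst _ (car N) c d ^~ (mask_lE c d))) => //.
- exact: sorts_in_cat.
- exact: size_mask_l.
- exact: count_mask_l.
Qed.

Lemma h_snd_inj c d (X : set (tup N (c ++ d))) :
  sorts_in c -> sorts_in d -> definable X -> X !=set0 ->
  (forall x x', X x -> X x' -> hsnd x = hsnd x' -> x = x') ->
  h ((fun w => hsnd w) @` X) = h X.
Proof.
move=> oc od dX nX; apply: (h_proj_inj (@hproj_snd _ (car N) c d ^~ (mask_rE c d))) => //.
- exact: sorts_in_cat.
- exact: size_mask_r.
- exact: count_mask_r.
Qed.

(** The fibres in the Fubini axiom are subsets of the whole product; this identifies their values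
    with those of the sections. *)
Lemma h_point_times c d (b : tup N c) (Y : set (tup N d)) :
  sorts_in c -> sorts_in d -> definable Y -> Y !=set0 ->
  h [set w : tup N (c ++ d) | hfst w = b /\ Y (hsnd w)] = h Y.
Proof.
move=> oc od dY [y0 Yy0]; pose X := [set w : tup N (c ++ d) | hfst w = b /\ Y (hsnd w)].
have dX : definable X.
  have d1 : definable [set w : tup N (c ++ d) | Y (hsnd w)].
    by apply: (@definable_pre _ _ (fun w => hsnd w)) dY; coords.
  suff d2 : definable [set w : tup N (c ++ d) | hfst w = b] by exact: definableI.
  exists c, b; split=> [|w w' ww' /= e]; first exact: (proj1 oc).
  have dd : def0 [set z : tup N ((c ++ d) ++ c) | hfst (hfst z) = hsnd z].
    by apply: def0_eq; coords.
  by have := eqv_def0 dd ww'; rewrite /= !hfst_hcat !hsnd_hcat; apply.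
have E : (fun w => hsnd w) @` X = Y.
  apply/seteqP; split=> y; first by move=> [w [_ Yw] <-].
  by move=> Yy; exists (hcat b y); rewrite ?hsnd_hcat //; split; rewrite ?hfst_hcat ?hsnd_hcat.
rewrite -[X in _ = h X]E h_snd_inj //.
  by exists (hcat b y0); split; rewrite ?hfst_hcat ?hsnd_hcat.
move=> x x' [xb _] [xb' _] e.
by rewrite -[x]hcat_hfst_hsnd -[x']hcat_hfst_hsnd xb xb' e.
Qed.

Definition swap c d (w : tup N (c ++ d)) : tup N (d ++ c) :=
  hcat (hsnd w) (hfst w).

Lemma coord_swap c d : coord (@swap c d).
Proof. by rewrite /swap; coords. Qed.

Lemma swapK c d (w : tup N (c ++ d)) : swap (swap w) = w.
Proof. by rewrite /swap hfst_hcat hsnd_hcat hcat_hfst_hsnd. Qed.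

(* Both sets are injective projections of the graph of [swap] on [X]. *)
Lemma h_swap c d (X : set (tup N (c ++ d))) : sorts_in c -> sorts_in d -> definable X ->
  X !=set0 -> h (@swap d c @^-1` X) = h X.
Proof.
move=> oc od dX [x0 Xx0].
pose G := [set z : tup N ((c ++ d) ++ (d ++ c)) |
  X (hfst z) /\ swap (hfst z) = hsnd z].
have dG : definable G.
  apply: definableI; first by apply: (@definable_pre _ _ (fun z => hfst z)) dX; coords.
  apply: def0_dfn; apply: def0_eq; last by coords.
  by apply: (coord_comp _ (@coord_swap c d)); coords.
have nG : G !=set0.
  by exists (hcat x0 (swap x0)); split; rewrite hfst_hcat ?hsnd_hcat.
have o1 := sorts_in_cat oc od; have o2 := sorts_in_cat od oc.
have E1 : (fun z => hfst z) @` G = X.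
  apply/seteqP; split=> y; first by move=> [w [Xw _] <-].
  move=> Xy; exists (hcat y (swap y)); rewrite ?hfst_hcat //.
  by split; rewrite hfst_hcat ?hsnd_hcat.
have E2 : (fun z => hsnd z) @` G = @swap d c @^-1` X.
  apply/seteqP; split=> y; first by move=> [w [Xw e] <-]; rewrite /= -e swapK.
  move=> Xy; exists (hcat (swap y) y); rewrite ?hsnd_hcat //.
  by split; rewrite hfst_hcat ?hsnd_hcat ?swapK.
rewrite -E2 -[X in RHS]E1 h_snd_inj // ?h_fst_inj //.
  move=> x x' [_ e] [_ e'] exx'.
  by rewrite -[x]hcat_hfst_hsnd -[x']hcat_hfst_hsnd -e -e' exx'.
move=> x x' [_ e] [_ e'] exx'.
rewrite -[x]hcat_hfst_hsnd -[x']hcat_hfst_hsnd exx'; congr hcat.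
by rewrite -[hfst x]swapK -[hfst x']swapK e e' exx'.
Qed.

Lemma fubini_l c d (X : set (tup N (c ++ d))) k nu :
  sorts_in c -> sorts_in d -> definable X -> X !=set0 ->
  (forall x, (exists y, X (hcat x y)) -> h [set y | X (hcat x y)] = (k, nu)) ->
  dm X = (dm [set x | exists y, X (hcat x y)] + k)%N /\
  ms X = ms [set x | exists y, X (hcat x y)] * nu.
Proof.
move=> oc od dX nX hk.
have <- : (fun w => hfst w) @` X = [set x | exists y, X (hcat x y)].
  apply/seteqP; split=> x /=.
    by move=> [w Xw <-]; exists (hsnd w); rewrite hcat_hfst_hsnd.
  by move=> [y Xy]; exists (hcat x y); rewrite ?hfst_hcat.
apply: (hproj_mask (@hproj_fst _ (car N) c d ^~ (mask_lE c d))) => //.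
- exact: sorts_in_cat.
- exact: size_mask_l.
- exact: count_mask_l.
move=> x [w Xw wx].
have ex : exists y, X (hcat x y) by exists (hsnd w); rewrite -wx hcat_hfst_hsnd.
rewrite -(hk x ex) -(h_point_times x oc od) //.
- congr (h _); apply/seteqP; split=> z /=.
    by move=> [<- Xz]; rewrite hcat_hfst_hsnd.
  by move=> [<-]; rewrite hcat_hfst_hsnd.
- exact: definable_secr (proj1 oc) dX.
Qed.

(* The [k]-dimensional measure: sets of dimension other than [k] get 0. *)
Definition ms_at k c (X : set (tup N c)) : R :=
  if pselect (X !=set0 /\ dm X = k) then ms X else 0.

Definition le_dim c (X : set (tup N c)) k : Prop := X !=set0 -> (dm X <= k)%N.

Lemma ms_at0 k c : ms_at k (set0 : set (tup N c)) = 0.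
Proof. by rewrite /ms_at; case: pselect => // -[[]]. Qed.

Lemma ms_atE k c (X : set (tup N c)) : X !=set0 ->
  ms_at k X = if dm X == k then ms X else 0.
Proof.
move=> nX; rewrite /ms_at; case: pselect => [p|np] /=; first by rewrite (proj2 p) eqxx.
by case: eqP => // e; case: np.
Qed.

Lemma ms_at_ge0 k c (X : set (tup N c)) : sorts_in c -> definable X -> 0 <= ms_at k X.
Proof.
move=> oc dX; rewrite /ms_at; case: pselect => // p.
exact: ltW (ms_gt0 oc dX (proj1 p)).
Qed.

(** The dimension bounds matter: a part of dimension above [k] would turn the value of the union
    into 0. *)
Lemma ms_atU k c (X Y : set (tup N c)) : sorts_in c -> definable X -> definable Y ->
  X `&` Y = set0 -> le_dim X k -> le_dim Y k ->
  ms_at k (X `|` Y) = ms_at k X + ms_at k Y.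
Proof.
move=> oc dX dY XY lX lY.
have [->|/set0P nX] := eqVneq X set0; first by rewrite ms_at0 set0U add0r.
have [->|/set0P nY] := eqVneq Y set0; first by rewrite ms_at0 setU0 addr0.
have nU : X `|` Y !=set0 by case: nX => x Xx; exists x; left.
have [DX DY] := (definable_Def oc dX nX, definable_Def oc dY nY).
have := MS_dimU hS DX DY XY; rewrite !ms_atE // => ->.
move: (lX nX) (lY nY) => lx ly.
have [lt|gt|e] := ltngtP (dm X) (dm Y).
- rewrite (MS_measU_lt hS) // [in RHS](_ : (dm X == k) = false) ?add0r //.
  by apply/eqP => e; move: lt; rewrite e ltnNge ly.
- rewrite setUC (MS_measU_lt hS) 1?setIC //.
  rewrite [in RHS](_ : (dm Y == k) = false) ?addr0 //.
  by apply/eqP => e; move: gt; rewrite e ltnNge lx.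
- rewrite (MS_measU_eq hS) // e; case: eqP => // _; by rewrite addr0.
Qed.

Definition base c (B : set (tup N c)) : Prop :=
  [/\ sorts_in c, def0 B & B !=set0].

(** A finitely additive probability on [B] for which sets of smaller dimension are null. *)
Definition rel_ms c (B X : set (tup N c)) : R := ms_at (dm B) (X `&` B) / ms B.

Section Base.
Variables (c : seq (Sort L)) (B : set (tup N c)).
Hypothesis bB : base B.

Lemma base_sorts : sorts_in c. Proof. by case: bB. Qed.
Lemma base_dfn : definable B. Proof. by case: bB => _ /def0_dfn. Qed.
Lemma base_gt0 : 0 < ms B.
Proof. by case: bB => oc /def0_dfn dB nB; apply: ms_gt0. Qed.

Lemma le_dim_base X : definable X -> le_dim (X `&` B) (dm B).
Proof.
move=> dX nX; apply: dm_sub => //; first exact: base_sorts.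
- by apply: definableI => //; exact: base_dfn.
- exact: base_dfn.
Qed.

Lemma rel_ms_ge0 X : definable X -> 0 <= rel_ms B X.
Proof.
move=> dX; apply: divr_ge0; last exact: ltW base_gt0.
by apply: ms_at_ge0 base_sorts _; apply: definableI => //; apply: base_dfn.
Qed.

Lemma rel_ms_disj X : X `&` B = set0 -> rel_ms B X = 0.
Proof. by rewrite /rel_ms => ->; rewrite ms_at0 mul0r. Qed.

Lemma rel_ms_base X : B `<=` X -> rel_ms B X = 1.
Proof.
move=> BX; rewrite /rel_ms (_ : X `&` B = B); last exact/setIidr.
by rewrite ms_atE ?eqxx ?divff ?gt_eqF ?base_gt0 //; case: bB.
Qed.

Lemma rel_ms_ext X Y : (forall x, B x -> (X x <-> Y x)) -> rel_ms B X = rel_ms B Y.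
Proof.
move=> XY; rewrite /rel_ms; congr (ms_at _ _ / _).
by apply/seteqP; split=> x [h1 h2]; split=> //; apply/XY.
Qed.

Lemma rel_msU X Y : definable X -> definable Y -> X `&` Y `&` B = set0 ->
  rel_ms B (X `|` Y) = rel_ms B X + rel_ms B Y.
Proof.
move=> dX dY XY; rewrite /rel_ms -mulrDl -ms_atU.
- by rewrite setIUl.
- exact: base_sorts.
- by apply: definableI => //; exact: base_dfn.
- by apply: definableI => //; exact: base_dfn.
- by rewrite -subset0 => x [[? ?] [? _]]; rewrite -XY.
- exact: le_dim_base.
- exact: le_dim_base.
Qed.

Lemma rel_ms_split X Y : definable X -> definable Y ->
  rel_ms B X = rel_ms B (X `&` Y) + rel_ms B (X `&` ~` Y).
Proof.
move=> dX dY; rewrite -rel_msU.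
- by rewrite -setIUr setUCr setIT.
- exact: definableI.
- by apply: definableI => //; apply: definableC.
- by rewrite -subset0 => x [[[? ?] [_ []]]].
Qed.

Definition ind (A : set (tup N c)) (x : tup N c) : R := (`[< A x >])%:R.

Lemma ind1 (A : set (tup N c)) x : A x -> ind A x = 1.
Proof. by move=> /asboolP e; rewrite /ind e. Qed.

Lemma ind0 (A : set (tup N c)) x : ~ A x -> ind A x = 0.
Proof. by move=> /asboolPn /negbTE e; rewrite /ind e. Qed.

Lemma ind_ext (A A' : set (tup N c)) x : (A x <-> A' x) -> ind A x = ind A' x.
Proof.
by move=> e; rewrite /ind (asbool_equiv_eq e).
Qed.

Definition simple (l : seq (R * set (tup N c))) : Prop :=
  forall p, List.In p l -> definable p.2.

Lemma simple_cons p l : simple (p :: l) <-> definable p.2 /\ simple l.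
Proof.
split=> [hl|[h1 h2] q [<- //|/h2 //]]; split=> [|q ql]; apply: hl; by [left|right].
Qed.

Lemma simple_cat l l' : simple l -> simple l' -> simple (l ++ l').
Proof. by move=> h1 h2 p /List.in_app_iff [/h1|/h2]. Qed.

(* Positivity makes the integral of a simple function independent of the way it
   is written as a combination of indicators. *)
Lemma simple_pos_aux l D (r : R) : simple l -> definable D ->
  (forall x, B x -> D x -> 0 <= r + \sum_(p <- l) p.1 * ind p.2 x) ->
  0 <= r * rel_ms B D + \sum_(p <- l) p.1 * rel_ms B (p.2 `&` D).
Proof.
elim: l D r => [|[q A] l IH] D r.
  move=> _ dD pos; rewrite big_nil addr0.
  have [/rel_ms_disj ->|/set0P [x [Dx Bx]]] := eqVneq (D `&` B) set0.
    by rewrite mulr0.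
  apply: mulr_ge0; last exact: rel_ms_ge0.
  by have := pos x Bx Dx; rewrite big_nil addr0.
move=> /simple_cons [/= dA sl] dD pos; rewrite big_cons /=.
(* [r] collects the coefficients of the sets already known to contain [D]; cutting [D] along [A]
   adds [q] to it on one half. *)
have dDA := definableI dD dA; have dDN := definableI dD (definableC dA).
have h1 : 0 <= (r + q) * rel_ms B (D `&` A) + \sum_(p <- l) p.1 * rel_ms B (p.2 `&` (D `&` A)).
  apply: IH => // x Bx [Dx Ax]; have := pos x Bx Dx.
  by rewrite big_cons /= ind1 // mulr1 addrA.
have h2 : 0 <= r * rel_ms B (D `&` ~` A) + \sum_(p <- l) p.1 * rel_ms B (p.2 `&` (D `&` ~` A)).
  apply: IH => // x Bx [Dx Ax]; have := pos x Bx Dx.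
  by rewrite big_cons /= ind0 // mulr0 add0r.
have := addr_ge0 h1 h2.
rewrite addrACA -big_split /= (rel_ms_split dD dA).
suff -> : \sum_(p <- l) (p.1 * rel_ms B (p.2 `&` (D `&` A)) +
    p.1 * rel_ms B (p.2 `&` (D `&` ~` A))) = \sum_(p <- l) p.1 * rel_ms B (p.2 `&` D).
  by rewrite (setIC A D); lra.
elim: l sl {IH pos h1 h2} => [|p l IH]; first by rewrite !big_nil.
move=> /simple_cons [dp sl]; rewrite !big_cons IH // -mulrDr.
by rewrite (rel_ms_split (definableI dp dD) dA) !setIA.
Qed.

Lemma simple_pos l : simple l ->
  (forall x, B x -> 0 <= \sum_(p <- l) p.1 * ind p.2 x) ->
  0 <= \sum_(p <- l) p.1 * rel_ms B p.2.
Proof.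
move=> sl pos; have := @simple_pos_aux l setT 0 sl (def0_dfn (@def0T _ N c)).
rewrite mul0r add0r; under eq_bigr do rewrite setIT.
by apply=> x Bx _; rewrite add0r; apply: pos.
Qed.

Definition is_integ (F : tup N c -> R) (r : R) : Prop :=
  exists l, [/\ simple l,
    forall x, B x -> F x = \sum_(p <- l) p.1 * ind p.2 x
    & r = \sum_(p <- l) p.1 * rel_ms B p.2].

Lemma is_integ_lin F G r s a b : is_integ F r -> is_integ G s ->
  is_integ (fun x => a * F x + b * G x) (a * r + b * s).
Proof.
move=> [l [sl hl ->]] [l' [sl' hl' ->]].
pose sc (k : R) (l : seq (R * set (tup N c))) := [seq (k * p.1, p.2) | p <- l].
have ssc k l0 : simple l0 -> simple (sc k l0).
  by move=> h0 p /List.in_map_iff [q [<- /h0]].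
have Esc k l0 (f : set (tup N c) -> R) :
    \sum_(p <- sc k l0) p.1 * f p.2 = k * \sum_(p <- l0) p.1 * f p.2.
  by rewrite big_map mulr_sumr; apply: eq_bigr => p _; rewrite mulrA.
exists (sc a l ++ sc b l'); split; first by apply: simple_cat; apply: ssc.
  move=> x Bx; rewrite big_cat /= (Esc a l (fun A => ind A x)).
  by rewrite (Esc b l' (fun A => ind A x)) -hl // -hl'.
by rewrite big_cat /= !Esc.
Qed.

Lemma is_integ_ge0 F r : is_integ F r -> (forall x, B x -> 0 <= F x) -> 0 <= r.
Proof.
move=> [l [sl hl ->]] pos; apply: simple_pos => // x Bx.
by rewrite -hl //; apply: pos.
Qed.

Lemma is_integ_le F G r s : is_integ F r -> is_integ G s ->
  (forall x, B x -> F x <= G x) -> r <= s.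
Proof.
move=> hF hG le; have := is_integ_lin 1 (-1) hG hF; move=> /is_integ_ge0.
rewrite mul1r mulN1r subr_ge0; apply=> x Bx; rewrite mul1r mulN1r subr_ge0.
exact: le.
Qed.

Lemma is_integ_ind A : definable A -> is_integ (ind A) (rel_ms B A).
Proof.
move=> dA; exists [:: (1, A)]; split.
- by move=> p [<-|[]].
- by move=> x Bx; rewrite big_seq1 mul1r.
- by rewrite big_seq1 mul1r.
Qed.

Definition integ (F : tup N c -> R) : R := xget 0 [set r | is_integ F r].

(** Two values for the same function are compared in both directions by [is_integ_le]. *)
Lemma integ_eq F r : is_integ F r -> integ F = r.
Proof.
move=> hF; rewrite /integ; case: xgetP => [r' -> hF'|/(_ r)//].
by apply/eqP; rewrite eq_le !(is_integ_le (F := F) (G := F)).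
Qed.

End Base.

Definition fun_over e (a : tup N e) c (F : tup N c -> R) : Prop :=
  forall x x', eqv (hcat x a) (hcat x' a) -> F x = F x'.

Definition param_fun c (F : tup N c -> R) : Prop := exists e (a : tup N e),
  in_sorts S e /\ fun_over a F.

Definition simple_over e (a : tup N e) c (l : seq (R * set (tup N c))) : Prop :=
  forall p, List.In p l -> inv_over a p.2.

(** Such a function is constant on each of the finitely many types over [a]. *)
Lemma fun_over_simple e (a : tup N e) c (F : tup N c -> R) : fun_over a F ->
  exists2 l, simple_over a l & forall x, F x = \sum_(p <- l) p.1 * ind p.2 x.
Proof.
move=> hF.
suff : forall D, inv_over a D -> exists2 l, simple_over a l &
    forall x, F x * ind D x = \sum_(p <- l) p.1 * ind p.2 x.
  move=> /(_ setT) [//|l sl hl]; exists l => // x.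
  by rewrite -hl ind1 // mulr1.
apply: (inv_over_ind ft).
  by exists [::] => // x; rewrite big_nil ind0 // mulr0.
move=> D t hD nDt [l sl hl]; exists ((F t, type_over a t) :: l).
  move=> p [<-|/sl //] x x' xx' tx; exact: eqv_trans xx'.
move=> x; rewrite big_cons /= -hl.
have [tx|ntx] := pselect (type_over a t x).
  have nDx : ~ D x by move=> /hD h1; apply: nDt; apply: h1; exact: eqv_sym.
  by rewrite (ind1 tx) (ind0 nDx) ind1 ?mulr0 ?addr0 ?(hF _ _ tx) //; right.
rewrite (ind0 ntx) mulr0 add0r; congr (_ * _).
by apply: ind_ext; split=> [[]//|?]; left.
Qed.

Lemma param_fun_simple c (F : tup N c -> R) : param_fun F ->
  exists2 l, simple l & forall x, F x = \sum_(p <- l) p.1 * ind p.2 x.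
Proof.
move=> [e [a [he /fun_over_simple [l sl hl]]]]; exists l => // p /sl ip.
by exists e, a.
Qed.

Lemma integP c (B : set (tup N c)) F : param_fun F -> is_integ B F (integ B F).
Proof.
move=> /param_fun_simple [l sl hl].
have hI : is_integ B F (\sum_(p <- l) p.1 * rel_ms B p.2) by exists l; split=> // x _.
rewrite /integ; case: xgetP => [r' -> //|]; by move/(_ _ hI).
Qed.

Lemma is_integ_const c (B : set (tup N c)) (r : R) : base B -> is_integ B (fun=> r) r.
Proof.
move=> bB; have := is_integ_ind B (def0_dfn (@def0T _ N c)).
rewrite rel_ms_base // => hT; have := is_integ_lin r 0 hT hT.
rewrite mulr1 mul0r addr0; move=> [l [sl hl el]]; exists l; split=> // x Bx.
by rewrite -hl //= ind1 // mul0r addr0 mulr1.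
Qed.

Lemma is_integ_sum c (B : set (tup N c)) d (l : seq (R * set (tup N d)))
    (G : set (tup N d) -> tup N c -> R) (g : set (tup N d) -> R) : base B ->
  (forall p, List.In p l -> is_integ B (G p.2) (g p.2)) ->
  is_integ B (fun x => \sum_(p <- l) p.1 * G p.2 x) (\sum_(p <- l) p.1 * g p.2).
Proof.
move=> bB; elim: l => [|p l IH] hl.
  rewrite big_nil; have [l [sl El E]] := is_integ_const 0 bB.
  by exists l; split=> // x Bx; rewrite big_nil -El.
have h1 := hl p (or_introl erefl).
have h2 := IH (fun q ql => hl q (or_intror ql)).
have [l' [sl' El E]] := is_integ_lin p.1 1 h1 h2.
exists l'; split=> //; last by rewrite big_cons -E mul1r.
by move=> x Bx; rewrite big_cons -El // mul1r.
Qed.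

Lemma h_sec_eqv c d e (a : tup N e) (W : set (tup N (c ++ d))) x x' :
  in_sorts S c -> sorts_in d -> in_sorts S e -> inv_over a W ->
  eqv (hcat x a) (hcat x' a) -> [set y | W (hcat x y)] !=set0 ->
  [set y | W (hcat x' y)] !=set0 /\
  h [set y | W (hcat x' y)] = h [set y | W (hcat x y)].
Proof.
move=> oc od oe /(inv_overP ft) [W0 d0 hW] xx'.
pose D := [set z : tup N (d ++ c ++ e) |
  W0 (hcat (hcat (hfst (hsnd z)) (hfst z)) (hsnd (hsnd z)))].
have dD : def0 D.
  by apply: (@def0_pre _ _ (d ++ c ++ e) _ (fun z =>
    hcat (hcat (hfst (hsnd z)) (hfst z)) (hsnd (hsnd z)))) d0; coords.
have E u : [set y | W (hcat u y)] = [set y | D (hcat y (hcat u a))].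
  by apply/seteqP; split=> y; rewrite /D /= !(hfst_hcat, hsnd_hcat) hW.
rewrite !E; apply: h_eqv => //; exact: in_sorts_cat.
Qed.

Lemma ms_at_sec_eqv k c d e (a : tup N e) (W : set (tup N (c ++ d))) x x' :
  in_sorts S c -> sorts_in d -> in_sorts S e -> inv_over a W ->
  eqv (hcat x a) (hcat x' a) ->
  ms_at k [set y | W (hcat x y)] = ms_at k [set y | W (hcat x' y)].
Proof.
move=> oc od oe iW xx'.
have [e0|/set0P ne] := eqVneq [set y | W (hcat x y)] set0.
  have [e1|/set0P ne] := eqVneq [set y | W (hcat x' y)] set0; first by rewrite e0 e1.
  have [[y]] := h_sec_eqv oc od oe iW (eqv_sym xx') ne.
  by move=> Wy; have : [set y | W (hcat x y)] y by []; rewrite e0.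
have [ne' eh] := h_sec_eqv oc od oe iW xx' ne.
by rewrite !ms_atE // /Defs.dm /Defs.ms eh.
Qed.

Definition rect c d (B : set (tup N c)) (C : set (tup N d)) :
    set (tup N (c ++ d)) := [set w | B (hfst w) /\ C (hsnd w)].

Lemma swap_rect c d (B : set (tup N c)) (C : set (tup N d)) :
  @swap d c @^-1` rect B C = rect C B.
Proof.
by apply/seteqP; split=> w; rewrite /rect /swap /= hfst_hcat hsnd_hcat => -[].
Qed.

(** * Fubini for normalised measures *)

Section Fubini.
Variables (c d : seq (Sort L)) (B : set (tup N c)) (C : set (tup N d)).
Hypotheses (bB : base B) (bC : base C).

Lemma rect_base : base (rect B C).
Proof.
have [[oB dB [b Bb]] [oC dC [y Cy]]] := (bB, bC); split.
- exact: sorts_in_cat.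
- exact: def0I (def0_hfst d dB) (def0_hsnd c dC).
- by exists (hcat b y); split; rewrite ?hfst_hcat ?hsnd_hcat.
Qed.

Lemma h_rect : dm (rect B C) = (dm B + dm C)%N /\
  ms (rect B C) = ms B * ms C.
Proof.
have [[oB dB [b Bb]] [oC dC [y Cy]]] := (bB, bC).
have [_ dr nr] := rect_base.
have E : [set x | exists y, rect B C (hcat x y)] = B.
  apply/seteqP; split=> x; first by move=> [y' []]; rewrite hfst_hcat.
  by move=> Bx; exists y; split; rewrite ?hfst_hcat ?hsnd_hcat.
have [x [y' [Bx _]]|h1 h2] := fubini_l oB oC (def0_dfn dr) nr (k := dm C) (nu := ms C).
  rewrite hfst_hcat in Bx; suff -> : [set y | rect B C (hcat x y)] = C.
    by rewrite /Defs.dm /Defs.ms; case: (h C).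
  apply/seteqP; split=> z; first by move=> []; rewrite hsnd_hcat.
  by move=> Cz; split; rewrite ?hfst_hcat ?hsnd_hcat.
by move: h1 h2; rewrite E.
Qed.

Lemma rel_ms_sec_eqv e (a : tup N e) (W : set (tup N (c ++ d))) x x' :
  in_sorts S e -> inv_over a W -> eqv (hcat x a) (hcat x' a) ->
  rel_ms C [set y | W (hcat x y)] = rel_ms C [set y | W (hcat x' y)].
Proof.
move=> oe iW xx'; have [[oB dB _] [oC dC _]] := (bB, bC).
pose W' := W `&` [set w | C (hsnd w)].
have iW' : inv_over a W'.
  have := inv_over_tt (def0_hsnd c dC) => hC.
  move=> w w' ww' [/(iW _ _ ww') h1 h2]; split=> //.
  apply: (eqv_def0 (def0_hsnd c dC) _ h2).
  have cf : coord (fun z : tup N ((c ++ d) ++ e) => hfst z) by coords.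
  by have := eqv_coord cf ww'; rewrite !hfst_hcat.
have E u : [set y | W (hcat u y)] `&` C = [set y | W' (hcat u y)].
  by apply/seteqP; split=> y; rewrite /W' /= hsnd_hcat.
by rewrite /rel_ms !E (ms_at_sec_eqv _ (proj1 oB) oC oe iW' xx').
Qed.

(** Over a single type the sections of [W] are all empty or share one dimension and measure, which
    is the hypothesis of the Fubini axiom. *)
Lemma rel_ms_rect_type e (a : tup N e) (W : set (tup N (c ++ d))) t :
  in_sorts S e -> inv_over a W -> B t ->
  rel_ms (rect B C) (W `&` [set w | type_over a t (hfst w)]) =
  rel_ms C [set y | W (hcat t y)] * rel_ms B (type_over a t).
Proof.
move=> oe iW Bt; have [[oB dB _] [oC dC _]] := (bB, bC).
have dW : definable W by exists e, a.
pose T := type_over a t; have dT : definable T by exact: definable_type_over.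
have TB : T `<=` B.
  move=> x tx; apply: (eqv_def0 dB _ Bt).
  have cf : coord (fun z : tup N (c ++ e) => hfst z) by coords.
  by have := eqv_coord cf tx; rewrite !hfst_hcat.
pose V := W `&` [set w | T (hfst w)] `&` [set w | C (hsnd w)].
have dV : definable V.
  apply: definableI; last exact: def0_dfn (def0_hsnd c dC).
  by apply: definableI => //; apply: (@definable_pre _ _ (fun w => hfst w)) dT; coords.
have EV : W `&` [set w | type_over a t (hfst w)] `&` rect B C = V.
  apply/seteqP; split=> w; first by move=> [h1 [_ ?]].
  by move=> [[h1 h2] h3]; split=> //; split=> //; apply: TB.
have Esec x : T x -> [set y | V (hcat x y)] = [set y | W (hcat x y)] `&` C.
  move=> Tx; apply/seteqP; split=> y; rewrite /V /= hfst_hcat hsnd_hcat.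
    by move=> [[]].
  by move=> [].
pose W' := W `&` [set w | C (hsnd w)].
have iW' : inv_over a W'.
  move=> w w' ww' [/(iW _ _ ww') h1 h2]; split=> //.
  apply: (eqv_def0 (def0_hsnd c dC) _ h2).
  have cf : coord (fun z : tup N ((c ++ d) ++ e) => hfst z) by coords.
  by have := eqv_coord cf ww'; rewrite !hfst_hcat.
have E u : [set y | W' (hcat u y)] = [set y | W (hcat u y)] `&` C.
  by apply/seteqP; split=> y; rewrite /W' /= hsnd_hcat.
have Tt : T t by exact: eqv_refl.
rewrite {1}/rel_ms EV.
have [e0|/set0P ne] := eqVneq ([set y | W (hcat t y)] `&` C) set0.
  rewrite (rel_ms_disj e0) mul0r; suff -> : V = set0 by rewrite ms_at0 mul0r.
  rewrite -subset0 => w [[Ww Tw] Cw].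
  have : [set y | W' (hcat (hfst w) y)] !=set0.
    by exists (hsnd w); rewrite E /= hcat_hfst_hsnd.
  move=> /(h_sec_eqv (proj1 oB) oC oe iW' (eqv_sym Tw)) [[y]].
  by rewrite E e0.
pose v := h ([set y | W (hcat t y)] `&` C).
have hx x : T x -> [set y | V (hcat x y)] !=set0 /\ h [set y | V (hcat x y)] = v.
  move=> Tx; rewrite (Esec x Tx) -E /v -E.
  by apply: (h_sec_eqv (proj1 oB) oC oe iW' Tx); rewrite E.
have EP : [set x | exists y, V (hcat x y)] = T.
  apply/seteqP; split=> x; first by move=> [y [[_]]]; rewrite /= hfst_hcat.
  by move=> /hx [[y Vy] _]; exists y.
have nV : V !=set0 by have [[y Vy] _] := hx t Tt; exists (hcat t y).
have [x [y [[_ Tx] _]]|h1 h2] := fubini_l oB oC dV nV (k := v.1) (nu := v.2).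
  rewrite /= hfst_hcat in Tx; have [_ ->] := hx x Tx.
  by case: v {hx}.
rewrite EP in h1 h2; have [r1 r2] := h_rect.
have nT : T !=set0 by exists t.
rewrite /rel_ms !ms_atE //; last by exists t.
have -> : T `&` B = T by exact/setIidl.
have -> : dm ([set y | W (hcat t y)] `&` C) = v.1 by [].
have -> : ms ([set y | W (hcat t y)] `&` C) = v.2 by [].
have l1 : (dm T <= dm B)%N by apply: dm_sub => //; exact: def0_dfn.
have l2 : (v.1 <= dm C)%N.
  have dWt : definable [set y | W (hcat t y)] by apply: definable_secr (proj1 oB) dW.
  by have := le_dim_base bC dWt ne.
have [msB msC] := (base_gt0 bB, base_gt0 bC).
rewrite h1 h2 r1 r2.
(* A section of dimension less than that of [C] keeps the whole piece below the dimension of the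
   rectangle, so both sides are 0. *)
have [e1|n1] := eqVneq v.1 (dm C).
  rewrite e1 eqn_add2r; case: eqP => _; last by rewrite !mul0r mulr0.
  by field; rewrite !gt_eqF.
rewrite mul0r mul0r; case: eqP => [e2|_]; last by rewrite mul0r.
have : (v.1 < dm C)%N by rewrite ltn_neqAle n1.
by move=> lt; have := leq_add l1 l2; move: e2 l1 lt; lia.
Qed.

(** Both sides are additive in the base, which is exhausted type by type. *)
Lemma rel_ms_fubini_l (W : set (tup N (c ++ d))) : definable W ->
  is_integ B (fun x => rel_ms C [set y | W (hcat x y)]) (rel_ms (rect B C) W).
Proof.
move=> [e [a [oe iW]]]; have [[oB dB nB] [oC dC _]] := (bB, bC).
have dW : definable W by exists e, a.
suff : forall D, inv_over a D -> D `<=` B -> exists l, [/\ simple l,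
    forall x, B x -> rel_ms C [set y | W (hcat x y)] * ind D x =
      \sum_(p <- l) p.1 * ind p.2 x
    & rel_ms (rect B C) (W `&` [set w | D (hfst w)]) =
      \sum_(p <- l) p.1 * rel_ms B p.2].
  have iB : inv_over a B.
    move=> x x' xx' Bx; apply: (eqv_def0 dB _ Bx).
    have cf : coord (fun z : tup N (c ++ e) => hfst z) by coords.
    by have := eqv_coord cf xx'; rewrite !hfst_hcat.
  move=> /(_ B iB) [//|l [sl h1 h2]]; exists l; split=> //.
    by move=> x Bx; rewrite -h1 // ind1 // mulr1.
  by rewrite -h2; apply: rel_ms_ext => w [Bw _]; split=> // -[].
apply: (inv_over_ind ft).
  move=> _; exists [::]; split=> //.
    by move=> x _; rewrite big_nil ind0 // mulr0.
  by rewrite big_nil rel_ms_disj // -subset0 => w [[_ []]].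
move=> D t iD nDt IH DB.
have [|l [sl h1 h2]] := IH; first by move=> x Dx; apply: DB; left.
have Bt : B t by apply: DB; right; exact: eqv_refl.
have disj x : type_over a t x -> ~ D x.
  by move=> tx /iD h3; apply: nDt; apply: h3; exact: eqv_sym.
exists ((rel_ms C [set y | W (hcat t y)], type_over a t) :: l); split.
- by apply/simple_cons; split=> //; apply: definable_type_over.
- move=> x Bx; rewrite big_cons -h1 //=.
  have [tx|ntx] := pselect (type_over a t x).
    rewrite (ind1 tx) (ind0 (disj x tx)) ind1; last by right.
    by rewrite mulr0 addr0 !mulr1 (rel_ms_sec_eqv oe iW tx).
  rewrite (ind0 ntx) mulr0 add0r; congr (_ * _).
  by apply: ind_ext; split=> [[]//|?]; left.
- rewrite big_cons -h2 /= -(rel_ms_rect_type oe iW Bt) addrC -rel_msU.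
  + by apply: rel_ms_ext => w _; split=> [[? [?|?]]|[[? ?]|[? ?]]];
      [left|right|split=> //; left|split=> //; right].
  + exact: rect_base.
  + apply: definableI => //; apply: (@definable_pre _ _ (fun w => hfst w)); first by coords.
    by exists e, a.
  + apply: definableI => //; apply: (@definable_pre _ _ (fun w => hfst w)); first by coords.
    exact: definable_type_over.
  + by rewrite -subset0 => w [[[_ Dw] [_ /disj]]].
Qed.

End Fubini.

Lemma rel_ms_swap c d (B : set (tup N c)) (C : set (tup N d)) W :
  base B -> base C -> definable W ->
  rel_ms (rect C B) (@swap d c @^-1` W) = rel_ms (rect B C) W.
Proof.
move=> bB bC dW; have [[oB dB [b Bb]] [oC dC [y Cy]]] := (bB, bC).
have bR := rect_base bB bC; have [oR dR nR] := bR.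
have hR : h (rect C B) = h (rect B C).
  by rewrite -swap_rect; apply: h_swap => //; exact: def0_dfn.
rewrite /rel_ms /Defs.dm /Defs.ms hR -[in X in ms_at _ X / _ = _]swap_rect -preimage_setI.
have [->|/set0P ne] := eqVneq (W `&` rect B C) set0.
  by rewrite preimage_set0 !ms_at0.
have dV : definable (W `&` rect B C) by apply: definableI => //; exact: def0_dfn.
have nV : @swap d c @^-1` (W `&` rect B C) !=set0.
  by case: ne => w Ww; exists (swap w); rewrite /preimage /= swapK.
by rewrite !ms_atE // /Defs.dm /Defs.ms h_swap.
Qed.

Lemma rel_ms_fubini_r c d (B : set (tup N c)) (C : set (tup N d)) W :
  base B -> base C -> definable W ->
  is_integ C (fun y => rel_ms B [set x | W (hcat x y)]) (rel_ms (rect B C) W).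
Proof.
move=> bB bC dW; rewrite -(rel_ms_swap bB bC dW).
have dW' : definable (@swap d c @^-1` W) by apply: definable_pre dW; exact: coord_swap.
have [l [sl h1 h2]] := rel_ms_fubini_l bC bB dW'; exists l; split=> // y Cy.
rewrite -h1 //; congr rel_ms; apply/seteqP; split=> x;
  by rewrite /= /swap hfst_hcat hsnd_hcat.
Qed.

Lemma is_integ_ind_sum c (C : set (tup N c)) e (l : seq (R * set (tup N e)))
    (f : tup N c -> tup N e) : base C ->
  (forall p, List.In p l -> definable (f @^-1` p.2)) ->
  is_integ C (fun y => \sum_(p <- l) p.1 * ind p.2 (f y))
        (\sum_(p <- l) p.1 * rel_ms C (f @^-1` p.2)).
Proof.
move=> bC hl; apply: (@is_integ_sum _ C _ l (fun A y => ind A (f y))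
  (fun A => rel_ms C (f @^-1` A))) => // p /hl hp.
exact: (is_integ_ind C hp).
Qed.

(** Both iterated integrals equal the same combination of measures of subsets of the rectangle. *)
Lemma fubini c d (B : set (tup N c)) (C : set (tup N d))
    (F : tup N (c ++ d) -> R) : base B -> base C -> param_fun F ->
  integ B (fun x => integ C (fun y => F (hcat x y))) =
  integ C (fun y => integ B (fun x => F (hcat x y))).
Proof.
move=> bB bC /param_fun_simple [l sl hF].
have oc := proj1 (base_sorts bB); have od := proj1 (base_sorts bC).
have E1 x : integ C (fun y => F (hcat x y)) =
    \sum_(p <- l) p.1 * rel_ms C [set y | p.2 (hcat x y)].
  apply: (integ_eq bC).
  have -> : (fun y => F (hcat x y)) = (fun y => \sum_(p <- l) p.1 * ind p.2 (hcat x y)).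
    by apply/funext => y; rewrite hF.
  apply: is_integ_ind_sum => //.
  by move=> p /sl; apply: definable_secr.
have E2 y : integ B (fun x => F (hcat x y)) =
    \sum_(p <- l) p.1 * rel_ms B [set x | p.2 (hcat x y)].
  apply: (integ_eq bB).
  have -> : (fun x => F (hcat x y)) = (fun x => \sum_(p <- l) p.1 * ind p.2 (hcat x y)).
    by apply/funext => x; rewrite hF.
  apply: (@is_integ_ind_sum _ B _ l (fun x => hcat x y)) => //.
  by move=> p /sl; apply: definable_secl.
under eq_fun do rewrite E1; under [in RHS]eq_fun do rewrite E2.
transitivity (\sum_(p <- l) p.1 * rel_ms (rect B C) p.2).
  apply: (integ_eq bB).
  apply: (@is_integ_sum _ B _ l (fun W x => rel_ms C [set y | W (hcat x y)])) => // p /sl.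
  exact: rel_ms_fubini_l.
symmetry; apply: (integ_eq bC).
apply: (@is_integ_sum _ C _ l (fun W y => rel_ms B [set x | W (hcat x y)])) => // p /sl.
exact: rel_ms_fubini_r.
Qed.

Lemma integ_eqv c e (B : set (tup N c)) (F : tup N (c ++ e) -> R) a a' :
  base B -> in_sorts S e -> (forall z z', eqv z z' -> F z = F z') ->
  eqv a a' ->
  integ B (fun x => F (hcat x a)) = integ B (fun x => F (hcat x a')).
Proof.
move=> bB oe iF aa'; have [oB dB nB] := bB.
have : fun_over (tt : tup N [::]) F.
  move=> z z' zz'; apply: iF.
  have cf : coord (fun z : tup N ((c ++ e) ++ [::]) => hfst z) by coords.
  by have := eqv_coord cf zz'; rewrite !hfst_hcat.
move=> /fun_over_simple [l sl hF].
have d0 p : List.In p l -> def0 p.2.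
  move=> /sl ip; apply: (inv_def0 ft) => z z' zz'; apply: ip.
  have cf : coord (fun z : tup N (c ++ e) => hcat z (tt : tup N [::])) by coords.
  exact: (eqv_coord cf zz').
have E u : integ B (fun x => F (hcat x u)) =
    \sum_(p <- l) p.1 * rel_ms B [set x | p.2 (hcat x u)].
  apply: (integ_eq bB).
  have -> : (fun x => F (hcat x u)) = (fun x => \sum_(p <- l) p.1 * ind p.2 (hcat x u)).
    by apply/funext => x; rewrite hF.
  apply: (@is_integ_ind_sum _ B _ l (fun x => hcat x u)) => //.
  by move=> p /d0 /def0_dfn; apply: definable_secl.
rewrite !E {E hF sl}; elim: l d0 => [|p l IH] d0; first by rewrite !big_nil.
rewrite !big_cons IH; last by move=> q ql; apply: d0; right.
congr (_ * _ + _).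
have dp : def0 (p.2 `&` [set z | B (hfst z)]).
  by apply: def0I; [apply: d0; left|exact: def0_hfst].
have E u : [set x | p.2 (hcat x u)] `&` B =
    [set x | (p.2 `&` [set z | B (hfst z)]) (hcat x u)].
  by apply/seteqP; split=> x /=; rewrite hfst_hcat.
have hh := h_eqv oB oe dp.
rewrite /rel_ms !E; congr (_ / _).
have [e0|/set0P ne] := eqVneq [set x | (p.2 `&` [set z | B (hfst z)]) (hcat x a)] set0.
  have [e1|/set0P ne] :=
      eqVneq [set x | (p.2 `&` [set z | B (hfst z)]) (hcat x a')] set0.
    by rewrite e0 e1.
  have [[y]] := hh _ _ (eqv_sym aa') ne.
  by move=> py; have : [set x | (p.2 `&` [set z | B (hfst z)]) (hcat x a)] y by []; rewrite e0.
have [ne' eh] := hh _ _ aa' ne.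
by rewrite !ms_atE // /Defs.dm /Defs.ms eh.
Qed.

(** The type of a generic [b] over [a] has positive measure and [F] is constant on it, so a non-zero
    value would contribute to the integral. *)
Lemma integ_eq0 c e (B : set (tup N c)) (F : tup N c -> R) (a : tup N e) b :
  base B -> in_sorts S e -> fun_over a F -> (forall x, B x -> 0 <= F x) ->
  integ B F = 0 -> B b -> dm (type_over a b) = dm B -> F b = 0.
Proof.
move=> bB oe iF pos int0 Bb db; have [oB dB nB] := bB.
have dT : definable (type_over a b) by exact: definable_type_over.
have TB : type_over a b `<=` B.
  move=> x tx; apply: (eqv_def0 dB _ Bb).
  have cf : coord (fun z : tup N (c ++ e) => hfst z) by coords.
  by have := eqv_coord cf tx; rewrite !hfst_hcat.
have nT : type_over a b !=set0 by exists b; exact: eqv_refl.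
have mT : 0 < rel_ms B (type_over a b).
  rewrite /rel_ms (_ : _ `&` _ = type_over a b); last exact/setIidl.
  rewrite ms_atE // db eqxx; apply: divr_gt0; last exact: base_gt0.
  exact: ms_gt0.
have h1 := is_integ_lin (F b) 0 (is_integ_ind B dT) (is_integ_ind B dT).
have h2 : is_integ B F 0 by rewrite -int0; apply: integP; exists e, a.
have : F b * rel_ms B (type_over a b) + 0 * rel_ms B (type_over a b) <= 0.
  apply: (is_integ_le bB h1 h2) => x Bx; rewrite mul0r addr0.
  have [tx|ntx] := pselect (type_over a b x).
    by rewrite ind1 // mulr1 (iF _ _ tx).
  by rewrite ind0 // mulr0; apply: pos.
rewrite mul0r addr0 pmulr_lle0 // => le.
by apply/eqP; rewrite eq_le le pos.
Qed.

(** The Fubini axiom asks for uniform fibres; here the base is cut into types, on each of which they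
    are uniform. *)
Lemma dm_le c d (W : set (tup N (c ++ d))) k : sorts_in c -> sorts_in d -> definable W ->
  W !=set0 ->
  (forall x, [set y | W (hcat x y)] !=set0 -> (dm [set y | W (hcat x y)] <= k)%N) ->
  (dm W <= dm [set x | exists y, W (hcat x y)] + k)%N.
Proof.
move=> oc od dW nW hk; pose P := [set x | exists y, W (hcat x y)].
have dP : definable P by exact: definable_proj_l.
case: (dW) => e [a [oe iW]].
suff : forall D, inv_over a D -> W `&` [set w | D (hfst w)] !=set0 ->
    (dm (W `&` [set w | D (hfst w)]) <= dm P + k)%N.
  move=> /(_ setT); rewrite (_ : W `&` _ = W); first by apply.
  by apply/seteqP; split=> w // -[].
apply: (inv_over_ind ft); first by case=> w [_ []].
move=> D t iD nDt IH; pose T := type_over a t.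
have dT : definable T by exact: definable_type_over.
have dD : definable D by exists e, a.
pose V := W `&` [set w | T (hfst w)].
have pre (A : set (tup N c)) : definable A -> definable [set w : tup N (c ++ d) | A (hfst w)].
  by move=> dA; apply: (@definable_pre _ _ (fun w => hfst w)) dA; coords.
have dV : definable V by apply: definableI => //; exact: pre.
have lV : V !=set0 -> (dm V <= dm P + k)%N.
  move=> [w0 [Ww0 Tw0]].
  have Ex x : T x -> [set y | V (hcat x y)] = [set y | W (hcat x y)].
    by move=> Tx; apply/seteqP; split=> y; rewrite /V /= hfst_hcat // => -[].
  have n0 : [set y | W (hcat (hfst w0) y)] !=set0.
    by exists (hsnd w0); rewrite /= hcat_hfst_hsnd.
  pose v := h [set y | W (hcat (hfst w0) y)].
  have hx x : T x -> [set y | V (hcat x y)] !=set0 /\ h [set y | V (hcat x y)] = v.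
    move=> Tx; rewrite Ex //; apply: (h_sec_eqv (proj1 oc) od oe iW) n0.
    exact: eqv_trans (eqv_sym Tw0) Tx.
  have [x [y [_ Tx]]|h1 _] := fubini_l oc od dV (k := v.1) (nu := v.2)
      (ex_intro _ w0 (conj Ww0 Tw0)).
    rewrite /= hfst_hcat in Tx; have [_ ->] := hx x Tx; by case: (v).
  rewrite h1; apply: leq_add; last exact: hk.
  apply: dm_sub => //; first exact: definable_proj_l.
    by exists (hfst w0), (hsnd w0); rewrite hcat_hfst_hsnd.
  by move=> x [y [Wy _]]; exists y.
rewrite (_ : W `&` _ = (W `&` [set w | D (hfst w)]) `|` V); last first.
  apply/seteqP; split=> w; first by move=> [? [?|?]]; [left|right].
  by move=> [[? ?]|[? ?]]; split=> //; [left|right].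
have dWD : definable (W `&` [set w | D (hfst w)]) by apply: definableI => //; exact: pre.
have [->|/set0P n1] := eqVneq (W `&` [set w | D (hfst w)]) set0.
  by rewrite set0U.
have [->|/set0P n2] := eqVneq V set0; first by rewrite setU0.
move=> _; rewrite (MS_dimU hS) ?geq_max ?IH ?lV //.
- by apply: definable_Def => //; exact: sorts_in_cat.
- by apply: definable_Def => //; exact: sorts_in_cat.
- rewrite -subset0 => w [[_ Dw] [_ Tw]]; apply: nDt; apply: iD Dw.
  exact: eqv_sym.
Qed.

Definition type0 c (a : tup N c) : set (tup N c) := [set x | eqv a x].

Lemma base_type0 c (a : tup N c) : sorts_in c -> base (type0 a).
Proof.
move=> oc; split=> //; first exact: fin_types_class_def0.
by exists a; exact: eqv_refl.
Qed.

(** Additivity d(ab) = d(a) + d(b/a): the fibres over realisations of tp(a) all have the same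
    value. *)
Lemma dm_pair_l c d (a : tup N c) (b : tup N d) : sorts_in c -> sorts_in d ->
  dm (type0 (hcat a b)) = (dm (type0 a) + dm [set y | type0 (hcat a b) (hcat a y)])%N.
Proof.
move=> oc od; have [oX dX nX] := base_type0 (hcat a b) (sorts_in_cat oc od).
pose v := h [set y | type0 (hcat a b) (hcat a y)].
have hx x : eqv a x -> [set y | type0 (hcat a b) (hcat x y)] !=set0 /\
    h [set y | type0 (hcat a b) (hcat x y)] = v.
  move=> ax; apply: (h_sec_eqv (proj1 oc) od (List.Forall_nil _) (inv_over_tt dX)).
    have cf : coord (fun z : tup N c => hcat z (tt : tup N [::])) by coords.
    exact: (eqv_coord cf ax).
  by exists b; exact: eqv_refl.
have cf : coord (fun z : tup N (c ++ d) => hfst z) by coords.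
have [x [y xy]|-> _] := fubini_l oc od (def0_dfn dX) nX (k := v.1) (nu := v.2).
  have : eqv a x by have := eqv_coord cf xy; rewrite !hfst_hcat.
  by move=> /hx [_ ->]; case: (v).
congr (dm _ + _)%N; apply/seteqP; split=> x; last by move=> /hx [[y]]; exists y.
by move=> [y xy]; have := eqv_coord cf xy; rewrite !hfst_hcat.
Qed.

Lemma dm_pair_r c d (a : tup N c) (b : tup N d) : sorts_in c -> sorts_in d ->
  dm (type0 (hcat a b)) = (dm (type0 b) + dm (type_over b a))%N.
Proof.
move=> oc od; have dX := fin_types_class_def0 ft (hcat a b).
have nX : type0 (hcat a b) !=set0 by exists (hcat a b); exact: eqv_refl.
rewrite /Defs.dm -(h_swap oc od (def0_dfn dX) nX) -/(dm _).
have sw x y : eqv (hcat a b) (hcat x y) <-> eqv (hcat b a) (hcat y x).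
  split=> xy.
    have := eqv_coord (coord_swap c d) xy.
    by rewrite /swap !(hfst_hcat, hsnd_hcat).
  have := eqv_coord (coord_swap d c) xy.
  by rewrite /swap !(hfst_hcat, hsnd_hcat).
have -> : @swap d c @^-1` type0 (hcat a b) = type0 (hcat b a).
  apply/seteqP; split=> w; rewrite /type0 /swap /= sw hcat_hfst_hsnd //.
rewrite -/(dm _) dm_pair_l // /type0; congr (_ + dm _)%N.
by apply/seteqP; split=> x /=; rewrite -sw.
Qed.

(** Otherwise [B] would be a finite union of null types over [a], against its total mass 1. *)
Lemma exists_generic c e (B : set (tup N c)) (a : tup N e) :
  base B -> in_sorts S e -> exists2 b, B b & dm (type_over a b) = dm B.
Proof.
move=> bB oe; have [oB dB nB] := bB; apply: contrapT => no.
have /(_ B) : forall D, inv_over a D -> D `<=` B -> rel_ms B D = 0.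
  apply: (inv_over_ind ft); first by move=> _; rewrite rel_ms_disj // set0I.
  move=> D t iD nDt IH DB; have Bt : B t by apply: DB; right; exact: eqv_refl.
  rewrite rel_msU //.
  - rewrite IH ?add0r; last by move=> x Dx; apply: DB; left.
    rewrite /rel_ms (_ : _ `&` _ = type_over a t); last first.
      by apply/setIidl => x tx; apply: DB; right.
    rewrite ms_atE; last by exists t; exact: eqv_refl.
    by case: eqP => [e1|]; rewrite ?mul0r //; case: no; exists t.
  - by exists e, a.
  - exact: definable_type_over.
  - rewrite -subset0 => x [[Dx tx] _]; apply: nDt; apply: iD Dx; exact: eqv_sym.
rewrite rel_ms_base // => h1; suff : (1 : R) = 0 by move/eqP; rewrite oner_eq0.
apply: h1 => // x x' xx' Bx; apply: (eqv_def0 dB _ Bx).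
have cf : coord (fun z : tup N (c ++ e) => hfst z) by coords.
by have := eqv_coord cf xx'; rewrite !hfst_hcat.
Qed.

End Measure.

(** * Forking and dimension *)

Section Realisations.
Variables (L : lang) (N : structure L).
Implicit Types c d e : seq (Sort L).

Lemma elts_lookup e (b : tup N e) s (x : N s) :
  elts b (existT (car N) s x) -> exists v : var e s, lookup v b = x.
Proof.
elim: e b => [//|s' e IH] [y b] /= [h|/IH [v hv]]; last by exists (vs s' v).
have e1 : s = s' by move: (congr1 (@projT1 _ _) h).
subst s'; rewrite (existT_inj2 h); by exists (vz s e).
Qed.

Lemma elts_pull e (b : tup N e) d (p : tup N d) : elts p `<=` elts b ->
  exists w : htup (var e) d, pull w b = p.
Proof.
elim: d p => [|s d IH] p hp; first by exists tt; case: p hp.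
have [v hv] : exists v : var e s, lookup v b = p.1.
  by apply: elts_lookup; apply: hp; left.
have [w hw] := IH p.2 (fun z hz => hp z (or_intror hz)).
by exists (v, w); rewrite /pull /= hv -/(pull w b) hw; case: p {hp hv hw}.
Qed.

(** The parameters of a formula over [elts b] are entries of [b], possibly repeated or reordered, so
    renaming turns it into a formula about [b] itself. *)
Lemma realisations_tp e (b : tup N e) c (a : tup N c) :
  realisations (tp a (elts b)) = type_over b a.
Proof.
apply/seteqP; split=> x hx.
  suff imp (phi : form (c ++ e)) : sat N phi (hcat a b) -> sat N phi (hcat x b).
    move=> phi; split; first exact: imp.
    move=> h1; apply: contrapT => h2.
    exact: (imp (fimp phi (fbot _)) h2 h1).
  by move=> h1; apply: (hx (PForm phi b)); split.
move=> phi [/elts_pull [w hw]]; rewrite /psat /= -hw.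
have [v hv] : coord (fun z : tup N (c ++ e) => hcat (hfst z) (pull w (hsnd z))).
  apply: coord_hcat; first by coords.
  by apply: (coord_comp (f := fun z => hsnd z)); [coords|exists w].
have E u : hcat u (pull w b) = pull v (hcat u b).
  by rewrite -hv hfst_hcat hsnd_hcat.
by rewrite !E -!sat_ren; apply: (hx _).1.
Qed.

Lemma realisationsU c (p q : set (pform N c)) :
  realisations (p `|` q) = realisations p `&` realisations q.
Proof.
apply/seteqP; split=> x; last by move=> [h1 h2] phi [/h1|/h2].
by move=> hx; split=> phi h1; apply: hx; [left|right].
Qed.

Lemma type_over_tt c (a : tup N c) : type_over (tt : tup N [::]) a = type0 a.
Proof.
have cf : coord (fun z : tup N (c ++ [::]) => hfst z) by coords.
have cg : coord (fun z : tup N c => hcat z (tt : tup N [::])) by coords.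
apply/seteqP; split=> x hx; last exact: (eqv_coord cg hx).
by have := eqv_coord cf hx; rewrite !hfst_hcat.
Qed.

Lemma realisations_tp0 c (a : tup N c) : realisations (tp a set0) = type0 a.
Proof. by rewrite -type_over_tt -realisations_tp. Qed.

Lemma tp0_eqv c (a b : tup N c) : eqv a b -> tp b set0 = tp a set0.
Proof.
move=> ab; apply/seteqP; split=> phi [ov h1]; split=> //.
  exact: (eqv_def0 (over_set0_def0 ov) (eqv_sym ab) h1).
exact: (eqv_def0 (over_set0_def0 ov) ab h1).
Qed.

(** Merges a list of tuples into one parameter tuple, as [type_over] takes a single one. *)
Fixpoint ctxl c (s : seq (tup N c)) : seq (Sort L) :=
  if s is _ :: s' then c ++ ctxl s' else [::].

Fixpoint tupl c (s : seq (tup N c)) : tup N (ctxl s) :=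
  match s with
  | [::] => tt
  | b :: s' => hcat b (tupl s')
  end.

Lemma tupl_coord c (s : seq (tup N c)) b : List.In b s ->
  exists2 f : tup N (ctxl s) -> tup N c, coord f & f (tupl s) = b.
Proof.
elim: s => [//|b' s IH] /= [<-|/IH [f cf <-]].
  by exists (fun z => hfst z); [coords|rewrite hfst_hcat].
exists (fun z => f (hsnd z)); last by rewrite hsnd_hcat.
by apply: coord_comp cf; coords.
Qed.

End Realisations.

(** * A drop in dimension implies forking *)

Section Forking.
Variables (R : realType) (L : lang) (N : structure L) (h : dim_meas R N).
Variable S : set (Sort L).
Hypothesis ft : fin_types N.
Hypothesis hS : MS_measurable_on h S.
Implicit Types c d e : seq (Sort L).
Local Notation dm := (dm h).

Lemma ctxl_sorts c (s : seq (tup N c)) : in_sorts S c -> in_sorts S (ctxl s).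
Proof.
move=> oc; elim: s => [|b s IH] /=; first exact: List.Forall_nil.
exact: in_sorts_cat.
Qed.

Variables (c d : seq (Sort L)) (a0 : tup N c) (b0 : tup N d).
Hypotheses (oc : sorts_in S c) (od : sorts_in S d).
Hypothesis drop : (dm (type_over b0 a0) < dm (type0 a0))%N.

Let phi x y : Prop := eqv (hcat a0 b0) (hcat x y).

(* Double counting of the pairs (x, y) with x in [D], y generic over [p] and
   [phi x y]: its fibres over y have the dimension of [D /\ phi(., b)], its
   fibres over x have dimension less than d(b0). *)
Lemma dim_drop e (p : tup N e) (D : set (tup N c)) b : in_sorts S e ->
  inv_over p D -> eqv b0 b -> dm (type_over p b) = dm (type0 b0) ->
  D `&` [set x | phi x b] !=set0 ->
  (dm (D `&` [set x | phi x b]) < dm D)%N.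
Proof.
move=> oe iD b0b db [x0 [Dx0 px0]].
have bX := base_type0 ft a0 oc; have bY := base_type0 ft b0 od.
pose Q := type_over p b.
have dQ : definable S Q by exact: definable_type_over.
have dD : definable S D by exists e, p.
have dphi : def0 (type0 (hcat a0 b0)) by exact: fin_types_class_def0.
pose W : set (tup N (c ++ d)) :=
  [set w | D (hfst w)] `&` [set w | Q (hsnd w)] `&` type0 (hcat a0 b0).
have dW : definable S W.
  apply: definableI; last exact: def0_dfn.
  apply: definableI.
    by apply: (@definable_pre _ _ _ _ _ (fun w => hfst w)) dD; coords.
  by apply: (@definable_pre _ _ _ _ _ (fun w => hsnd w)) dQ; coords.
have WE x y : W (hcat x y) <-> [/\ D x, Q y & phi x y].
  by rewrite /W /= hfst_hcat hsnd_hcat; split=> [[[]]|[]].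
have nW : W !=set0.
  by exists (hcat x0 b); apply/WE; split=> //; exact: eqv_refl.
have up : (dm W <= dm D + (dm (type0 b0)).-1)%N.
  apply: (@leq_trans (dm [set x | exists y, W (hcat x y)] +
    (dm (type0 b0)).-1)%N); last first.
    rewrite leq_add2r; apply: (dm_sub ft hS oc) => //; first exact: definable_proj_l.
      by exists x0, b; apply/WE; split=> //; exact: eqv_refl.
    by move=> x [y /WE []].
  apply: (dm_le ft hS oc od dW nW) => x [y Wy].
  have [Dx Qy pxy] := (WE _ _).1 Wy.
  have ax : eqv a0 x.
    have cf : coord (fun z : tup N (c ++ d) => hfst z) by coords.
    by have := eqv_coord cf pxy; rewrite !hfst_hcat.
  have [ne eh] : [set y | type0 (hcat a0 b0) (hcat x y)] !=set0 /\
      h [set y | type0 (hcat a0 b0) (hcat x y)] =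
      h [set y | type0 (hcat a0 b0) (hcat a0 y)].
    apply: (h_sec_eqv ft hS (proj1 oc) od (List.Forall_nil _) (inv_over_tt dphi)).
      have cf : coord (fun z : tup N c => hcat z (tt : tup N [::])) by coords.
      exact: (eqv_coord cf ax).
    by exists b0; exact: eqv_refl.
  have le1 : (dm [set y | W (hcat x y)] <=
      dm [set y | type0 (hcat a0 b0) (hcat x y)])%N.
    apply: (dm_sub ft hS od).
    - exact: definable_secr (proj1 oc) dW.
    - exact: definable_secr (proj1 oc) (def0_dfn _ dphi).
    - by exists y.
    - by move=> z /WE [].
  apply: leq_trans le1 _; have -> : dm [set y | type0 (hcat a0 b0) (hcat x y)] =
      dm [set y | type0 (hcat a0 b0) (hcat a0 y)] by rewrite /Defs.dm eh.
  (* Additivity in both orders turns d(a0/b0) < d(a0) into d(b0/a0) < d(b0), which explains the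
     predecessor in the bound. *)
  have := dm_pair_l ft hS a0 b0 oc od; rewrite (dm_pair_r ft hS a0 b0 oc od).
  by move: drop; lia.
have low : dm W = (dm (type0 b0) + dm (D `&` [set x | phi x b]))%N.
  have dW' : definable S (@swap L N d c @^-1` W) by apply: definable_pre dW; exact: coord_swap.
  have nW' : @swap L N d c @^-1` W !=set0.
    by case: nW => w Ww; exists (swap w); rewrite /preimage /= swapK.
  have W'E y x : (@swap L N d c @^-1` W) (hcat y x) <-> W (hcat x y).
    by rewrite /preimage /= /swap hfst_hcat hsnd_hcat.
  pose V : set (tup N (d ++ c)) := [set w | D (hsnd w) /\ phi (hsnd w) (hfst w)].
  have iV : inv_over p V.
    move=> w w' ww' [h1 h2]; split.
      apply: iD h1.
      have cf : coord (fun z : tup N ((d ++ c) ++ e) =>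
        hcat (hsnd (hfst z)) (hsnd z)) by coords.
      by have := eqv_coord cf ww'; rewrite !(hfst_hcat, hsnd_hcat).
    apply: eqv_trans h2 _.
    have cf : coord (fun z : tup N ((d ++ c) ++ e) =>
      hcat (hsnd (hfst z)) (hfst (hfst z))) by coords.
    by have := eqv_coord cf ww'; rewrite !(hfst_hcat, hsnd_hcat).
  have VE y : Q y -> [set x | (@swap L N d c @^-1` W) (hcat y x)] =
      [set x | V (hcat y x)].
    move=> Qy; apply/seteqP; split=> x.
      by move=> /W'E /WE [? _ ?]; rewrite /V /= hfst_hcat hsnd_hcat.
    rewrite /V /= hfst_hcat hsnd_hcat => -[? ?]; apply/W'E/WE; by split.
  have Vb : [set x | V (hcat b x)] = D `&` [set x | phi x b].
    by apply/seteqP; split=> x; rewrite /V /= hfst_hcat hsnd_hcat.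
  have Qb : Q b by exact: eqv_refl.
  pose v := h (D `&` [set x | phi x b]).
  have hy y : Q y -> [set x | (@swap L N d c @^-1` W) (hcat y x)] !=set0 /\
      h [set x | (@swap L N d c @^-1` W) (hcat y x)] = v.
    move=> Qy; rewrite VE // /v -Vb.
    apply: (h_sec_eqv ft hS (proj1 od) oc oe iV Qy).
    by rewrite Vb; exists x0.
  have PQ : [set y | exists x, (@swap L N d c @^-1` W) (hcat y x)] = Q.
    apply/seteqP; split=> y; first by move=> [x /W'E /WE []].
    by move=> /hy [[x Wx] _]; exists x.
  have [y [x /W'E /WE [_ Qy _]]|h1 _] :=
      fubini_l ft hS od oc dW' nW' (k := v.1) (nu := v.2).
    by have [_ ->] := hy y Qy; case: (v).
  rewrite PQ in h1; rewrite -[dm (type0 b0)]db -h1.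
  by rewrite /Defs.dm (h_swap ft hS oc od dW nW).
by move: up low drop; have := dm_pair_l ft hS a0 b0 oc od;
  rewrite (dm_pair_r ft hS a0 b0 oc od); lia.
Qed.

(** [s n] lists the conjugates built before [b n], over which [b n] is chosen generic. *)
Lemma generic_elements : exists b : nat -> tup N d, exists s : nat -> seq (tup N d),
  [/\ forall n, eqv b0 (b n), forall n i, (i < n)%N -> List.In (b i) (s n)
    & forall n, dm (type_over (tupl (s n)) (b n)) = dm (type0 b0)].
Proof.
have bY := base_type0 ft b0 od.
have gen (s : seq (tup N d)) : exists b, eqv b0 b /\
    dm (type_over (tupl s) b) = dm (type0 b0).
  have [b h1 h2] := exists_generic ft hS (tupl s) bY (ctxl_sorts s (proj1 od)).
  by exists b.
pose g s := sval (cid (gen s)).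
pose s := fix s (n : nat) : seq (tup N d) :=
  if n is m.+1 then g (s m) :: s m else [::].
exists (fun n => g (s n)), s; split.
- by move=> n; rewrite /g; case: cid => b [].
- elim=> [//|n IH] i; rewrite ltnS leq_eqVlt => /orP[/eqP ->|/IH]; first by left.
  by right.
- by move=> n; rewrite /g; case: cid => b [].
Qed.

(** The list decreases so that its head is generic over the parameters of its tail; by [dim_drop]
    each element then costs at least one dimension. *)
Lemma inconsistent (b : nat -> tup N d) (s : nat -> seq (tup N d)) :
  (forall n, eqv b0 (b n)) -> (forall n i, (i < n)%N -> List.In (b i) (s n)) ->
  (forall n, dm (type_over (tupl (s n)) (b n)) = dm (type0 b0)) ->
  forall l : seq nat, sorted gtn l -> (dm (type0 a0) < size l)%N ->
    ~ exists x, forall i, i \in l -> phi x (b i).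
Proof.
move=> hb hs hd l.
pose X (l : seq nat) := type0 a0 `&` [set x | forall i, i \in l -> phi x (b i)].
have Xinv (k : seq nat) n : (forall i, i \in k -> (i < n)%N) ->
    inv_over (tupl (s n)) (X k).
  move=> kn x x' xx' [h1 h2]; split.
    apply: eqv_trans h1 _.
    have cf : coord (fun z : tup N (c ++ ctxl (s n)) => hfst z) by coords.
    by have := eqv_coord cf xx'; rewrite !hfst_hcat.
  move=> i ik; apply: eqv_trans (h2 i ik) _.
  have [f cf <-] := tupl_coord (hs n i (kn i ik)).
  have cg : coord (fun z : tup N (c ++ ctxl (s n)) =>
      hcat (hfst z) (f (hsnd z))).
    apply: coord_hcat; first by coords.
    by apply: coord_comp cf; coords.
  by have := eqv_coord cg xx'; rewrite !hfst_hcat !hsnd_hcat.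
have main k : sorted gtn k -> X k !=set0 -> (dm (X k) + size k <= dm (type0 a0))%N.
  elim: k => [|n k IH] sk nX.
    rewrite addn0; suff -> : X [::] = type0 a0 by [].
    by apply/seteqP; split=> x // -[].
  have kn i : i \in k -> (i < n)%N.
    by move: sk; rewrite /= path_sortedE; [move=> /andP[/allP + _] => /(_ i)|
      move=> p q r; rewrite /gtn /=; lia].
  have E : X (n :: k) = X k `&` [set x | phi x (b n)].
    apply/seteqP; split=> x.
      move=> [h1 h2]; split; last by apply: h2; rewrite mem_head.
      by split=> // i ik; apply: h2; rewrite inE ik orbT.
    move=> [[h1 h2] h3]; split=> // i; rewrite inE => /orP[/eqP ->|/h2] //.
  rewrite E in nX *.
  have nXk : X k !=set0 by case: nX => x [Xx _]; exists x.
  have le := IH (path_sorted sk) nXk.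
  have := dim_drop (ctxl_sorts _ (proj1 od)) (Xinv k n kn) (hb n) (hd n) nX.
  by move: le; rewrite /=; lia.
move=> sl lt [x hx].
have ne : X l !=set0.
  exists x; split=> //; case: l lt sl hx => [//|i l] _ _ /(_ i (mem_head _ _)) px.
  have cf : coord (fun z : tup N (c ++ d) => hfst z) by coords.
  by have := eqv_coord cf px; rewrite !hfst_hcat.
by have := main l sl ne; lia.
Qed.

(** The formula isolating the type of the pair already divides, and [N] contains the dividing
    sequence, so the identity embedding and a one-term disjunction suffice. *)
Lemma forks_of_drop : forks set0 (tp a0 (set0 `|` elts b0)).
Proof.
have [chi hchi] := fin_types_class_def0 ft (hcat a0 b0).
pose f := fun (s : Sort L) (x : N s) => x.
have hid e (x : tup N e) : hmap f x = x by exact: hmap_id.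
have fel : elementary f by move=> e psi x; rewrite hid.
have f0 : elt_map f @` (set0 : set (elt N)) = set0 by exact: image_set0.
exists N, f, 1%N, 1%N, (fun=> PForm chi b0), (fun=> PForm chi b0); split.
- exact: fel.
- by move=> _; split; [right|apply/hchi; exact: eqv_refl].
- move=> _; have [b [s [hb hs hd]]] := generic_elements.
  exists N, f, b, (dm (type0 a0)).+1; rewrite !f0; split=> //.
    by move=> i /=; rewrite hid; apply: tp0_eqv.
  move=> j j_inj [x hx].
  pose l := sort geq [seq j i | i <- enum 'I_(dm (type0 a0)).+1].
  apply: (inconsistent hb hs hd (l := l)).
  - rewrite gtn_sorted_uniq_geq sort_uniq sort_sorted; last first.
      by move=> m n; rewrite /geq /= leq_total.
    by rewrite map_inj_uniq // enum_uniq.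
  - by rewrite size_sort size_map size_enum_ord.
  - exists x => i; rewrite mem_sort => /mapP [k _ ->].
    exact/hchi/(hx k).
- move=> x hx; exists ord0; have := hx ord0.
  by rewrite /psat /= hid.
Qed.

End Forking.

(** * Independence for the measure *)

Section Ramsey.
Variable T : Type.

Definition unbounded (A : set nat) : Prop := forall n, exists2 m, (n <= m)%N & A m.

Lemma unbounded_pigeonhole (A : set nat) (f : nat -> T) (l : seq T) :
  unbounded A -> (forall i, List.In (f i) l) ->
  exists v, unbounded (A `&` [set i | f i = v]).
Proof.
move=> uA fl; have {fl} : forall i, A i -> List.In (f i) l by [].
elim: l A uA => [|v l IH] A uA fl.
  by have [m _ /fl] := uA 0%N.
have [u|nu] := pselect (unbounded (A `&` [set i | f i = v])); first by exists v.
have [n hn] := (existsNP _).2 nu.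
have [||w uw] := IH (A `&` [set i | (n <= i)%N]).
- move=> k; have [m hm Am] := uA (maxn n k); exists m.
    by apply: leq_trans hm; exact: leq_maxr.
  by split=> //=; apply: leq_trans hm; exact: leq_maxl.
- move=> i [Ai /= ni]; have [e|//] := fl i Ai.
  by case: hn; exists i => //; split.
- exists w => k; have [m hm [[Am _] /= e]] := uw k; by exists m.
Qed.

(** Successive refinement makes the colour of a pair depend on its smaller element only; a last
    pigeonhole makes it constant. *)
Lemma ramsey (col : nat -> nat -> T) (l : seq T) :
  (forall i j, List.In (col i j) l) ->
  exists g : nat -> nat, exists v,
    (forall i j, (i < j)%N -> (g i < g j)%N /\ col (g i) (g j) = v).
Proof.
move=> hl; pose St := {A : set nat | unbounded A}.
have step (A : St) : exists p : nat * T * St,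
    [/\ sval A p.1.1, sval p.2 `<=` sval A &
      forall j, sval p.2 j -> (p.1.1 < j)%N /\ col p.1.1 j = p.1.2].
  have [a _ Aa] := svalP A 0%N.
  have uA : unbounded (sval A `&` [set j | (a < j)%N]).
    move=> n; have [m hm Am] := svalP A (maxn n a.+1); exists m.
      by apply: leq_trans hm; exact: leq_maxl.
    by split=> //=; apply: leq_trans hm; exact: leq_maxr.
  have [v uv] := unbounded_pigeonhole uA (hl a).
  exists (a, v, exist _ _ uv); split=> //=; first by move=> j [[]].
  by move=> j [[_ ?] ?].
pose nx A := sval (cid (step A)).
have uT : unbounded setT by move=> n; exists n.
pose A := fix A n : St := if n is m.+1 then (nx (A m)).2 else exist _ _ uT.
have hA n : [/\ sval (A n) (nx (A n)).1.1, sval (A n.+1) `<=` sval (A n) &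
    forall j, sval (A n.+1) j -> ((nx (A n)).1.1 < j)%N /\
      col (nx (A n)).1.1 j = (nx (A n)).1.2].
  by rewrite /= /nx; case: cid.
have Asub m n : (m <= n)%N -> sval (A n) `<=` sval (A m).
  elim: n => [|n IH]; first by rewrite leqn0 => /eqP ->.
  rewrite leq_eqVlt => /orP[/eqP -> //|]; rewrite ltnS => /IH h.
  by apply: subset_trans h; have [] := hA n.
pose a n := (nx (A n)).1.1.
have ha m n : (m < n)%N -> (a m < a n)%N /\ col (a m) (a n) = (nx (A m)).1.2.
  move=> mn; have [_ _ h] := hA m; apply: h; apply: (Asub _ _ mn).
  by have [] := hA n.
have [v uv] := unbounded_pigeonhole (f := fun n => (nx (A n)).1.2) uT
  (l := l) (fun n => eq_ind _ (fun t => List.In t l) (hl (a n) (a n.+1)) _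
             (proj2 (ha n n.+1 (leqnn _)))).
have uv' n : exists m, (n <= m)%N /\ (nx (A m)).1.2 = v.
  by have [m h1 [_ h2]] := uv n; exists m.
pose k (n : nat) := sval (cid (uv' n)).
have hk n : (n <= k n)%N /\ (nx (A (k n))).1.2 = v by exact: (svalP (cid (uv' n))).
pose g := fix g n := if n is m.+1 then k (g m).+1 else k 0%N.
have hg n : (nx (A (g n))).1.2 = v by case: n => [|n]; apply: (hk _).2.
have gmono m n : (m < n)%N -> (g m < g n)%N.
  elim: n => [//|n IH]; rewrite ltnS leq_eqVlt => /orP[/eqP ->|/IH h].
    exact: (hk _).1.
  by apply: leq_trans h _; apply: leq_trans (leqnSn _) (hk _).1.
exists (fun n => a (g n)), v => i j /gmono /ha [h1 h2]; split=> //.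
by rewrite h2 hg.
Qed.

End Ramsey.

(** * Invariant functions, integrals and inner products *)

Section Functions.
Variables (R : realType) (L : lang) (N : structure L) (h : dim_meas R N).
Variable S : set (Sort L).
Hypothesis ft : fin_types N.
Hypothesis hS : MS_measurable_on h S.
Implicit Types c d e : seq (Sort L).
Local Notation param_fun := (param_fun S).
Local Notation integ := (integ h S).

Definition inv0 c (F : tup N c -> R) : Prop :=
  forall z z', eqv z z' -> F z = F z'.

Lemma inv0_param_fun c (F : tup N c -> R) : inv0 F -> param_fun F.
Proof.
move=> iF; exists [::], tt; split; first exact: List.Forall_nil.
move=> x x' xx'; apply: iF.
have cf : coord (fun z : tup N (c ++ [::]) => hfst z) by coords.
by have := eqv_coord cf xx'; rewrite !hfst_hcat.
Qed.

Lemma inv0_pre c d (f : tup N c -> tup N d) (F : tup N d -> R) :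
  coord f -> inv0 F -> inv0 (fun z => F (f z)).
Proof. by move=> cf iF z z' /(eqv_coord cf) /iF. Qed.

Lemma inv0_ind c (A : set (tup N c)) : def0 A -> inv0 (ind R A).
Proof.
move=> dA z z' zz'; apply: ind_ext; split; apply: (eqv_def0 dA) => //.
exact: eqv_sym.
Qed.

Lemma inv0_mul c (F G : tup N c -> R) :
  inv0 F -> inv0 G -> inv0 (fun z => F z * G z).
Proof. by move=> iF iG z z' zz'; rewrite (iF _ _ zz') (iG _ _ zz'). Qed.

Lemma inv0_integ c e (B : set (tup N c)) (F : tup N (c ++ e) -> R) :
  base S B -> in_sorts S e -> inv0 F ->
  inv0 (fun a => integ B (fun x => F (hcat x a))).
Proof. by move=> bB oe iF z z'; apply: integ_eqv. Qed.

Lemma param_fun_pre c d (f : tup N c -> tup N d) (F : tup N d -> R) :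
  coord f -> param_fun F -> param_fun (fun z => F (f z)).
Proof.
move=> cf [e [a [oe iF]]]; exists e, a; split=> // x x' xx'; apply: iF.
have cg : coord (fun z : tup N (c ++ e) => hcat (f (hfst z)) (hsnd z)).
  by apply: coord_hcat; [apply: coord_comp cf|]; coords.
by have := eqv_coord cg xx'; rewrite !hfst_hcat !hsnd_hcat.
Qed.

Lemma param_fun2 c d (F : tup N c -> R) (G : tup N d -> R) : param_fun F -> param_fun G ->
  exists e (a : tup N e), [/\ in_sorts S e, fun_over a F & fun_over a G].
Proof.
move=> [e [a [oe iF]]] [e' [a' [oe' iG]]].
exists (e ++ e'), (hcat a a'); split; first exact: in_sorts_cat.
  move=> x x' xx'; apply: iF.
  have cf : coord (fun z : tup N (c ++ e ++ e') =>
    hcat (hfst z) (hfst (hsnd z))) by coords.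
  by have := eqv_coord cf xx'; rewrite !(hfst_hcat, hsnd_hcat).
move=> x x' xx'; apply: iG.
have cf : coord (fun z : tup N (d ++ e ++ e') =>
  hcat (hfst z) (hsnd (hsnd z))) by coords.
by have := eqv_coord cf xx'; rewrite !(hfst_hcat, hsnd_hcat).
Qed.

Lemma param_fun_mul c (F G : tup N c -> R) : param_fun F -> param_fun G ->
  param_fun (fun z => F z * G z).
Proof.
move=> iF iG; have [e [a [oe h1 h2]]] := param_fun2 iF iG; exists e, a; split=> //.
by move=> x x' xx'; rewrite (h1 _ _ xx') (h2 _ _ xx').
Qed.

Lemma param_fun_lin c (F G : tup N c -> R) r : param_fun F -> param_fun G ->
  param_fun (fun z => F z + r * G z).
Proof.
move=> iF iG; have [e [a [oe h1 h2]]] := param_fun2 iF iG; exists e, a; split=> //.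
by move=> x x' xx'; rewrite (h1 _ _ xx') (h2 _ _ xx').
Qed.

Lemma param_fun_cst c (r : R) : param_fun (fun _ : tup N c => r).
Proof. by exists [::], tt; split=> //; exact: List.Forall_nil. Qed.

Lemma param_fun_sub c (F G : tup N c -> R) : param_fun F -> param_fun G ->
  param_fun (fun z => F z - G z).
Proof.
move=> iF iG; have [e [a [oe h1 h2]]] := param_fun2 iF iG; exists e, a; split=> //.
by move=> x x' xx'; rewrite (h1 _ _ xx') (h2 _ _ xx').
Qed.

Lemma param_fun_secl c d (F : tup N (c ++ d) -> R) a : in_sorts S d -> param_fun F ->
  param_fun (fun x => F (hcat x a)).
Proof.
move=> od [e [b [oe iF]]]; exists (d ++ e), (hcat a b).
split; first exact: in_sorts_cat.
move=> x x' xx'; apply: iF.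
have cf : coord (fun z : tup N (c ++ d ++ e) =>
  hcat (hcat (hfst z) (hfst (hsnd z))) (hsnd (hsnd z))) by coords.
by have := eqv_coord cf xx'; rewrite !(hfst_hcat, hsnd_hcat).
Qed.

Lemma param_fun_secr c d (F : tup N (c ++ d) -> R) a : in_sorts S c -> param_fun F ->
  param_fun (fun x => F (hcat a x)).
Proof.
move=> oc iF; have iF' : param_fun (fun z : tup N (d ++ c) => F (swap z)).
  by apply: param_fun_pre iF; exact: coord_swap.
have := param_fun_secl a oc iF'.
by under eq_fun do rewrite /swap hfst_hcat hsnd_hcat.
Qed.

Section Integral.
Variables (c : seq (Sort L)) (B : set (tup N c)).
Hypothesis bB : base S B.

Lemma integ_ext F G : param_fun F -> (forall x, B x -> F x = G x) ->
  integ B F = integ B G.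
Proof.
move=> iF FG; symmetry; apply: (integ_eq ft hS bB).
have [l [sl hl e]] := integP h ft B iF; exists l; split=> // x Bx.
by rewrite -FG // hl.
Qed.

Lemma integ_lin F G r : param_fun F -> param_fun G ->
  integ B (fun x => F x + r * G x) = integ B F + r * integ B G.
Proof.
move=> iF iG; apply: (integ_eq ft hS bB).
have := is_integ_lin 1 r (integP h ft B iF) (integP h ft B iG).
rewrite mul1r => -[l [sl hl e]]; exists l; split=> // x Bx.
by rewrite -hl // mul1r.
Qed.

Lemma integ_cst r : integ B (fun=> r) = r.
Proof. by apply: (integ_eq ft hS bB); apply: is_integ_const. Qed.

Lemma integ_scale F r : param_fun F -> integ B (fun x => r * F x) = r * integ B F.
Proof.
move=> iF; have := integ_lin r (param_fun_cst c 0) iF.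
by rewrite integ_cst add0r => <-; congr integ; apply/funext => x; rewrite add0r.
Qed.

Lemma integ_sub F G : param_fun F -> param_fun G ->
  integ B (fun x => F x - G x) = integ B F - integ B G.
Proof.
move=> iF iG; have := integ_lin (-1) iF iG; rewrite mulN1r => <-.
by congr integ; apply/funext => x; rewrite mulN1r.
Qed.

Lemma integ_ge0 F : param_fun F -> (forall x, B x -> 0 <= F x) -> 0 <= integ B F.
Proof. by move=> iF; apply: (is_integ_ge0 ft hS bB (integP h ft B iF)). Qed.

Lemma integ_le F G : param_fun F -> param_fun G -> (forall x, B x -> F x <= G x) ->
  integ B F <= integ B G.
Proof.
by move=> iF iG; apply: (is_integ_le ft hS bB (integP h ft B iF) (integP h ft B iG)).
Qed.

Definition ip (F G : tup N c -> R) : R := integ B (fun x => F x * G x).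

Lemma ipC F G : ip F G = ip G F.
Proof. by congr integ; apply/funext => x; rewrite mulrC. Qed.

Lemma ip_linl F G H r : param_fun F -> param_fun G -> param_fun H ->
  ip (fun x => F x + r * G x) H = ip F H + r * ip G H.
Proof.
move=> iF iG iH; rewrite /ip -integ_lin; [|exact: param_fun_mul..].
by congr integ; apply/funext => x; rewrite mulrDl mulrA.
Qed.

Lemma ip_subl F G H : param_fun F -> param_fun G -> param_fun H ->
  ip (fun x => F x - G x) H = ip F H - ip G H.
Proof.
move=> iF iG iH; rewrite /ip -integ_sub; [|exact: param_fun_mul..].
by congr integ; apply/funext => x; rewrite mulrBl.
Qed.

Lemma ip_ge0 F : param_fun F -> 0 <= ip F F.
Proof.
by move=> iF; apply: integ_ge0 => [|x _]; [exact: param_fun_mul|rewrite -expr2 sqr_ge0].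
Qed.

(* From <w, w> >= 0 for w = phi - (1/2) sum_i <phi, u_i> u_i; this choice
   avoids dividing by D, which may be 0. *)
Lemma bessel (phi : tup N c -> R) (u : nat -> tup N c -> R) (D : R) n :
  param_fun phi -> (forall i, param_fun (u i)) -> (forall i j, i <> j -> ip (u i) (u j) = 0) ->
  (forall i, ip (u i) (u i) = D) -> D <= 2 -> ip phi phi <= 1 ->
  \sum_(i < n) ip phi (u i) ^+ 2 <= 2.
Proof.
move=> iphi iu orth nrm D2 p1.
pose t i := ip phi (u i).
pose w := fix w n : tup N c -> R :=
  if n is m.+1 then (fun x => w m x + - (2^-1 * t m) * u m x) else phi.
have iw m : param_fun (w m) by elim: m => [//|m IH]; exact: param_fun_lin.
have wu m j : (m <= j)%N -> ip (w m) (u j) = t j.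
  elim: m => [//|m IH] mj; rewrite /= ip_linl // IH; last exact: ltnW.
  by rewrite orth ?mulr0 ?addr0 // => e; move: mj; rewrite e ltnn.
have ww m : ip (w m) (w m) = ip phi phi - (1 - D / 4) * \sum_(i < m) t i ^+ 2.
  elim: m => [|m IH]; first by rewrite big_ord0 mulr0 subr0.
  pose v x := w m x + - (2^-1 * t m) * u m x.
  have iv : param_fun v by exact: (iw m.+1).
  have wv : ip (w m) v = ip (w m) (w m) - 2^-1 * t m * t m.
    by rewrite ipC ip_linl // (ipC (u m)) wu // mulNr.
  have uv : ip (u m) v = t m - 2^-1 * t m * D.
    by rewrite ipC ip_linl // wu // nrm mulNr.
  rewrite big_ord_recr -[w m.+1]/v [LHS](@ip_linl (w m) (u m) v) // wv uv IH.
  by rewrite /=; field.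
(* As [D <= 2], the factor [1 - D / 4] is at least 1/2, and half the sum of squares is at most
   [ip phi phi <= 1]. *)
have := ip_ge0 (iw n); rewrite ww -/(t _) => h1.
have s0 : 0 <= \sum_(i < n) t i ^+ 2 by apply: sumr_ge0 => i _; exact: sqr_ge0.
by nra.
Qed.

End Integral.

Lemma fubini2 c d (B : set (tup N c)) (C : set (tup N d)) (K : tup N c -> tup N d -> R) :
  base S B -> base S C -> param_fun (fun z : tup N (c ++ d) => K (hfst z) (hsnd z)) ->
  integ B (fun x => integ C (fun y => K x y)) =
  integ C (fun y => integ B (fun x => K x y)).
Proof.
move=> bB bC iK; have e := fubini ft hS bB bC iK.
transitivity (integ B (fun x => integ C (fun y =>
    K (hfst (hcat x y)) (hsnd (hcat x y))))).
  congr integ; apply/funext => x; congr integ; apply/funext => y.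
  by rewrite hfst_hcat hsnd_hcat.
rewrite e; congr integ; apply/funext => y; congr integ; apply/funext => x.
by rewrite hfst_hcat hsnd_hcat.
Qed.


(** * Overlaps of conjugate types *)

Section Independence.
Variables (c1 c2 c3 : seq (Sort L)) (a1 : tup N c1) (a2 : tup N c2) (a3 : tup N c3).
Hypotheses (o1 : sorts_in S c1) (o2 : sorts_in S c2) (o3 : sorts_in S c3).
(** The form in which acl(0) = dcl(0) enters; it frees the rest of the argument from the structure
    of [Meq]. *)
Hypothesis fer : forall E : tup N c2 -> tup N c2 -> Prop,
  (forall x, E x x) -> (forall x y, E x y -> E y x) ->
  (forall x y z, E x y -> E y z -> E x z) ->
  (forall x y x' y', eqv (hcat x y) (hcat x' y') -> E x y -> E x' y') ->
  ~ (exists s : nat -> tup N c2, forall i j, i <> j -> ~ E (s i) (s j)) ->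
  forall x y, eqv x y -> E x y.

Let Z := type0 a1.
Let Y := type0 a2.
Let X := type0 a3.
Let bZ : base S Z := base_type0 ft a1 o1.
Let bY : base S Y := base_type0 ft a2 o2.
Let bX : base S X := base_type0 ft a3 o3.

Let P1 := ind R (type0 (hcat a3 a1)).
Let P2 := ind R (type0 (hcat a3 a2)).

Let iP1 : inv0 P1.
Proof. by apply: inv0_ind; exact: fin_types_class_def0. Qed.

Let iP2 : inv0 P2.
Proof. by apply: inv0_ind; exact: fin_types_class_def0. Qed.

Lemma ind_01 c (A : set (tup N c)) x : 0 <= ind R A x <= 1.
Proof. by rewrite /ind; case: asbool; rewrite ?lexx ?ler01. Qed.

(** The function f(b, c) of the overview. *)
Definition overlap (b : tup N c1) (y : tup N c2) : R :=
  integ X (fun x => P1 (hcat x b) * P2 (hcat x y)).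

Definition self_overlap (y y' : tup N c2) : R :=
  integ X (fun x => P2 (hcat x y) * P2 (hcat x y')).

(* The squared L^2-distance of [overlap ^~ y] and [overlap ^~ y']. *)
Definition dist2 (y y' : tup N c2) : R :=
  integ Z (fun b => (overlap b y - overlap b y') * (overlap b y - overlap b y')).

Lemma inv0_overlap : inv0 (fun z : tup N (c1 ++ c2) => overlap (hfst z) (hsnd z)).
Proof.
pose F (z : tup N (c3 ++ c1 ++ c2)) : R :=
  P1 (hcat (hfst z) (hfst (hsnd z))) * P2 (hcat (hfst z) (hsnd (hsnd z))).
have iF : inv0 F.
  apply: inv0_mul.
    by apply: (inv0_pre (f := fun z : tup N (c3 ++ c1 ++ c2) =>
      hcat (hfst z) (hfst (hsnd z)))) iP1; coords.
  by apply: (inv0_pre (f := fun z : tup N (c3 ++ c1 ++ c2) =>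
      hcat (hfst z) (hsnd (hsnd z)))) iP2; coords.
have := inv0_integ bX (in_sorts_cat (proj1 o1) (proj1 o2)) iF.
suff -> : (fun a => integ X (fun x => F (hcat x a))) =
  (fun z : tup N (c1 ++ c2) => overlap (hfst z) (hsnd z)) by [].
apply/funext => z; congr integ; apply/funext => x.
by rewrite /F hfst_hcat hsnd_hcat.
Qed.

Lemma inv0_self_overlap :
  inv0 (fun z : tup N (c2 ++ c2) => self_overlap (hfst z) (hsnd z)).
Proof.
pose F (z : tup N (c3 ++ c2 ++ c2)) : R :=
  P2 (hcat (hfst z) (hfst (hsnd z))) * P2 (hcat (hfst z) (hsnd (hsnd z))).
have iF : inv0 F.
  apply: inv0_mul.
    by apply: (inv0_pre (f := fun z : tup N (c3 ++ c2 ++ c2) =>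
      hcat (hfst z) (hfst (hsnd z)))) iP2; coords.
  by apply: (inv0_pre (f := fun z : tup N (c3 ++ c2 ++ c2) =>
      hcat (hfst z) (hsnd (hsnd z)))) iP2; coords.
have := inv0_integ bX (in_sorts_cat (proj1 o2) (proj1 o2)) iF.
suff -> : (fun a => integ X (fun x => F (hcat x a))) =
  (fun z : tup N (c2 ++ c2) => self_overlap (hfst z) (hsnd z)) by [].
apply/funext => z; congr integ; apply/funext => x.
by rewrite /F hfst_hcat hsnd_hcat.
Qed.

Lemma inv0_dist2 : inv0 (fun z : tup N (c2 ++ c2) => dist2 (hfst z) (hsnd z)).
Proof.
pose G (z : tup N (c1 ++ c2 ++ c2)) : R :=
  overlap (hfst z) (hfst (hsnd z)) - overlap (hfst z) (hsnd (hsnd z)).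
have iG : inv0 G.
  move=> z z' zz'; rewrite /G; congr (_ - _).
    have cf : coord (fun z : tup N (c1 ++ c2 ++ c2) =>
      hcat (hfst z) (hfst (hsnd z))) by coords.
    by have := inv0_pre cf inv0_overlap zz'; rewrite !hfst_hcat !hsnd_hcat.
  have cf : coord (fun z : tup N (c1 ++ c2 ++ c2) =>
    hcat (hfst z) (hsnd (hsnd z))) by coords.
  by have := inv0_pre cf inv0_overlap zz'; rewrite !hfst_hcat !hsnd_hcat.
have := inv0_integ bZ (in_sorts_cat (proj1 o2) (proj1 o2)) (inv0_mul iG iG).
suff -> : (fun a => integ Z (fun x => G (hcat x a) * G (hcat x a))) =
  (fun z : tup N (c2 ++ c2) => dist2 (hfst z) (hsnd z)) by [].
apply/funext => z; congr integ; apply/funext => x.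
by rewrite /G hfst_hcat hsnd_hcat.
Qed.

Lemma param_fun_P1 b : param_fun (fun x => P1 (hcat x b)).
Proof. exact: param_fun_secl (proj1 o1) (inv0_param_fun iP1). Qed.

Lemma param_fun_P2 y : param_fun (fun x => P2 (hcat x y)).
Proof. exact: param_fun_secl (proj1 o2) (inv0_param_fun iP2). Qed.

Lemma param_fun_overlap_l y : param_fun (fun b => overlap b y).
Proof.
have := param_fun_secl y (proj1 o2) (inv0_param_fun inv0_overlap).
by under eq_fun do rewrite hfst_hcat hsnd_hcat.
Qed.

Lemma param_fun_overlap_r b : param_fun (fun y => overlap b y).
Proof.
have := param_fun_secr b (proj1 o1) (inv0_param_fun inv0_overlap).
by under eq_fun do rewrite hfst_hcat hsnd_hcat.
Qed.

Lemma eqv_diag c (y y' : tup N c) : eqv y y' -> eqv (hcat y y) (hcat y' y').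
Proof. by apply: (eqv_coord (f := fun z : tup N c => hcat z z)); coords. Qed.

Lemma inv0_2 (K : tup N c2 -> tup N c2 -> R) y z y' z' :
  inv0 (fun w : tup N (c2 ++ c2) => K (hfst w) (hsnd w)) ->
  eqv (hcat y z) (hcat y' z') -> K y z = K y' z'.
Proof. by move=> iK /iK; rewrite !hfst_hcat !hsnd_hcat. Qed.

Lemma self_overlap_01 y y' : 0 <= self_overlap y y' <= 1.
Proof.
have i12 : param_fun (fun x => P2 (hcat x y) * P2 (hcat x y')).
  by apply: param_fun_mul; exact: param_fun_P2.
have h1 x := ind_01 (type0 (hcat a3 a2)) (hcat x y).
have h2 x := ind_01 (type0 (hcat a3 a2)) (hcat x y').
apply/andP; split.
  apply: (integ_ge0 bX) => // x _.
  by apply: mulr_ge0; [case/andP: (h1 x)|case/andP: (h2 x)].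
rewrite -(integ_cst bX 1); apply: (integ_le bX) => //; first exact: param_fun_cst.
move=> x _; rewrite -[X in _ <= X]mul1r.
by apply: ler_pM; [case/andP: (h1 x)|case/andP: (h2 x)|case/andP: (h1 x)|case/andP: (h2 x)].
Qed.

Lemma no_separated_sequence :
  ~ exists s : nat -> tup N c2, (forall i, Y (s i)) /\
      forall i j, i <> j -> dist2 (s i) (s j) <> 0.
Proof.
move=> [s [sY sd]].
have [l hl] := ft (c2 ++ c2).
(* Both numbers depend only on the type of the pair, so there are finitely many colours. *)
pose K (z : tup N (c2 ++ c2)) : R * R :=
  (self_overlap (hfst z) (hsnd z), dist2 (hfst z) (hsnd z)).
have [i j|g [v hg]] := @ramsey _ (fun i j => K (hcat (s i) (s j))) (map K l).
  have [t tl te] := hl (hcat (s i) (s j)).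
  have -> : K (hcat (s i) (s j)) = K t.
    by rewrite /K (inv0_self_overlap te) (inv0_dist2 te).
  exact: List.in_map.
pose c i := s (g i).
have hc i j : (i < j)%N -> self_overlap (c i) (c j) = v.1 /\ dist2 (c i) (c j) = v.2.
  move=> /hg [_]; rewrite /K hfst_hcat hsnd_hcat => e.
  by move: (congr1 fst e) (congr1 snd e).
have sym y y' : self_overlap y y' = self_overlap y' y.
  by congr integ; apply/funext => x; rewrite mulrC.
have hc' i j : i <> j -> self_overlap (c i) (c j) = v.1.
  by move=> /eqP; rewrite neq_ltn => /orP[/hc []//|/hc []]; rewrite sym.
pose be := self_overlap (c 0%N) (c 0%N).
have hbe i : self_overlap (c i) (c i) = be.
  apply: (inv0_2 inv0_self_overlap); apply: eqv_diag.
  exact: eqv_trans (eqv_sym (sY _)) (sY _).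
(* For [i <> j] the four indices in [ip X (u i) (u j)] are distinct, so its four terms are all [v.1]
   and cancel. *)
pose u i (x : tup N c3) : R := P2 (hcat x (c i.*2)) - P2 (hcat x (c i.*2.+1)).
have iu i : param_fun (u i) by apply: param_fun_sub; exact: param_fun_P2.
have ipE F (i : nat) : param_fun F -> ip X F (u i) =
    ip X (fun x => P2 (hcat x (c i.*2))) F - ip X (fun x => P2 (hcat x (c i.*2.+1))) F.
  by move=> iF; rewrite ipC ip_subl //; exact: param_fun_P2.
have so i j : ip X (fun x => P2 (hcat x (c i))) (fun x => P2 (hcat x (c j))) =
    self_overlap (c i) (c j) by [].
have ipu i j : ip X (u i) (u j) =
    (self_overlap (c i.*2) (c j.*2) - self_overlap (c i.*2.+1) (c j.*2)) -
    (self_overlap (c i.*2) (c j.*2.+1) - self_overlap (c i.*2.+1) (c j.*2.+1)).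
  by rewrite (ipE _ j) // !(ipE _ i) ?so //; exact: param_fun_P2.
have orth i j : i <> j -> ip X (u i) (u j) = 0.
  by move=> ij; rewrite ipu !hc' ?subrr //; lia.
have nrm i : ip X (u i) (u i) = 2 * (be - v.1).
  by rewrite ipu !hbe !hc'; [ring|lia|lia].
have D2 : 2 * (be - v.1) <= 2.
  have /andP[_ b1] := self_overlap_01 (c 0%N) (c 0%N).
  have /andP[v0 _] := self_overlap_01 (c 0%N) (c 1%N).
  by move: v0; rewrite hc' // -/be => v0; rewrite -/be in b1; lra.
(* Bessel for [P1 (hcat x b)] as a function of [x], whose inner product with [u i] is a difference
   of overlaps. *)
have bound n b : \sum_(i < n) (overlap b (c i.*2) - overlap b (c i.*2.+1)) ^+ 2 <= 2.
  have p1 : ip X (fun x => P1 (hcat x b)) (fun x => P1 (hcat x b)) <= 1.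
    rewrite -(integ_cst bX 1); apply: (integ_le bX); [|exact: param_fun_cst|].
      by apply: param_fun_mul; exact: param_fun_P1.
    move=> x _; have /andP[h0 h1] := ind_01 (type0 (hcat a3 a1)) (hcat x b).
    by rewrite -[X in _ <= X]mul1r; apply: ler_pM.
  have := bessel bX n (param_fun_P1 b) iu orth nrm D2 p1.
  under eq_bigr => i _.
    rewrite ipE; last exact: param_fun_P1.
    rewrite !(ipC _ _ (fun x => P1 (hcat x b))); over.
  by [].
(* Integrated over [b], each of the [n] squares contributes a [dist2], which is [v.2]. *)
have total n : n%:R * v.2 <= 2.
  pose F n b := \sum_(i < n) (overlap b (c i.*2) - overlap b (c i.*2.+1)) ^+ 2.
  have iD i : param_fun (fun b => (overlap b (c i.*2) - overlap b (c i.*2.+1)) ^+ 2).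
    under eq_fun do rewrite expr2.
    by apply: param_fun_mul; apply: param_fun_sub; exact: param_fun_overlap_l.
  have iF : param_fun (F n) /\ integ Z (F n) = n%:R * v.2.
    rewrite /F; elim: n => [|n [IH1 IH2]].
      have -> : (fun b => \sum_(i < 0) (overlap b (c i.*2) - overlap b (c i.*2.+1)) ^+ 2)
          = fun=> 0 by apply/funext => b; rewrite big_ord0.
      by rewrite integ_cst // mul0r; split=> //; exact: param_fun_cst.
    have E : (fun b => \sum_(i < n.+1) (overlap b (c i.*2) - overlap b (c i.*2.+1)) ^+ 2)
        = fun b => \sum_(i < n) (overlap b (c i.*2) - overlap b (c i.*2.+1)) ^+ 2 +
            1 * (overlap b (c n.*2) - overlap b (c n.*2.+1)) ^+ 2.
      by apply/funext => b; rewrite big_ord_recr mul1r.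
    rewrite E; split; first exact: param_fun_lin.
    rewrite integ_lin // IH2 mul1r -natr1 mulrDl mul1r; congr (_ + _).
    have [_ <-] := hc n.*2 n.*2.+1 (leqnn _).
    by congr integ; apply/funext => b; rewrite expr2.
  rewrite -iF.2 -(integ_cst bZ 2); apply: (integ_le bZ); [exact: iF.1|exact: param_fun_cst|].
  by move=> b _; exact: bound.
have v0 : 0 < v.2.
  have [_ e] := hc 0%N 1%N (leqnn _).
  rewrite lt_def -e; apply/andP; split.
    by apply/eqP; apply: sd; have [+ _] := hg 0%N 1%N (leqnn _); lia.
  apply: (integ_ge0 bZ); last by move=> b _; rewrite -expr2 sqr_ge0.
  by apply: param_fun_mul; apply: param_fun_sub; exact: param_fun_overlap_l.
(* This [n] satisfies [3 < n%:R * v.2], against the bound 2. *)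
have := total (Num.bound (3 / v.2)).
have := archi_boundP (ltW (divr_gt0 (ltr0n R 3) v0)).
by rewrite ltr_pdivrMr // => h1 h2; lra.
Qed.


Lemma dist2_eq0 y y' : Y y -> Y y' -> dist2 y y' = 0.
Proof.
move=> Yy Yy'.
(* [fer] speaks of relations on all tuples, so the complement of [Y] is made one additional
   class. *)
pose E y y' := (~ Y y /\ ~ Y y') \/ [/\ Y y, Y y' & dist2 y y' = 0].
have id2 u v : param_fun (fun b => (overlap b u - overlap b v) * (overlap b u - overlap b v)).
  by apply: param_fun_mul; apply: param_fun_sub; exact: param_fun_overlap_l.
have dsym u v : dist2 u v = dist2 v u.
  by congr integ; apply/funext => b; rewrite -[LHS]mulrNN !opprB.
have dtri u v w : dist2 u v = 0 -> dist2 v w = 0 -> dist2 u w = 0.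
  move=> d1 d2; apply/eqP; rewrite eq_le; apply/andP; split; last first.
    by apply: (integ_ge0 bZ) => // b _; rewrite -expr2 sqr_ge0.
  have i1 := id2 u v; have i2 := id2 v w.
  (* Integrates (p - r)^2 <= 2 (p - q)^2 + 2 (q - r)^2. *)
  suff le : dist2 u w <= 2 * dist2 u v + 2 * dist2 v w.
    by move: le; rewrite d1 d2 !mulr0 addr0.
  rewrite -(integ_scale bZ 2 i1) -(integ_lin bZ 2 _ i2); last first.
    by apply: param_fun_mul => //; exact: param_fun_cst.
  apply: (integ_le bZ) => //.
    by apply: param_fun_lin => //; apply: param_fun_mul => //; exact: param_fun_cst.
  move=> b _; set p := overlap b u; set q := overlap b v; set r := overlap b w.
  have := sqr_ge0 ((p - q) - (q - r)); nra.
have Einv u v u' v' : eqv (hcat u v) (hcat u' v') -> E u v -> E u' v'.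
  move=> e.
  have dY := fin_types_class_def0 ft a2.
  have e1 : eqv u u'.
    have cf : coord (fun z : tup N (c2 ++ c2) => hfst z) by coords.
    by have := eqv_coord cf e; rewrite !hfst_hcat.
  have e2 : eqv v v'.
    have cf : coord (fun z : tup N (c2 ++ c2) => hsnd z) by coords.
    by have := eqv_coord cf e; rewrite !hsnd_hcat.
  move=> [[n1 n2]|[y1 y2 d]]; [left|right; split].
  - by split=> y0; [apply: n1|apply: n2]; apply: (eqv_trans y0); exact: eqv_sym.
  - exact: eqv_trans e1.
  - exact: eqv_trans e2.
  - by rewrite -(inv0_2 inv0_dist2 e).
have : E y y'.
  apply: fer => //; last exact: eqv_trans (eqv_sym Yy) Yy'.
  - move=> x; have [Yx|nYx] := pselect (Y x); [right|by left].
    split=> //; rewrite /dist2 -[RHS](integ_cst bZ 0); congr integ.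
    by apply/funext => b; rewrite subrr mulr0.
  - move=> u v [[? ?]|[? ? ?]]; [by left|right; split=> //].
    by rewrite dsym.
  - move=> u v w [[n1 n2]|[y1 y2 d1]] [[n3 n4]|[y3 y4 d2]] //; first by left.
    by right; split=> //; exact: dtri d1 d2.
  - move=> [s hs]; apply: no_separated_sequence.
    (* At most one term of a separated sequence lies outside [Y], as the complement is a single
       class; the terms up to it are discarded. *)
    have [n hn] : exists n, forall i, Y (s (n + i)%N).
      have [[k nk]|all] := pselect (exists k, ~ Y (s k)).
        exists k.+1 => i; apply: contrapT => ni.
        by apply: (hs k (k.+1 + i)%N) => //; [lia|left].
      by exists 0%N => i; apply: contrapT => ni; apply: all; exists i.
    exists (fun i => s (n + i)%N); split=> // i j ij d.
    by apply: (hs (n + i)%N (n + j)%N) => //; [lia|right].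
by case=> [[]|[]].
Qed.

(** Double counting: by Fubini the two partial integrals have the same mean, and each is constant on
    a complete type. *)
Lemma mean_swap c (a : tup N c) (P : tup N (c3 ++ c) -> R) x :
  sorts_in S c -> inv0 P -> X x ->
  integ (type0 a) (fun b => P (hcat x b)) = integ X (fun x => P (hcat x a)).
Proof.
move=> oc iP Xx; have ba := base_type0 ft a oc.
pose k x := integ (type0 a) (fun b => P (hcat x b)).
have kE : k = fun x => integ (type0 a) (fun b => P (swap (hcat b x))).
  apply/funext => u; congr integ; apply/funext => b.
  by rewrite /swap hfst_hcat hsnd_hcat.
have ik : inv0 k.
  rewrite kE; apply: (inv0_integ (F := fun w => P (swap w))) => //.
    exact: (proj1 o3).
  by apply: inv0_pre iP; exact: coord_swap.
have kx : forall u, X u -> k u = k x.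
  by move=> u Xu; apply: ik; exact: eqv_trans (eqv_sym Xu) Xx.
have e1 : integ X k = integ (type0 a) (fun b => integ X (fun x => P (hcat x b))).
  by have := fubini ft hS bX ba (inv0_param_fun iP).
have e2 : integ X k = k x.
  by rewrite (integ_ext bX (inv0_param_fun ik) kx) integ_cst.
rewrite -[LHS]/(k x) -e2 e1 -[RHS](integ_cst ba).
have iPx : inv0 (fun b => integ X (fun x => P (hcat x b))).
  by apply: inv0_integ => //; exact: (proj1 oc).
apply: (integ_ext ba (inv0_param_fun iPx)) => b ab.
by apply: iPx; exact: eqv_sym.
Qed.

Let lam1 := integ X (fun x => P1 (hcat x a1)).
Let lam2 := integ X (fun x => P2 (hcat x a2)).

(** Once the integrals are exchanged, the inner mean of [P2] over [Y] is the constant [lam2] by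
    [mean_swap]. *)
Lemma mean_overlap_r b : Z b -> integ Y (fun y => overlap b y) = lam1 * lam2.
Proof.
move=> Zb; rewrite -(@fubini2 _ _ X Y (fun x y => P1 (hcat x b) * P2 (hcat x y))) //.
  transitivity (integ X (fun x => lam2 * P1 (hcat x b))).
    symmetry; apply: (integ_ext bX).
      by apply: param_fun_mul; [exact: param_fun_cst|exact: param_fun_P1].
    move=> x Xx; rewrite integ_scale //; last exact: param_fun_secr (proj1 o3) (inv0_param_fun iP2).
    by rewrite (mean_swap a2 o2 iP2 Xx) mulrC.
  rewrite integ_scale //; last exact: param_fun_P1.
  rewrite mulrC; congr (_ * _).
  by apply: (inv0_integ bX (proj1 o1) iP1); exact: eqv_sym.
apply: param_fun_mul.
  by apply: (param_fun_pre (f := fun z => hfst z)) (param_fun_P1 b); coords.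
by under eq_fun do rewrite hcat_hfst_hsnd; exact: inv0_param_fun.
Qed.

Lemma mean_overlap_l y : Y y -> integ Z (fun b => overlap b y) = lam1 * lam2.
Proof.
move=> Yy; rewrite -(@fubini2 _ _ X Z (fun x b => P1 (hcat x b) * P2 (hcat x y))) //.
  transitivity (integ X (fun x => lam1 * P2 (hcat x y))).
    symmetry; apply: (integ_ext bX).
      by apply: param_fun_mul; [exact: param_fun_cst|exact: param_fun_P2].
    move=> x Xx; rewrite (_ : (fun b => _) = fun b => P2 (hcat x y) * P1 (hcat x b));
      last by apply/funext => b; rewrite mulrC.
    rewrite integ_scale //; last exact: param_fun_secr (proj1 o3) (inv0_param_fun iP1).
    by rewrite (mean_swap a1 o1 iP1 Xx) mulrC.
  rewrite integ_scale //; last exact: param_fun_P2.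
  congr (_ * _).
  by apply: (inv0_integ bX (proj1 o2) iP2); exact: eqv_sym.
apply: param_fun_mul; last first.
  by apply: (param_fun_pre (f := fun z => hfst z)) (param_fun_P2 y); coords.
by under eq_fun do rewrite hcat_hfst_hsnd; exact: inv0_param_fun.
Qed.

Lemma overlap_generic : dm h (type_over a2 a1) = dm h Z ->
  overlap a1 a2 = lam1 * lam2.
Proof.
move=> d12; have Ya2 : Y a2 by exact: eqv_refl.
have Za1 : Z a1 by exact: eqv_refl.
pose f y b := overlap b y.
have iff y : param_fun (f y) by exact: param_fun_overlap_l.
pose K := ip Z (f a2) (f a2).
have KK y : Y y -> ip Z (f y) (f y) = K.
  move=> Yy.
  have i2 : inv0 (fun w : tup N (c1 ++ c2) => f (hsnd w) (hfst w) * f (hsnd w) (hfst w)).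
    by apply: inv0_mul; exact: inv0_overlap.
  have E u : integ Z (fun b => f (hsnd (hcat b u)) (hfst (hcat b u)) *
      f (hsnd (hcat b u)) (hfst (hcat b u))) = ip Z (f u) (f u).
    by congr integ; apply/funext => b; rewrite hfst_hcat hsnd_hcat.
  by have := inv0_integ bZ (proj1 o2) i2 (eqv_sym Yy); rewrite !E.
(* Both squared norms are [K], so [dist2 a2 y = 0] expands to 2 K minus twice this inner product. *)
have cross y : Y y -> ip Z (f a2) (f y) = K.
  move=> Yy; have := dist2_eq0 Ya2 Yy.
  rewrite /dist2 -/(ip Z (fun b => f a2 b - f y b) (fun b => f a2 b - f y b)).
  rewrite ip_subl //; last exact: param_fun_sub.
  rewrite !(ipC _ _ (fun b => f a2 b - f y b)) !ip_subl //.
  by rewrite (ipC _ (f y) (f a2)) (KK _ Yy) -/K; lra.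
(* Averaging the constant inner products over [y] replaces [f y] by its mean [lam1 * lam2]. *)
have Kval : K = (lam1 * lam2) ^+ 2.
  have iF : param_fun (fun z : tup N (c1 ++ c2) =>
      f a2 (hfst z) * overlap (hfst z) (hsnd z)).
    apply: param_fun_mul; last exact: inv0_param_fun inv0_overlap.
    by apply: (param_fun_pre (f := fun z => hfst z)) (iff a2); coords.
  have := @fubini2 _ _ Z Y (fun b y => f a2 b * overlap b y) bZ bY iF.
  have -> : integ Y (fun y => integ Z (fun b => f a2 b * overlap b y)) = K.
    rewrite -[RHS](integ_cst bY); symmetry; apply: (integ_ext bY).
      exact: param_fun_cst.
    by move=> y Yy; rewrite -(cross y Yy).
  move=> <-; transitivity (integ Z (fun b => lam1 * lam2 * f a2 b)).
    symmetry; apply: (integ_ext bZ).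
      by apply: param_fun_mul; [exact: param_fun_cst|].
    move=> b Zb; rewrite integ_scale //; last exact: param_fun_overlap_r.
    by rewrite mean_overlap_r // mulrC.
  by rewrite integ_scale // mean_overlap_l // expr2.
(* The squared deviation from the mean has integral 0, hence vanishes at [a1], which is generic over
   [a2] by [d12]. *)
apply/eqP; rewrite -subr_eq0 -sqrf_eq0 expr2; apply/eqP.
pose G b := (f a2 b - lam1 * lam2) * (f a2 b - lam1 * lam2).
have iG : param_fun G by apply: param_fun_mul; apply: param_fun_sub => //; exact: param_fun_cst.
have oG : fun_over a2 G.
  move=> b b' bb'; rewrite /G /f.
  by have := inv0_overlap bb'; rewrite !hfst_hcat !hsnd_hcat => ->.
apply: (integ_eq0 ft hS bZ (proj1 o2) oG _ _ Za1 d12).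
  by move=> b _; rewrite /G -expr2 sqr_ge0.
rewrite -/(ip Z (fun b => f a2 b - lam1 * lam2) (fun b => f a2 b - lam1 * lam2)).
have ic : param_fun (fun _ : tup N c1 => lam1 * lam2) by exact: param_fun_cst.
rewrite ip_subl //; last exact: param_fun_sub.
rewrite !(ipC _ _ (fun b => f a2 b - lam1 * lam2)) !ip_subl // -/K Kval.
have e1 : ip Z (fun=> lam1 * lam2) (f a2) = lam1 * lam2 * (lam1 * lam2).
  by rewrite /ip integ_scale // mean_overlap_l.
rewrite (ipC _ (f a2) (fun=> _)) e1 /ip.
by rewrite /ip integ_cst //; ring.
Qed.

(** If the intersection were empty or of smaller dimension its normalised measure would be 0,
    whereas [lam1 * lam2] is positive; this settles the dimension. *)
Lemma measure_independence :
  dm h (type_over a2 a1) = dm h Z -> dm h (type_over a1 a3) = dm h X ->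
  dm h (type_over a2 a3) = dm h X ->
  dm h (type_over a1 a3 `&` type_over a2 a3) = dm h X /\
  ms h (type_over a1 a3 `&` type_over a2 a3) =
    ms h (type_over a1 a3) * ms h (type_over a2 a3) / ms h X.
Proof.
move=> d12 d13 d23.
have d1 : definable S (type_over a1 a3) by exact: definable_type_over (proj1 o1).
have d2 : definable S (type_over a2 a3) by exact: definable_type_over (proj1 o2).
have X0 := base_gt0 ft hS bX.
have sub c (a : tup N c) : type_over a a3 `<=` X.
  move=> x tx; have cf : coord (fun z : tup N (c3 ++ c) => hfst z) by coords.
  by have := eqv_coord cf tx; rewrite !hfst_hcat.
have nmE c (a : tup N c) : dm h (type_over a a3) = dm h X ->
    rel_ms h X (type_over a a3) = ms h (type_over a a3) / ms h X.
  move=> da; rewrite /rel_ms (_ : _ `&` X = type_over a a3); last exact/setIidl.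
  by rewrite ms_atE ?da ?eqxx //; exists a3; exact: eqv_refl.
have e1 : lam1 = ms h (type_over a1 a3) / ms h X.
  rewrite -nmE //; apply: (integ_eq ft hS bX).
  by have [l [sl hl e]] := is_integ_ind h X d1; exists l; split.
have e2 : lam2 = ms h (type_over a2 a3) / ms h X.
  rewrite -nmE //; apply: (integ_eq ft hS bX).
  by have [l [sl hl e]] := is_integ_ind h X d2; exists l; split.
have e3 : overlap a1 a2 = rel_ms h X (type_over a1 a3 `&` type_over a2 a3).
  apply: (integ_eq ft hS bX).
  have [l [sl hl e]] := is_integ_ind h X (definableI d1 d2); exists l; split=> // x Xx.
  rewrite -hl //.
  have [h1|h1] := pselect (type_over a1 a3 x); last first.
    by rewrite /P1 ind0 // mul0r ind0 // => -[].
  have [h2|h2] := pselect (type_over a2 a3 x); last first.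
    by rewrite /P2 [X in _ * X]ind0 // mulr0 ind0 // => -[].
  by rewrite /P1 /P2 !ind1 // mulr1.
have m1 : 0 < ms h (type_over a1 a3).
  by apply: (ms_gt0 ft hS o3) => //; exists a3; exact: eqv_refl.
have m2 : 0 < ms h (type_over a2 a3).
  by apply: (ms_gt0 ft hS o3) => //; exists a3; exact: eqv_refl.
have := overlap_generic d12; rewrite e3 e1 e2 /rel_ms.
rewrite (_ : _ `&` X = type_over a1 a3 `&` type_over a2 a3); last first.
  by apply/setIidl => x [/sub].
have [->|/set0P ne] := eqVneq (type_over a1 a3 `&` type_over a2 a3) set0.
  rewrite ms_at0 mul0r => /esym e.
  have : 0 < ms h (type_over a1 a3) / ms h X * (ms h (type_over a2 a3) / ms h X).
    by apply: mulr_gt0; apply: divr_gt0.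
  by rewrite e ltxx.
rewrite ms_atE //; case: eqP => [-> e|_]; last first.
  rewrite mul0r => /esym e.
  have : 0 < ms h (type_over a1 a3) / ms h X * (ms h (type_over a2 a3) / ms h X).
    by apply: mulr_gt0; apply: divr_gt0.
  by rewrite e ltxx.
split=> //; apply: (mulIf (invr_neq0 (lt0r_neq0 X0))); rewrite e.
by field; exact: lt0r_neq0.
Qed.

End Independence.

End Functions.

(** The total relations on the powers of one sort give infinitely many sorts, told apart by the
    lengths of their contexts. *)
Lemma infinite_eqsorts (L : lang) (M : structure L) :
  inhabited (Sort L) -> infinite_set [set: Sort (Leq M)].
Proof.
move=> [s0] fin; apply: infinite_nat.
pose phi n : form (nseq n.+1 s0 ++ nseq n.+1 s0) := fimp (fbot _) (fbot _).
have tr n (x : tup M _) : sat M (phi n) x by [].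
pose E n := @EqSort L M (nseq n.+1 s0) (phi n) erefl (fun a => tr n _)
  (fun a b _ => tr n _) (fun a b c _ _ => tr n _).
pose f (s : Sort (Leq M)) : nat :=
  if s is inr E' then (size (es_ctx E')).-1 else 0%N.
apply: sub_finite_set (finite_image f fin) => n _.
by exists (inr (E n)) => //=; rewrite size_nseq.
Qed.

Lemma finite_set_In (T : Type) (l : seq T) : finite_set [set s | List.In s l].
Proof.
elim: l => [|a l IH].
  by rewrite (_ : [set s | _] = set0) //; apply/seteqP; split.
rewrite (_ : [set s | _] = [set a] `|` [set s | List.In s l]).
  by rewrite finite_setU; split.
by apply/seteqP; split=> s [->|]; by [left|right].
Qed.

Lemma dm_of_indep (R : realType) (L : lang) (N : structure L)
    (h : dim_meas R N) (S : set (Sort L)) :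
  fin_types N -> MS_measurable_on h S ->
  forall c d (a : tup N c) (b : tup N d), sorts_in S c -> sorts_in S d -> indep set0 a b ->
  dm h (type_over b a) = dm h (type0 a).
Proof.
move=> ft hS c d a b oc od ind; apply/eqP; rewrite eqn_leq; apply/andP; split.
  apply: (dm_sub ft hS oc).
  - exact: definable_type_over (proj1 od).
  - exact: def0_dfn (fin_types_class_def0 ft a).
  - by exists a; exact: eqv_refl.
  - move=> x tx; have cf : coord (fun z : tup N (c ++ d) => hfst z) by coords.
    by have := eqv_coord cf tx; rewrite !hfst_hcat.
rewrite leqNgt; apply/negP => lt; apply: ind.
exact: (forks_of_drop ft hS oc od lt).
Qed.

(** Symmetry of independence at the level of dimension, from the two ways of adding up d(ab). *)
Lemma dm_indep_sym (R : realType) (L : lang) (N : structure L)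
    (h : dim_meas R N) (S : set (Sort L)) :
  fin_types N -> MS_measurable_on h S ->
  forall c d (a : tup N c) (b : tup N d), sorts_in S c -> sorts_in S d -> indep set0 a b ->
  dm h (type_over a b) = dm h (type0 b).
Proof.
move=> ft hS c d a b oc od ind; have e := dm_of_indep ft hS oc od ind.
have := dm_pair_r ft hS a b oc od; rewrite e (dm_pair_l ft hS a b oc od).
have -> : [set y | type0 (hcat a b) (hcat a y)] = type_over a b.
  have sw x y u v : eqv (hcat (x : tup N c) (u : tup N d)) (hcat y v) ->
      eqv (hcat u x) (hcat v y).
    by move/(eqv_coord (@coord_swap L N c d)); rewrite /swap !(hfst_hcat, hsnd_hcat).
  have sw' x y u v : eqv (hcat (x : tup N d) (u : tup N c)) (hcat y v) ->
      eqv (hcat u x) (hcat v y).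
    by move/(eqv_coord (@coord_swap L N d c)); rewrite /swap !(hfst_hcat, hsnd_hcat).
  by apply/seteqP; split=> y; [exact: sw|exact: sw'].
by lia.
Qed.

Theorem theorem3p6 (R : realType) (F P : Type) (arF : F -> nat) (arP : P -> nat)
    (M : structure (onesorted arF arP)) (h : dim_meas R (Meq M))
    (hMS : MS_measurable h)
    (hcat : omega_categorical (Meq M))
    (hacl : @acl _ (Meq M) set0 = dcl set0)
    (x1 x2 x3 : seq (Sort (Leq M)))
    (a1 : tup (Meq M) x1) (a2 : tup (Meq M) x2) (a3 : tup (Meq M) x3)
    (hx3 : (0 < size x3)%N)
    (h12 : indep set0 a1 a2) (h13 : indep set0 a1 a3) (h23 : indep set0 a2 a3) :
  dm h (realisations (tp a3 (elts a1) `|` tp a3 (elts a2))) =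
    dm h (realisations (tp a3 set0)) /\
  ms h (realisations (tp a3 (elts a1) `|` tp a3 (elts a2))) =
    ms h (realisations (tp a3 (elts a1))) * ms h (realisations (tp a3 (elts a2)))
      / ms h (realisations (tp a3 set0)).
Proof.
have ft : fin_types (Meq M).
  by apply: ryll_nardzewski hcat; apply: infinite_eqsorts; exact: (inhabits tt).
(* The axioms are available on finite sets of sorts; the sets measured have variables and parameters
   in copies of these three contexts. *)
pose S : set (Sort (Leq M)) := [set s | List.In s (x1 ++ x2 ++ x3)].
have hS := hMS S (finite_set_In _).
have o1 : in_sorts S x1.
  by apply/List.Forall_forall => s hs; apply/List.in_app_iff; left.
have o2 : in_sorts S x2.
  apply/List.Forall_forall => s hs.
  by apply/List.in_app_iff; right; apply/List.in_app_iff; left.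
have o3 : sorts_in S x3.
  split=> //; apply/List.Forall_forall => s hs.
  by apply/List.in_app_iff; right; apply/List.in_app_iff; right.
rewrite realisationsU !realisations_tp realisations_tp0.
have ms3 : 0 < ms h (type0 a3) by apply: (base_gt0 ft hS); exact: base_type0.
have sub c (a : tup (Meq M) c) : type_over a a3 `<=` type0 a3.
  move=> x tx.
  have cf : coord (fun z : tup (Meq M) (x3 ++ c) => hfst z) by coords.
  by have := eqv_coord cf tx; rewrite !hfst_hcat.
(* The axioms say nothing of empty contexts. For an empty [a1] the measure formula cancels, and
   d(a3/a2) = d(a3) remains to be shown; an empty [a2] is similar. *)
case: x1 a1 h12 h13 @S hS o1 o2 o3 => [|s1 x1'] b1 i12 i13 S hS o1 o2 o3.
  case: b1 i12 i13 => i12 i13; rewrite type_over_tt.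
  have -> : type0 a3 `&` type_over a2 a3 = type_over a2 a3 by exact/setIidr.
  rewrite [_ * ms h (type_over a2 a3)]mulrC mulfK ?gt_eqF //; split=> //.
  case: x2 a2 i12 h23 @S hS o1 o2 o3 => [|s2 x2'] b2 _ i23 S hS o1 o2 o3.
    by case: b2 i23; rewrite type_over_tt.
  exact: (dm_indep_sym ft hS (conj o2 isT) o3 i23).
have ok1 : sorts_in S (s1 :: x1') by split.
have d13 := dm_indep_sym ft hS ok1 o3 i13.
case: x2 a2 i12 h23 @S hS o1 o2 o3 ok1 => [|s2 x2'] b2 i12 i23 S hS o1 o2 o3 ok1.
  case: b2 i12 i23 => i12 i23; rewrite type_over_tt.
  have -> : type_over b1 a3 `&` type0 a3 = type_over b1 a3 by exact/setIidl.
  by rewrite mulfK ?gt_eqF.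
have ok2 : sorts_in S (s2 :: x2') by split.
apply: (measure_independence ft hS ok1 ok2 o3).
- move=> E E1 E2 E3 E4 E5.
  exact: (finite_equivalence_trivial ft hacl _ E1 E2 E3 E4 E5).
- exact: (dm_of_indep ft hS ok1 ok2 i12).
- exact: d13.
- exact: (dm_indep_sym ft hS ok2 o3 i23).
Qed.
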